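(* Let $n\ge 1$ be an integer, let $\lambda>0$, and suppose $\alpha$ and $p$ satisfy $$\Bigl(p>1\text{ and }0<\alpha<\tfrac{n+2}{2p}\Bigr)\quad\text{or}\quad\Bigl(p=1\text{ and }0<\alpha\le\tfrac{n+2}{2}\Bigr).$$ Then the problem $$(\partial_t-\Delta)^\alpha u\ge u^\lambda\ \text{ in }\mathbb{R}^n\times\mathbb{R},\qquad u=0\ \text{ in }\mathbb{R}^n\times(-\infty,0)$$ has a nontrivial nonnegative solution $u\in Y^p_\alpha$ if and only if $(\lambda,\alpha)\in B\cup D\cup E$, where $$B=\{(\lambda,\alpha):\lambda=1,\ \alpha>0\},$$ $$D=\Bigl\{(\lambda,\alpha):\lambda>1,\ \tfrac{n+2}{2p}\bigl(1-\tfrac1\lambda\bigr)\le\alpha<\tfrac{n+2}{2}\bigl(1-\tfrac1\lambda\bigr)\Bigr\},$$ $$E=\Bigl\{(\lambda,\alpha):\lambda>1,\ 0<\alpha<\tfrac{n+2}{2p}\bigl(1-\tfrac1\lambda\bigr)\Bigr\}.$$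
   Context: For $\alpha>0$ the fractional heat kernel is $$\Phi_\alpha(x,t)=\frac{t^{\alpha-1}}{\Gamma(\alpha)}\frac{1}{(4\pi t)^{n/2}}e^{-|x|^2/(4t)}\ \text{ for } t>0,\qquad \Phi_\alpha(x,t)=0\ \text{ for } t\le 0,\qquad x\in\mathbb{R}^n.$$ $X^p$ is the set of all measurable $f:\mathbb{R}^n\times\mathbb{R}\to\mathbb{R}$ with $\|f\|_{L^p(\mathbb{R}^n\times(-\infty,T))}<\infty$ for all $T\in\mathbb{R}$. Define $$J_\alpha f(x,t)=\iint_{\mathbb{R}^n\times(-\infty,t)}\Phi_\alpha(x-\xi,t-\tau)f(\xi,\tau)\,d\xi\,d\tau,\qquad Y^p_\alpha:=J_\alpha(X^p).$$ When $(p>1$ and $0<\alpha<\frac{n+2}{2p})$ or $(p=1$ and $0<\alpha\le\frac{n+2}{2})$, it is known that $J_\alpha f\in L^p_{\rm loc}(\mathbb{R}^n\times\mathbb{R})$ for $f\in X^p$, that $J_\alpha:X^p\to Y^p_\alpha$ is one-to-one and onto, and that if $f\in X^p$ and $u=J_\alpha f$ then $f=0$ in $\mathbb{R}^n\times(-\infty,0)$ if and only if $u=0$ in $\mathbb{R}^n\times(-\infty,0)$. The operator $(\partial_t-\Delta)^\alpha:Y^p_\alpha\to X^p$ is defined as the inverse of $J_\alpha:X^p\to Y^p_\alpha$. Functions equal almost everywhere are identified, (in)equalities are understood almost everywhere, and ''nontrivial'' means not a.e. equal to $0$. *)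

(* Defs.v *)
From HB Require Import structures.
From mathcomp Require Import all_boot all_order all_algebra.
From mathcomp Require Import all_classical all_reals all_analysis.

Set Implicit Arguments.
Unset Strict Implicit.
Unset Printing Implicit Defensive.

Import Order.TTheory GRing.Theory Num.Theory.
Import numFieldNormedType.Exports.

Local Open Scope classical_set_scope.
Local Open Scope ring_scope.

Lemma sigma_finite_prod d1 d2 (T1 : measurableType d1) (T2 : measurableType d2)
    (R : realType) (m1 : {sigma_finite_measure set T1 -> \bar R})
    (m2 : {sigma_finite_measure set T2 -> \bar R}) :
  sigma_finite [set: T1 * T2] (m1 \x m2)%E.
Proof.
have /sigma_finiteP[F [TF ndF Foo]] := sigma_finiteT m1.
have /sigma_finiteP[G [TG ndG Goo]] := sigma_finiteT m2.
exists (fun n => F n `*` G n).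
  rewrite -setXTT TF TG predeqE => -[x y]; split.
    move=> [/= [n _ Fnx] [k _ Gky]]; exists (maxn n k) => //; split.
    - by move: x Fnx; exact/subsetPset/ndF/leq_maxl.
    - by move: y Gky; exact/subsetPset/ndG/leq_maxr.
  by move=> [n _ []/= ? ?]; split; exists n.
move=> k; have [? ?] := Foo k; have [? ?] := Goo k.
split; first exact: measurableX.
by rewrite product_measure1E// lte_mul_pinfty// ge0_fin_numE.
Qed.

Notation euclid R n := (n.-tuple (measurableTypeR R)).

(* n-dimensional Lebesgue measure, by recursion on n: the image of the product
   of the Lebesgue measures on R and R^n under (a, v) |-> a :: v. *)
Section lebesgue_vec.
Context {R : realType}.
Local Notation vec n := (euclid R n).

Definition vcons n (z : measurableTypeR R * vec n) : vec n.+1 :=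
  [tuple of z.1 :: z.2].

Definition vuncons n (v : vec n.+1) : measurableTypeR R * vec n :=
  (thead v, [tuple of behead v]).

Lemma vconsK n : cancel (@vcons n) (@vuncons n).
Proof. by move=> [a v]; congr pair; exact: val_inj. Qed.

Lemma measurable_vcons n : measurable_fun [set: measurableTypeR R * vec n] (@vcons n).
Proof. exact: measurable_cons. Qed.

Lemma measurable_vuncons n : measurable_fun [set: vec n.+1] (@vuncons n).
Proof.
apply/measurable_fun_pairP; split; first exact: measurable_tnth.
exact: measurable_behead.
Qed.

Section step.
Variables (n : nat) (m : {sigma_finite_measure set (vec n) -> \bar R}).

Definition vstep : set (vec n.+1) -> \bar R :=
  pushforward (lebesgue_measure \x m)%E (@vcons n).

Let vstep0 : vstep set0 = 0%E.
Proof. by rewrite /vstep /pushforward preimage_set0 measure0. Qed.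

Let vstep_ge0 A : (0 <= vstep A)%E.
Proof. by rewrite /vstep /pushforward; exact: measure_ge0. Qed.

Let vstep_sigma_additive : semi_sigma_additive vstep.
Proof.
have mV A : measurable A -> measurable (@vcons n @^-1` A).
  by move=> mA; rewrite -[X in measurable X]setTI; exact: measurable_vcons.
move=> F mF tF mUF; rewrite /vstep /pushforward preimage_bigcup.
apply: measure_semi_sigma_additive => [i||]; first exact: mV.
- apply/trivIsetP => i j _ _ ij; rewrite -preimage_setI.
  by move/trivIsetP : tF => /(_ _ _ _ _ ij) ->//; rewrite preimage_set0.
- by rewrite -preimage_bigcup; exact: mV.
Qed.

HB.instance Definition _ :=
  isMeasure.Build _ _ _ vstep vstep0 vstep_ge0 vstep_sigma_additive.

Lemma vstep_sigma_finite : sigma_finite [set: vec n.+1] vstep.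
Proof.
have [F FT mF] := sigma_finite_prod lebesgue_measure m.
exists (fun i => @vuncons n @^-1` F i).
  by rewrite -preimage_bigcup -FT preimage_setT.
move=> i; have [mFi Fioo] := mF i; split.
  by rewrite -[X in measurable X]setTI; exact: measurable_vuncons.
rewrite /vstep /pushforward.
suff -> : @vcons n @^-1` (@vuncons n @^-1` F i) = F i by [].
by apply/seteqP; split => z /=; rewrite vconsK.
Qed.

HB.instance Definition _ := Measure_isSigmaFinite.Build _ _ _ vstep vstep_sigma_finite.

End step.

Fixpoint lebesgue_vec (n : nat) : {sigma_finite_measure set (vec n) -> \bar R} :=
  if n is m.+1 then vstep (lebesgue_vec m) else \d_([tuple] : vec 0).

Lemma lebesgue_vec_box n (A : 'I_n -> set (measurableTypeR R)) :
  (forall i, measurable (A i)) ->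
  lebesgue_vec n [set v | forall i, A i (tnth v i)] =
  (\prod_(i < n) lebesgue_measure (A i))%E.
Proof.
elim: n A => [|n IH] A mA /=.
  rewrite big_ord0 diracE mem_set//= => -[//].
rewrite /vstep /pushforward big_ord_recl -IH//.
pose B := [set v : vec n | forall i, A (lift ord0 i) (tnth v i)].
have mB : measurable B.
  have -> : B = \bigcap_(i in [set: 'I_n]) ((@tnth n _ ^~ i) @^-1` A (lift ord0 i)).
    by apply/seteqP; split => v /= h i; [move=> _; exact: h | exact: h].
  apply: fin_bigcap_measurable => // i _.
  by rewrite -[X in measurable X]setTI; exact: measurable_tnth.
rewrite -(product_measure1E _ _ (mA _) mB); congr product_measure1.
apply/seteqP; split => -[a v] /=.
  move=> h; split; first exact: (h ord0).
  by move=> i /=; have := h (lift ord0 i); rewrite tnthS.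
move=> [Aa Bv] i; case: (unliftP ord0 i) => [j|] ->; last exact: Aa.
by rewrite tnthS; exact: Bv.
Qed.

End lebesgue_vec.

Notation spacetime R n := (euclid R n * measurableTypeR R)%type.

Section fractional_heat.
Context {R : realType}.

Definition spacetime_measure (n : nat) : {measure set (spacetime R n) -> \bar R} :=
  (@lebesgue_vec R n \x lebesgue_measure)%E.

Definition Gamma (a : R) : R :=
  \int[lebesgue_measure]_(s in `]0, +oo[) (s `^ (a - 1) * expR (- s)).

Definition sqnorm n (x : euclid R n) : R := \sum_(i < n) (tnth x i : R) ^+ 2.

Definition vsub n (x y : euclid R n) : euclid R n :=
  [tuple (tnth x i : R) - tnth y i | i < n].

Definition Phi n (alpha : R) (x : euclid R n) (t : R) : R :=
  if 0 < t then
    t `^ (alpha - 1) / Gamma alpha * ((4 * pi * t) `^ (n%:R / 2))^-1 *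
    expR (- sqnorm x / (4 * t))
  else 0.

(* Extended by the junk value of the integral at points where it diverges; this
   concerns only a null set when f is in [Xspace p] and alpha is admissible. *)
Definition J n (alpha : R) (f : spacetime R n -> R) (z : spacetime R n) : R :=
  \int[spacetime_measure n]_(w in [set w | (w.2 : R) < z.2])
    (Phi alpha (vsub z.1 w.1) ((z.2 : R) - w.2) * f w).

(* Functions are not quotiented by a.e. equality: [Xspace p] consists of Borel
   representatives, while [Yspace p alpha] is closed under a.e. equality. *)
Definition Xspace n (p : R) : set (spacetime R n -> R) :=
  [set f | measurable_fun [set: spacetime R n] f /\
    forall T : R, (Lnorm (spacetime_measure n) p%:E
      (EFin \o (f \_ [set w : spacetime R n | ((w.2 : R) < T)%R])) < +oo)%E].

Definition Yspace n (p alpha : R) : set (spacetime R n -> R) :=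
  [set u | exists2 f, Xspace p f & u = J alpha f %[ae spacetime_measure n]].

(* The operator (d_t - Delta)^alpha : Yspace p alpha -> Xspace p, as the inverse
   of J alpha; the default value is used only outside Yspace p alpha. *)
Definition frac_heat n (p alpha : R) (u : spacetime R n -> R) :
    spacetime R n -> R :=
  xget (cst 0)
    [set f | Xspace p f /\ u = J alpha f %[ae spacetime_measure n]].

Definition nonneg_solution n (p alpha lambda : R) (u : spacetime R n -> R) : Prop :=
  [/\ Yspace p alpha u,
      \forall z \ae spacetime_measure n, 0 <= u z,
      \forall z \ae spacetime_measure n, u z `^ lambda <= frac_heat p alpha u z &
      \forall z \ae spacetime_measure n, (z.2 : R) < 0 -> u z = 0].

Definition regionB : set (R * R) := [set la | la.1 = 1 /\ 0 < la.2].

Definition regionD (n : nat) (p : R) : set (R * R) :=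
  [set la | [/\ 1 < la.1,
    (n%:R + 2) / (2 * p) * (1 - la.1^-1) <= la.2 &
    la.2 < (n%:R + 2) / 2 * (1 - la.1^-1)]].

Definition regionE (n : nat) (p : R) : set (R * R) :=
  [set la | [/\ 1 < la.1, 0 < la.2 &
    la.2 < (n%:R + 2) / (2 * p) * (1 - la.1^-1)]].

End fractional_heat.

(* Main.v *)
(* Injectivity of J.  If J h = 0, integrating J h against a suitable weight and
   using the Beta integral together with the semigroup law of the heat kernel
   shows that all moments of ker h in the variable s / (s + a), s being the
   elapsed time, vanish.  Polynomials approximating the indicator of v < 1/2
   then restrict the memory to s < a; averaging over a box and letting a tend to
   0 gives that h has zero integral over every box, so h = 0.

   Existence.  For lambda = 1 take f = e^t gauss x (t + 1) on t > 0; for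
   lambda > 1 take f = ep (t + 1)^(-b) gauss x (t + 1) on t > 0, with b < 1.
   The potential of f is explicit, and u = J f satisfies u^lambda <= f.

   Nonexistence.  A nontrivial F >= (J F)^lambda has a potential bounded below
   by a Gaussian for large times.  If lambda < 1, iterating the inequality
   flattens the Gaussian without losing mass, so F is not in L^p over a slab.
   If lambda > 1 and alpha is at least (n + 2)/2 (1 - 1/lambda), testing against
   powers of T - t times backward heat kernels and Young's inequality bounds the
   weighted integral of (J F)^lambda over 0 < t < T by C T^(n/2 + 1), whereas the
   Gaussian lower bound makes it at least c T^(n/2 + 1) log T. *)

From HB Require Import structures.
Require Import Defs.
From mathcomp Require Import all_boot all_order all_algebra.
From mathcomp Require Import all_classical all_reals all_analysis.
From mathcomp Require Import measurable_realfun.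
From mathcomp Require Import ring lra.

Import Order.TTheory GRing.Theory Num.Theory.
Import numFieldNormedType.Exports.

Set Implicit Arguments.
Unset Strict Implicit.
Unset Printing Implicit Defensive.

Local Open Scope classical_set_scope.
Local Open Scope ring_scope.

(** * Gaussian integrals in R^n *)

(** Injectivity serves existence twice: [frac_heat] merely chooses some source of u, and only
    uniqueness ties that choice to the explicit f; uniqueness also shows that J f is nontrivial. Its
    proof is shaped by how little is known: J h = 0 and finiteness of the potential of |h| hold at
    almost every point and no more. The factor (s + a)^(-alpha - k) of the weight makes the tested
    kernel a bounded multiple of the kernel at one point z0, so that absolute convergence at z0
    alone justifies Fubini.

    The critical order (n + 2)/2 (1 - 1/lambda) appears from both sides. For existence, homogeneity
    of the inequality asks for b >= lambda alpha/(lambda - 1) - n/2, while the Beta integral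
    bounding the potential needs b < 1. For nonexistence, the lower bound for (J F)^lambda,
    multiplied by the test function and integrated over space, is at least a multiple of 1/t exactly
    when alpha is at least critical. The divergence is then logarithmic at equality, which is why
    equality lies on the side of nonexistence. *)

Section measurable_real_comp.
Context {R : realType} d (T : measurableType d).
Implicit Types f g : T -> R.

Lemma measurable_powR_comp p f : measurable_fun [set: T] f ->
  measurable_fun [set: T] (fun t => f t `^ p).
Proof. by move=> mf; exact: (measurableT_comp (@measurable_powR R p) mf). Qed.

Lemma measurable_inv_comp f : measurable_fun [set: T] f ->
  measurable_fun [set: T] (fun t => (f t)^-1).
Proof.
move=> mf; suff mi : measurable_fun [set: R] (fun x : R => x^-1).
  exact: (measurableT_comp mi mf).
(* Inversion is discontinuous at 0, so each sign is handled by the power -1; at 0 the two terms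
   cancel, in accordance with 0^-1 = 0. *)
have -> : (fun x : R => x^-1) = (fun x =>
    \1_`[0, +oo[ x * x `^ (-1) - \1_`]-oo, 0] x * (- x) `^ (-1)).
  apply/funext => x; rewrite !indicE !mem_setE !in_itv/= !andbT.
  case: (ltgtP x 0) => x0.
  - by rewrite mul0r sub0r mul1r powR_inv1 ?oppr_ge0 ?ltW// invrN opprK.
  - by rewrite mul0r mul1r subr0 powR_inv1 ?ltW.
  - by rewrite x0 oppr0 subrr invr0.
apply: measurable_funB; apply: measurable_funM => //.
exact: (measurableT_comp (@measurable_powR R (-1)) (@oppr_measurable R setT)).
Qed.

Lemma measurable_expR_comp f : measurable_fun [set: T] f ->
  measurable_fun [set: T] (fun t => expR (f t)).
Proof. by move=> mf; exact: (measurableT_comp (@measurable_expR R) mf). Qed.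

Lemma measurable_opp_comp f : measurable_fun [set: T] f ->
  measurable_fun [set: T] (fun t => - f t).
Proof. by move=> mf; exact: (measurableT_comp (@oppr_measurable R setT) mf). Qed.

Lemma measurable_ltr_comp f g : measurable_fun [set: T] f ->
  measurable_fun [set: T] g -> measurable_fun [set: T] (fun t => (f t < g t)%R%:R : R).
Proof.
move=> mf mg; have mb := measurable_fun_ltr mf mg.
have -> : (fun t => (f t < g t)%R%:R : R) = (fun t => if f t < g t then 1 else 0).
  by apply/funext => t; case: ifP.
exact: measurable_fun_ifT.
Qed.

End measurable_real_comp.

Ltac mfun_base := first
  [ assumption | exact: measurable_cst | exact: measurable_id
  | exact: measurable_fst | exact: measurable_snd
  | apply: measurable_ltr_comp | apply: measurable_powR_comp
  | apply: measurable_inv_comp | apply: measurable_expR_comp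
  | apply: measurable_opp_comp
  | apply: measurable_funB | apply: measurable_funD
  | apply: measurable_funM | apply: measurable_funX ].

Ltac mfun := repeat mfun_base.

(** * Affine changes of variable for Lebesgue measure *)

Section affine.
Context {R : realType}.
Local Notation RR := (measurableTypeR R).
Local Notation mu := (@lebesgue_measure R).

Let maff (a b : R) : measurable_fun [set: RR] (fun x : RR => a * x + b : RR).
Proof. by apply: measurable_funD => //; exact: measurable_funM. Qed.

(** By uniqueness of Lebesgue measure: a times its image under x |-> a x + b gives every half-open
    interval its length. *)
Lemma ge0_integral_affine (a b : R) (F : RR -> \bar R) : 0 < a ->
  measurable_fun [set: RR] F -> (forall x, 0 <= F x)%E ->
  (\int[mu]_x F x = a%:E * \int[mu]_x F (a * x + b)%R)%E.
Proof.
move=> a0 mF F0.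
have ai0 : 0 <= a by exact: ltW.
pose f := fun x : RR => a * x + b : RR.
have mf : measurable_fun [set: RR] f by exact: maff.
pose nu := mscale (NngNum ai0) (pushforward mu f).
have E A : measurable A -> mu A = nu mf A.
  apply: lebesgue_measure_unique => _ [[c d] /= cd] <-.
  rewrite /nu /mscale/= /pushforward.
  have -> : f @^-1` `]c, d] = `](c-b)/a, (d-b)/a]%classic.
    apply/seteqP; split => x /=; rewrite !in_itv/= ltr_pdivrMr// ler_pdivlMr//;
      by rewrite ltrBlDr lerBrDr [x * a]mulrC.
  rewrite !lebesgue_measure_itv/= !lte_fin ltr_pM2r ?invr_gt0// ltrD2r.
  case: ifPn => _; last by rewrite mule0.
  rewrite -!EFinD -EFinM; congr EFin; field; exact: lt0r_neq0.
rewrite (eq_measure_integral (nu mf)); last by move=> A mA _; exact: E.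
rewrite ge0_integral_mscale//=.
rewrite (@ge0_integral_pushforward _ _ RR RR R f mf mu setT F)//.
Qed.

Lemma ge0_integral_opp (F : RR -> \bar R) :
  measurable_fun [set: RR] F -> (forall x, 0 <= F x)%E ->
  (\int[mu]_x F x = \int[mu]_x F (- x)%R)%E.
Proof.
move=> mF F0.
pose f := fun x : RR => - x : RR.
have mf : measurable_fun [set: RR] f by exact: oppr_measurable.
have p1 : 0 <= 1 :> R by [].
pose nu := mscale (NngNum p1) (pushforward mu f).
rewrite (eq_measure_integral (nu mf)).
  rewrite ge0_integral_mscale//= mul1e.
  by rewrite (@ge0_integral_pushforward _ _ RR RR R f mf mu setT F).
move=> A mA _; transitivity (pushforward mu f A).
  exact: (esym (lebesgue_measureN mA)).
exact: (esym (mul1e _)).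
Qed.

Lemma ge0_integral_shift (b : R) (F : RR -> \bar R) :
  measurable_fun [set: RR] F -> (forall x, 0 <= F x)%E ->
  (\int[mu]_x F (x + b)%R = \int[mu]_x F x)%E.
Proof.
move=> mF F0; rewrite [RHS](@ge0_integral_affine 1 b)// mul1e.
by under [RHS]eq_integral do rewrite mul1r.
Qed.

Lemma ge0_integral_reflect (b : R) (F : RR -> \bar R) :
  measurable_fun [set: RR] F -> (forall x, 0 <= F x)%E ->
  (\int[mu]_x F (b - x)%R = \int[mu]_x F x)%E.
Proof.
move=> mF F0; rewrite -[RHS](ge0_integral_shift b)// [RHS]ge0_integral_opp//.
- by under [RHS]eq_integral do rewrite addrC.
- apply: measurableT_comp => //; exact: measurable_funD.
Qed.
End affine.

Section gauss1d.
Context {R : realType}.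
Local Notation RR := (measurableTypeR R).
Local Notation mu := (@lebesgue_measure R).

(** The heat kernel at time r, that is, the spatial factor of [Phi]. *)
Definition gauss n (x : euclid R n) (r : R) : R :=
  ((4 * pi * r) `^ (n%:R / 2))^-1 * expR (- sqnorm x / (4 * r)).

Definition gauss1 (s r : R) : R :=
  ((4 * pi * r) `^ (2^-1))^-1 * expR (- s ^+ 2 / (4 * r)).

Lemma gauss1_ge0 s r : 0 <= gauss1 s r.
Proof. by rewrite mulr_ge0 ?invr_ge0 ?powR_ge0 ?expR_ge0. Qed.

Lemma measurable_gauss1_comp d (T : measurableType d) (f g : T -> R) :
  measurable_fun [set: T] f -> measurable_fun [set: T] g ->
  measurable_fun [set: T] (fun t => gauss1 (f t) (g t)).
Proof. by move=> mf mg; rewrite /gauss1; mfun. Qed.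

Lemma gauss1_normal (m s r : R) : 0 < r ->
  gauss1 (s - m) r = normal_pdf m (Num.sqrt (2 * r)) s.
Proof.
move=> r0; have r20 : 0 < 2 * r by rewrite mulr_gt0.
rewrite /gauss1 normal_pdfE ?gt_eqF ?sqrtr_gt0// /normal_peak.
rewrite powR12_sqrt; last by rewrite !mulr_ge0 ?pi_ge0// ltW.
rewrite sqr_sqrtr ?ltW// /normal_fun sqr_sqrtr ?ltW//; congr (_^-1 * expR _).
  by congr Num.sqrt; rewrite -mulr_natr; ring.
by congr (_ / _); rewrite -mulr_natr; ring.
Qed.

Lemma integral_gauss1 (m r : R) : 0 < r ->
  (\int[mu]_s (gauss1 (s - m) r)%:E = 1)%E.
Proof.
move=> r0; under eq_integral do rewrite gauss1_normal//.
exact: integral_normal_pdf.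
Qed.

Lemma integral_gauss1_conv (x y r s : R) : 0 < r -> 0 < s ->
  (\int[mu]_w (gauss1 (x - w) r * gauss1 (w - y) s)%:E = (gauss1 (x - y) (r + s))%:E)%E.
Proof.
move=> r0 s0.
(* Completing the square in w: the product is the Gaussian in x - y at time r + s times a Gaussian
   in w centred at m, at time r s/(r + s), whose integral is 1. *)
pose m := (s * x + r * y) / (r + s).
have rs0 : 0 < r + s by rewrite addr_gt0.
have key w : gauss1 (x - w) r * gauss1 (w - y) s =
    gauss1 (x - y) (r + s) * gauss1 (w - m) (r * s / (r + s)).
  rewrite /gauss1 mulrACA [RHS]mulrACA -!expRD -!invfM -!powRM ?mulr_ge0 ?pi_ge0 ?invr_ge0 ?(ltW r0, ltW s0, ltW rs0)//.
  congr (_^-1 * expR _); last by rewrite /m; field; rewrite !gt_eqF.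
  by congr (_ `^ _); field; rewrite gt_eqF.
under eq_integral do rewrite key EFinM.
rewrite ge0_integralZl//=.
- by rewrite integral_gauss1 ?mule1// divr_gt0// mulr_gt0.
- apply/measurable_EFinP; apply: measurable_gauss1_comp => //.
  exact: measurable_funB.
- by move=> w _; rewrite lee_fin gauss1_ge0.
- by rewrite lee_fin gauss1_ge0.
Qed.

End gauss1d.

Section prod_integral.
Context {R : realType}.
Local Notation RR := (measurableTypeR R).
Local Notation mu := (@lebesgue_measure R).

Lemma ge0_integral_vcons n (F : euclid R n.+1 -> \bar R) :
  measurable_fun [set: euclid R n.+1] F -> (forall v, 0 <= F v)%E ->
  (\int[lebesgue_vec n.+1]_v F v =
   \int[mu]_a \int[lebesgue_vec n]_v F (vcons (a, v)))%E.
Proof.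
move=> mF F0.
have -> : (\int[lebesgue_vec n.+1]_v F v =
   \int[(mu \x lebesgue_vec n)%E]_z (F \o @vcons R n) z)%E.
  rewrite -(@ge0_integral_pushforward _ _ _ _ R (@vcons R n) (@measurable_vcons R n) _ setT F)//.
rewrite fubini_tonelli1//=.
exact: measurableT_comp (@measurable_vcons R n).
Qed.

Lemma measurable_prod_tnth n (f : 'I_n -> RR -> R) :
  (forall i, measurable_fun [set: RR] (f i)) ->
  measurable_fun [set: euclid R n] (fun v : euclid R n => \prod_(i < n) f i (tnth v i)).
Proof.
move=> mf; apply: measurable_prod => i _.
by apply: (measurableT_comp (mf i)); exact: measurable_tnth.
Qed.

Lemma ge0_integral_prod_tnth n (f : 'I_n -> RR -> R) :
  (forall i, measurable_fun [set: RR] (f i)) -> (forall i x, 0 <= f i x) ->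
  (\int[lebesgue_vec n]_v (\prod_(i < n) f i (tnth v i))%:E =
   \prod_(i < n) \int[mu]_x (f i x)%:E)%E.
Proof.
elim: n f => [|n IH] f mf f0.
  rewrite big_ord0 /=.
  rewrite integral_dirac//; last by apply/measurable_EFinP; exact: measurable_prod_tnth.
  by rewrite diracT mul1e big_ord0.
rewrite ge0_integral_vcons; last 2 first.
- by apply/measurable_EFinP; exact: measurable_prod_tnth.
- by move=> v; rewrite lee_fin prodr_ge0.
rewrite big_ord_recl/=.
have E a (v : euclid R n) : (\prod_(i < n.+1) f i (tnth (vcons (a, v)) i))%:E =
    ((f ord0 a)%:E * (\prod_(i < n) f (lift ord0 i) (tnth v i))%:E)%E.
  rewrite big_ord_recl EFinM; congr (_ * _)%E; congr EFin.
  by apply: eq_bigr => i _; rewrite tnthS.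
under eq_integral => a _.
  under eq_integral do rewrite E.
  rewrite ge0_integralZl//=; last 3 first.
  - by apply/measurable_EFinP; exact: (measurable_prod_tnth (f := fun i => f (lift ord0 i))).
  - by move=> v _; rewrite lee_fin prodr_ge0.
  - by rewrite lee_fin.
  rewrite (IH (fun i => f (lift ord0 i)))//.
  over.
rewrite ge0_integralZr//.
- exact/measurable_EFinP.
- by move=> a _; rewrite lee_fin.
- by apply: prode_ge0 => i _; apply: integral_ge0 => a _; rewrite lee_fin.
Qed.

End prod_integral.

Section gaussn.
Context {R : realType} (n : nat).
Local Notation E := (euclid R n).
Local Notation L := (@lebesgue_vec R n).

Lemma gaussE (x : E) r : 0 <= r -> gauss x r = \prod_(i < n) gauss1 (tnth x i) r.
Proof.
move=> r0; rewrite big_split/= prodr_const card_ord /gauss; congr (_ * _).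
  rewrite exprVn -powR_mulrn ?powR_ge0// -powRrM mulrC.
  by rewrite [2^-1 * _]mulrC.
rewrite -expR_sum; congr expR.
by rewrite -mulr_suml -sumrN.
Qed.

Lemma gauss_ge0 (x : E) r : 0 <= gauss x r.
Proof. by rewrite mulr_ge0 ?invr_ge0 ?powR_ge0 ?expR_ge0. Qed.

Lemma measurable_sqnorm_comp d (T : measurableType d) (f : T -> E) :
  measurable_fun [set: T] f -> measurable_fun [set: T] (fun t => sqnorm (f t)).
Proof.
move=> mf; apply: measurable_sum => i; apply: measurable_funX.
by have /measurable_fun_tnthP := mf; exact.
Qed.

Lemma measurable_gauss_comp d (T : measurableType d) (f : T -> E) (g : T -> R) :
  measurable_fun [set: T] f -> measurable_fun [set: T] g ->
  measurable_fun [set: T] (fun t => gauss (f t) (g t)).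
Proof.
move=> mf mg; have := measurable_sqnorm_comp mf.
by rewrite /gauss => ms; mfun.
Qed.

Lemma measurable_vsub_comp d (T : measurableType d) (f g : T -> E) :
  measurable_fun [set: T] f -> measurable_fun [set: T] g ->
  measurable_fun [set: T] (fun t => vsub (f t) (g t)).
Proof.
move=> mf mg; apply/measurable_fun_tnthP => i.
under [X in measurable_fun _ X]eq_fun do rewrite /= tnth_mktuple.
apply: measurable_funB.
- by have /measurable_fun_tnthP := mf; exact.
- by have /measurable_fun_tnthP := mg; exact.
Qed.

Lemma sqnorm_vsubC (x y : E) : sqnorm (vsub x y) = sqnorm (vsub y x).
Proof. by apply: eq_bigr => i _; rewrite !tnth_mktuple -sqrrN opprB. Qed.

Lemma gauss_vsubC (x y : E) r : gauss (vsub x y) r = gauss (vsub y x) r.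
Proof. by rewrite /gauss sqnorm_vsubC. Qed.

Lemma integral_gauss (m : E) r : 0 < r -> (\int[L]_x (gauss (vsub x m) r)%:E = 1)%E.
Proof.
move=> r0.
under eq_integral do rewrite gaussE ?ltW//; under eq_integral do under eq_bigr do rewrite tnth_mktuple.
rewrite (ge0_integral_prod_tnth (f := fun i (s : R) => gauss1 (s - tnth m i) r)).
- by apply: big1 => i _; exact: integral_gauss1.
- move=> i; apply: measurable_gauss1_comp => //; exact: measurable_funB.
- by move=> i x; exact: gauss1_ge0.
Qed.

Lemma integral_gauss_conv (x y : E) r s : 0 < r -> 0 < s ->
  (\int[L]_w (gauss (vsub x w) r * gauss (vsub w y) s)%:E = (gauss (vsub x y) (r + s))%:E)%E.
Proof.
move=> r0 s0.
under eq_integral do rewrite !gaussE ?ltW// -big_split; under eq_integral do under eq_bigr do rewrite /= !tnth_mktuple.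
rewrite (ge0_integral_prod_tnth (f := fun i (w : R) => gauss1 (tnth x i - w) r * gauss1 (w - tnth y i) s)).
- under eq_bigr do rewrite integral_gauss1_conv//.
  rewrite gaussE ?addr_ge0 ?ltW// prodEFin.
  by congr EFin; apply: eq_bigr => i _; rewrite tnth_mktuple.
- move=> i; apply: measurable_funM; apply: measurable_gauss1_comp => //; exact: measurable_funB.
- by move=> i z; rewrite mulr_ge0 ?gauss1_ge0.
Qed.

End gaussn.

(** * Beta and Gamma integrals *)

Section general_integral.
Local Open Scope ereal_scope.
Context d (T : measurableType d) (R : realType) (m : {measure set T -> \bar R}).

(** Monotone convergence, in the form used for improper integrals: a primitive is available on each
    compact interval of an exhaustion. *)
Lemma ge0_integral_bigcup_le (A : nat -> set T) (f : T -> \bar R) (M : \bar R) :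
  nondecreasing_seq A -> (forall i, measurable (A i)) ->
  measurable_fun [set: T] f -> (forall x, 0 <= f x) ->
  (forall i, \int[m]_(x in A i) f x <= M) ->
  \int[m]_(x in \bigcup_i A i) f x <= M.
Proof.
move=> ndA mA mf f0 fM.
have h : \int[m]_(x in A i) f x @[i --> \oo] --> \int[m]_(x in \bigcup_i A i) f x.
  by apply: ge0_nondecreasing_set_cvg_integral => // i; exact: measurable_funS mf.
rewrite -(cvg_lim _ h)//; apply: lime_le; first by apply/cvg_ex; eexists; exact: h.
by apply: nearW.
Qed.

Lemma ge0_integral_gt0 (A : set T) (f : T -> \bar R) :
  measurable_fun [set: T] f -> (forall x, 0 <= f x) ->
  measurable A -> 0 < m A -> (forall x, A x -> 0 < f x) ->
  0 < \int[m]_x f x.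
Proof.
move=> mf f0 mA A0 fA; rewrite lt0e integral_ge0// andbT; apply/eqP => h.
have /(ae_eq_integral_abs m measurableT mf) : \int[m]_x `|f x| = 0.
  by rewrite -[RHS]h; apply: eq_integral => x _; rewrite gee0_abs.
move=> [N [mN N0 sN]].
have : m A <= m N.
  apply: le_measure; rewrite ?inE// => x Ax; apply: sN => /= /(_ Logic.I) fx.
  by have := fA _ Ax; rewrite fx ltxx.
by rewrite N0 leNgt A0.
Qed.

End general_integral.

Section power_kernel.
Context {R : realType}.
Local Notation RR := (measurableTypeR R).
Local Notation mu := (@lebesgue_measure R).

(** Extended by 0 to nonpositive times, so that causality is carried by the kernel and every
    integral runs over the whole line. *)
Definition Kt (a r : R) : R := if 0 < r then r `^ (a - 1) else 0.

Lemma Kt_ge0 a r : 0 <= Kt a r.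
Proof. by rewrite /Kt; case: ifP => // _; exact: powR_ge0. Qed.

Lemma Kt_gt0 a r : 0 < r -> 0 < Kt a r.
Proof. by rewrite /Kt => r0; rewrite r0 powR_gt0. Qed.

Lemma KtE a r : 0 < r -> Kt a r = r `^ (a - 1).
Proof. by rewrite /Kt => ->. Qed.

Lemma Kt0 a r : r <= 0 -> Kt a r = 0.
Proof. by rewrite /Kt leNgt; case: ifP. Qed.

Lemma measurable_Kt_comp d (T : measurableType d) a (f : T -> R) :
  measurable_fun [set: T] f -> measurable_fun [set: T] (fun t => Kt a (f t)).
Proof.
move=> mf; have -> : (fun t => Kt a (f t)) = (fun t => (0 < f t)%R%:R * f t `^ (a - 1)).
  by apply/funext => t; rewrite /Kt; case: ifP; rewrite ?mul1r ?mul0r.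
by mfun.
Qed.

End power_kernel.

Ltac mfun ::= repeat first [ apply: measurable_Kt_comp | mfun_base ].

Section power_integrals.
Context {R : realType}.
Local Notation RR := (measurableTypeR R).
Local Notation mu := (@lebesgue_measure R).

Lemma lebesgue_measure_itv01_gt0 (b1 b2 : bool) :
  (0 < @lebesgue_measure R [set` Interval (BSide b1 0%R) (BSide b2 1%R)])%E.
Proof. by rewrite lebesgue_measure_itv/= lte_fin ltr01 oppr0 adde0 lte_fin. Qed.

Lemma continuous_powR_gt0 (p x : R) : 0 < x -> {for x, continuous (fun y : R => y `^ p)}.
Proof.
move=> x0; apply: differentiable_continuous; apply/derivable1_diffP.
by apply: derivable_powR; rewrite in_itv/= x0.
Qed.

Lemma integral_powR (a x y : R) : a != 0 -> 0 < x -> x < y ->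
  (\int[mu]_(s in `[x, y]) (s `^ (a - 1))%:E = ((y `^ a - x `^ a) / a)%:E)%E.
Proof.
move=> a0 x0 xy.
rewrite (@continuous_FTC2 _ (fun s => s `^ (a - 1)) (fun s => a^-1 * s `^ a))//.
- by rewrite -EFinB -mulrBr mulrC.
- apply: derivable_within_continuous => z; rewrite in_itv/= => /andP[xz _].
  by apply: derivable_powR; rewrite in_itv/= (lt_le_trans x0).
- split.
  + move=> z; rewrite in_itv/= => /andP[xz _]; apply: derivableM => //.
    by apply: derivable_powR; rewrite in_itv/= (lt_trans x0).
  + apply: cvg_at_right_filter; apply: cvgM; first exact: cvg_cst.
    exact: continuous_powR_gt0.
  + apply: cvg_at_left_filter; apply: cvgM; first exact: cvg_cst.
    by apply: continuous_powR_gt0; rewrite (lt_trans x0).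
- move=> z; rewrite in_itv/= => /andP[xz _].
  have z0 : z \in `]0, +oo[ by rewrite in_itv/= (lt_trans x0 xz).
  rewrite derive1E deriveZ/=; last exact: derivable_powR.
  by rewrite -derive1E powR_derive1// scalerA mulVf// scale1r.
Qed.

Lemma integral_Kt_le (a T : R) : 0 < a -> 0 < T ->
  (\int[mu]_s ((s < T)%R%:R * Kt a s)%:E <= (T `^ a / a)%:E)%E.
Proof.
move=> a0 T0.
(* The shift by 2 keeps the left end strictly below T already for n = 0, as [integral_powR]
   requires. *)
pose A n : set RR := `[T / n.+2%:R, T]%classic.
have mf : measurable_fun [set: RR] (fun s : RR => ((s < T)%R%:R * Kt a s)%:E).
  by apply/measurable_EFinP; mfun.
have f0 s : (0 <= ((s < T)%R%:R * Kt a s)%:E)%E.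
  by rewrite lee_fin mulr_ge0 ?Kt_ge0.
have -> : (\int[mu]_s ((s < T)%R%:R * Kt a s)%:E =
  \int[mu]_(s in \bigcup_n A n) ((s < T)%R%:R * Kt a s)%:E)%E.
  rewrite [RHS]integral_mkcond/=; apply: eq_integral => s _; rewrite patchE.
  case: ifPn => //; rewrite notin_setE => nA.
  have [sT|sT] := ltP s T; last by rewrite mul0r.
  have [s0|s0] := ltP 0 s; last by rewrite Kt0// mulr0.
  exfalso; apply: nA; exists (Num.truncn (T / s)) => //=.
  rewrite /A/= in_itv/= (ltW sT) andbT ler_pdivrMr ?ltr0n// mulrC -ler_pdivrMr//.
  apply/ltW/(lt_le_trans (truncnS_gt _)).
  by rewrite ler_nat.
apply: ge0_integral_bigcup_le => //.
- move=> i j ij; apply/subsetPset => s; rewrite /A/= !in_itv/= => /andP[h ->]; rewrite andbT.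
  apply: le_trans h; rewrite ler_pM2l// lef_pV2 ?posrE ?ltr0n// ler_nat.
  by rewrite !ltnS.
- by move=> i; exact: measurable_itv.
- move=> i.
  apply: (@le_trans _ _ (\int[mu]_(s in A i) (s `^ (a - 1))%:E)%E).
    apply: ge0_le_integral => //.
    + exact: measurable_itv.
    + exact: measurable_funS mf.
    + apply/measurable_EFinP; apply: measurable_funTS; exact: measurable_powR.
    + move=> s; rewrite /A/= in_itv/= => /andP[h _]; rewrite lee_fin.
      have s0 : 0 < s by apply: lt_le_trans h; rewrite divr_gt0// ltr0n.
      by rewrite KtE//; case: ltP => _; rewrite ?mul1r ?mul0r// powR_ge0.
  rewrite /A integral_powR ?gt_eqF ?divr_gt0 ?ltr0n//; last first.
    by rewrite ltr_pdivrMr ?ltr0n// ltr_pMr// ltr1n.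
  by rewrite lee_fin ler_pM2r ?invr_gt0// lerBlDr lerDl powR_ge0.
Qed.

Lemma integral_powR_tail (a : R) : a < 0 ->
  (\int[mu]_s ((1 < s)%R%:R * s `^ (a - 1))%:E <= ((- a)^-1)%:E)%E.
Proof.
move=> a0.
pose A n : set RR := `[1, n.+2%:R]%classic.
have mf : measurable_fun [set: RR] (fun s : RR => ((1 < s)%R%:R * s `^ (a - 1))%:E).
  by apply/measurable_EFinP; mfun.
have f0 (s : R) : (0 <= ((1 < s)%R%:R * s `^ (a - 1))%:E)%E.
  by rewrite lee_fin mulr_ge0 ?powR_ge0.
have -> : (\int[mu]_s ((1 < s)%R%:R * s `^ (a - 1))%:E =
  \int[mu]_(s in \bigcup_n A n) ((1 < s)%R%:R * s `^ (a - 1))%:E)%E.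
  rewrite [RHS]integral_mkcond/=; apply: eq_integral => s _; rewrite patchE.
  case: ifPn => //; rewrite notin_setE => nA.
  have [s1|s1] := ltP 1 s; last by rewrite mul0r.
  exfalso; apply: nA; exists (Num.truncn s) => //=.
  rewrite /A/= in_itv/= (ltW s1)/=.
  by apply/ltW/(lt_le_trans (truncnS_gt _)); rewrite ler_nat.
apply: ge0_integral_bigcup_le => //.
- move=> i j ij; apply/subsetPset => s; rewrite /A/= !in_itv/= => /andP[-> h]/=.
  by apply: le_trans h _; rewrite ler_nat !ltnS.
- by move=> i; exact: measurable_itv.
- move=> i.
  apply: (@le_trans _ _ (\int[mu]_(s in A i) (s `^ (a - 1))%:E)%E).
    apply: ge0_le_integral => //.
    + exact: measurable_itv.
    + exact: measurable_funS mf.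
    + apply/measurable_EFinP; apply: measurable_funTS; exact: measurable_powR.
    + move=> s _; rewrite lee_fin.
      by case: ltP => _; rewrite ?mul1r ?mul0r// powR_ge0.
  rewrite /A integral_powR ?lt_eqF ?ltr1n//.
  rewrite lee_fin -mulrNN -invrN ler_piMl ?invr_ge0 ?oppr_ge0 ?(ltW a0)//.
  by rewrite opprB powR1 lerBlDr lerDl powR_ge0.
Qed.


(** For a natural number m above |a|, exp(s) = exp(s/m)^m >= (s/m)^m, whence C = m^m. *)
Lemma powR_le_expR (a : R) : exists2 C : R, 0 < C & forall s, 1 <= s -> s `^ a <= C * expR s.
Proof.
pose m := (Num.truncn `|a|).+1.
have m0 : 0 < m%:R :> R by rewrite ltr0n.
exists (m%:R ^+ m); first by rewrite exprn_gt0.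
move=> s s1; have s0 : 0 <= s by apply: le_trans s1.
apply: (@le_trans _ _ (s `^ m%:R)).
  apply: ler_powR => //; apply: le_trans (ler_norm _) _.
  exact/ltW/truncnS_gt.
rewrite powR_mulrn//.
have -> : s ^+ m = m%:R ^+ m * (s / m%:R) ^+ m.
  by rewrite -exprMn; congr (_ ^+ _); field; rewrite gt_eqF.
rewrite ler_pM2l ?exprn_gt0//.
have -> : expR s = (expR (s / m%:R)) ^+ m.
  by rewrite -expRM_natl; congr expR; field; rewrite gt_eqF.
apply: lerXn2r; rewrite ?nnegrE ?expR_ge0 ?divr_ge0 ?(ltW m0)//.
by apply: le_trans (expR_ge1Dx _); rewrite lerDr.
Qed.

(** Finiteness is the content: [Gamma] is a real-valued integral, which would take a default value
    if it diverged. *)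
Lemma integral_GammaE (a : R) : 0 < a ->
  (\int[mu]_s (Kt a s * expR (- s))%:E = (Gamma a)%:E)%E /\ 0 < Gamma a.
Proof.
move=> a0.
have mf : measurable_fun [set: RR] (fun s : RR => (Kt a s * expR (- s))%:E).
  by apply/measurable_EFinP; mfun.
have f0 (s : R) : (0 <= (Kt a s * expR (- s))%:E)%E.
  by rewrite lee_fin mulr_ge0 ?Kt_ge0 ?expR_ge0.
have E : (\int[mu]_(s in `]0%R, +oo[) (s `^ (a - 1) * expR (- s))%:E =
    \int[mu]_s (Kt a s * expR (- s))%:E)%E.
  rewrite [LHS]integral_mkcond/=; apply: eq_integral => s _; rewrite patchE.
  case: ifPn; rewrite ?notin_setE ?inE/= in_itv/= andbT => s0; first by rewrite KtE.
  by rewrite Kt0 ?mul0r// leNgt; exact/negP.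
(* The exponent a + 1 leaves the integrable tail C s^(-2). The cutoffs s < 2 and 1 < s below
   overlap, so that no endpoint has to be treated apart. *)
have [C C0 HC] := powR_le_expR (a + 1).
have fin : (\int[mu]_s (Kt a s * expR (- s))%:E < +oo)%E.
  apply: (@le_lt_trans _ _ (\int[mu]_s (((s < 2)%R%:R * Kt a s)%:E + (C%:E * ((1 < s)%R%:R * s `^ (-1 - 1))%:E)))%E).
    apply: ge0_le_integral => //.
    - apply: emeasurable_funD; first by apply/measurable_EFinP; mfun.
      by apply/measurable_EFinP; mfun.
    - move=> s _; rewrite -EFinM -EFinD lee_fin.
      have [s2|s2] := ltP s 2.
        rewrite mul1r; apply: (@le_trans _ _ (Kt a s)).
          have [s0|s0] := leP s 0; first by rewrite Kt0// mul0r.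
          by rewrite ler_piMr ?Kt_ge0// -expR0 ler_expR oppr_le0 ltW.
        by rewrite lerDl mulr_ge0 ?(ltW C0)// mulr_ge0 ?powR_ge0.
      have s1 : 1 < s by apply: lt_le_trans s2; rewrite ltr1n.
      have s0 : 0 < s by apply: lt_trans s1.
      rewrite mul0r add0r s1 mul1r KtE// expRN ler_pdivrMr ?expR_gt0//.
      have -> : s `^ (a - 1) = s `^ (a + 1) * s `^ (-1 - 1).
        by rewrite -powRD ?(gt_eqF s0) ?implybT//; congr (_ `^ _); ring.
      by rewrite mulrAC ler_pM2r ?powR_gt0//; exact: HC (ltW s1).
  rewrite ge0_integralD//=; last 4 first.
  - by move=> s _; rewrite lee_fin mulr_ge0 ?Kt_ge0.
  - by apply/measurable_EFinP; mfun.
  - by move=> s _; rewrite -EFinM lee_fin mulr_ge0 ?(ltW C0)// mulr_ge0 ?powR_ge0.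
  - by apply/measurable_EFinP; mfun.
  rewrite ge0_integralZl//=; last 3 first.
  - by apply/measurable_EFinP; mfun.
  - by move=> s _; rewrite lee_fin mulr_ge0 ?powR_ge0.
  - by rewrite lee_fin ltW.
  apply: lte_add_pinfty.
    by apply: le_lt_trans (integral_Kt_le a0 _) _; rewrite ?ltry.
  apply: (@le_lt_trans _ _ (C%:E * ((- -1)^-1)%:E)%E); last by rewrite -EFinM ltry.
  by apply: lee_wpmul2l; [rewrite lee_fin ltW|apply: integral_powR_tail; rewrite ltrN10].
have pos : (0 < \int[mu]_s (Kt a s * expR (- s))%:E)%E.
  apply: (@ge0_integral_gt0 _ _ _ mu `]0, 1]%classic) => //.
  - exact: lebesgue_measure_itv01_gt0.
  - move=> s /=; rewrite in_itv/= => /andP[s0 _].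
    by rewrite lte_fin mulr_gt0 ?Kt_gt0 ?expR_gt0.
by rewrite /Gamma /Rintegral E fineK ?ge0_fin_numE ?ltW//; split => //; rewrite fine_gt0// pos.
Qed.

Definition Beta (a b : R) : R := fine (\int[mu]_s (Kt a (1 - s) * Kt b s)%:E)%E.

Lemma powR_half_le (p x : R) : 2^-1 <= x <= 1 -> x `^ p <= 1 + 2^-1 `^ p.
Proof.
move=> /andP[x2 x1]; have h0 : 0 < 2^-1 :> R by rewrite invr_gt0.
have x0 : 0 < x by apply: lt_le_trans x2.
have [p0|p0] := leP 0 p.
  apply: (@le_trans _ _ 1); last by rewrite lerDl powR_ge0.
  by rewrite -(@powRr0 _ x); apply: ger_powR => //; rewrite x0.
apply: (@le_trans _ _ (2^-1 `^ p)); last by rewrite lerDr.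
rewrite -[p]opprK !(powRN _ (- p)) lef_pV2 ?posrE ?powR_gt0//.
by apply: ge0_ler_powR; rewrite ?nnegrE ?oppr_ge0 ?(ltW h0) ?(ltW x0) ?(ltW p0).
Qed.

Lemma integral_BetaE (a b : R) : 0 < a -> 0 < b ->
  (\int[mu]_s (Kt a (1 - s) * Kt b s)%:E = (Beta a b)%:E)%E /\ 0 < Beta a b.
Proof.
move=> a0 b0.
have mf : measurable_fun [set: RR] (fun s : RR => (Kt a (1 - s) * Kt b s)%:E).
  by apply/measurable_EFinP; mfun.
have f0 (s : R) : (0 <= (Kt a (1 - s) * Kt b s)%:E)%E.
  by rewrite lee_fin mulr_ge0 ?Kt_ge0.
(* On each half of [0, 1], C bounds the factor whose singularity lies in the other half. *)
pose C := (1 + 2^-1 `^ (a - 1)) + (1 + 2^-1 `^ (b - 1)).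
have C1 : 1 + 2^-1 `^ (a - 1) <= C by rewrite lerDl addr_ge0 ?powR_ge0.
have C2 : 1 + 2^-1 `^ (b - 1) <= C by rewrite lerDr addr_ge0 ?powR_ge0.
have C0 : 0 <= C by apply: le_trans C1; rewrite addr_ge0 ?powR_ge0.
have mG (c : R) : measurable_fun [set: RR] (fun s : RR => ((s < 1)%R%:R * Kt c s)%:E).
  by apply/measurable_EFinP; mfun.
have G0 (c s : R) : (0 <= ((s < 1)%R%:R * Kt c s)%:E)%E.
  by rewrite lee_fin mulr_ge0 ?Kt_ge0.
have fin : (\int[mu]_s (Kt a (1 - s) * Kt b s)%:E < +oo)%E.
  apply: (@le_lt_trans _ _ (\int[mu]_s (C%:E * (((s < 1)%R%:R * Kt b s)%:E + ((1 - s < 1)%R%:R * Kt a (1 - s))%:E)))%E).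
    apply: ge0_le_integral => //.
    - by apply/measurable_EFinP; mfun.
    - move=> s _; rewrite -EFinD -EFinM lee_fin.
      have [s0|s0] := leP s 0; first by rewrite [X in _ * X <= _]Kt0// mulr0 mulr_ge0// addr_ge0// mulr_ge0 ?Kt_ge0.
      have [s1|s1] := leP 1 s.
        rewrite [X in X * _ <= _]Kt0 ?subr_le0// mul0r mulr_ge0// addr_ge0// mulr_ge0 ?Kt_ge0//.
      rewrite [(1 - s < 1)]gtrBl s0 !mul1r mulrDr.
      have [s2|s2] := leP s 2^-1.
        apply: (@le_trans _ _ (C * Kt b s)); last by rewrite lerDl mulr_ge0 ?Kt_ge0.
        rewrite ler_wpM2r ?Kt_ge0// KtE ?subr_gt0//; apply: le_trans C1.
        by apply: powR_half_le; rewrite gerBl (ltW s0) andbT; lra.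
      apply: (@le_trans _ _ (C * Kt a (1 - s))); last by rewrite lerDr mulr_ge0 ?Kt_ge0.
      rewrite mulrC ler_wpM2r ?Kt_ge0// KtE//; apply: le_trans C2.
      by apply: powR_half_le; rewrite (ltW s1) (ltW s2).
  have m1 : measurable_fun [set: RR] (fun s : RR => ((1 - s < 1)%R%:R * Kt a (1 - s))%:E).
    by apply/measurable_EFinP; mfun.
  rewrite ge0_integralZl//=; last 2 first.
  - exact: emeasurable_funD.
  - by move=> s _; rewrite adde_ge0.
  rewrite ge0_integralD//= (@ge0_integral_reflect R 1 (fun s : R => ((s < 1)%R%:R * Kt a s)%:E))//.
  have K (c : R) : 0 < c -> (\int[mu]_s ((s < 1)%R%:R * Kt c s)%:E < +oo)%E.
    by move=> c0; apply: le_lt_trans (integral_Kt_le c0 ltr01) _; rewrite ltry.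
  rewrite lte_mul_pinfty ?lee_fin//.
  by rewrite lte_add_pinfty ?K.
have pos : (0 < \int[mu]_s (Kt a (1 - s) * Kt b s)%:E)%E.
  apply: (@ge0_integral_gt0 _ _ _ mu `]0, 1[%classic) => //.
  - exact: lebesgue_measure_itv01_gt0.
  - move=> s /=; rewrite in_itv/= => /andP[s0 s1].
    by rewrite lte_fin mulr_gt0 ?Kt_gt0 ?subr_gt0.
by rewrite /Beta fineK ?ge0_fin_numE ?ltW//; split => //; rewrite fine_gt0// pos.
Qed.

(** The Beta integral carried from [0, 1] to [x, y]; up to normalisation, the semigroup law of
    fractional integration in time. For y <= x both sides vanish. *)
Lemma integral_Kt_conv (a b x y : R) : 0 < a -> 0 < b ->
  (\int[mu]_s (Kt a (y - s) * Kt b (s - x))%:E = (Beta a b * Kt (a + b) (y - x))%:E)%E.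
Proof.
move=> a0 b0.
have [yx|xy] := leP y x.
  rewrite Kt0 ?subr_le0// mulr0 integral0_eq// => s _.
  have [ys|sy] := leP y s; first by rewrite Kt0 ?mul0r// subr_le0.
  by rewrite [Kt b _]Kt0 ?mulr0// subr_le0 (le_trans _ yx)// ltW.
have l0 : 0 < y - x by rewrite subr_gt0.
rewrite (@ge0_integral_affine _ (y - x) x)//; last 2 first.
- by apply/measurable_EFinP; mfun.
- by move=> s; rewrite lee_fin mulr_ge0 ?Kt_ge0.
have K c r : Kt c ((y - x) * r) = (y - x) `^ (c - 1) * Kt c r.
  rewrite /Kt pmulr_rgt0//; case: ifPn => r0; last by rewrite mulr0.
  by rewrite powRM// ltW.
have E s : ((Kt a (y - ((y - x) * s + x)) * Kt b ((y - x) * s + x - x))%:E =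
    ((y - x) `^ (a - 1) * (y - x) `^ (b - 1))%:E * (Kt a (1 - s) * Kt b s)%:E)%E.
  have -> : y - ((y - x) * s + x) = (y - x) * (1 - s) by ring.
  by rewrite addrK !K -EFinM; congr EFin; ring.
under eq_integral do rewrite E.
rewrite ge0_integralZl//=; last 3 first.
- by apply/measurable_EFinP; mfun.
- by move=> s _; rewrite lee_fin mulr_ge0 ?Kt_ge0.
- by rewrite lee_fin mulr_ge0 ?powR_ge0.
rewrite (integral_BetaE a0 b0).1 -!EFinM KtE//; congr EFin.
rewrite mulrA mulrC; congr (_ * _).
rewrite -{1}(powRr1 (ltW l0)) -!powRD ?(gt_eqF l0) ?implybT//; congr (_ `^ _); ring.
Qed.

End power_integrals.

(** * A Beta integral after a Moebius change of variable *)

Section moebius.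
Context {R : realType}.
Local Notation RR := (measurableTypeR R).
Local Notation mu := (@lebesgue_measure R).
Variables (a k c sg : R).
Hypotheses (a0 : 0 < a) (k0 : 0 < k) (c0 : 0 < c) (sg0 : 0 < sg).

(** Inverse of the substitution q = r/(r + c), which maps ]0, sg[ onto ]0, v[. *)
Let F (q : R) : R := c * (1 - q)^-1 - c.
Let dF (q : R) : R := c * (1 - q) ^- 2.
Let v := sg / (sg + c).
Let G (r : R) : R := (sg - r) `^ (a - 1) * (r `^ (k - 1) * (r + c) `^ (- a - k)).
(** The intervals [x_ n, y_ n] exhaust ]0, v[ and stay away from its ends, where the integrand may
    be singular. The denominator n + 3 exceeds 2, which gives [x_ n < y_ n] already for n = 0. *)
Let x_ (n : nat) : R := v / n.+3%:R.
Let y_ (n : nat) : R := v - v / n.+3%:R.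

Let sc0 : 0 < sg + c. Proof. exact: addr_gt0. Qed.
Let v0 : 0 < v. Proof. by rewrite divr_gt0. Qed.
Let v1 : v < 1. Proof. by rewrite ltr_pdivrMr// mul1r ltrDl. Qed.
Let x0 n : 0 < x_ n. Proof. by rewrite divr_gt0 ?ltr0n. Qed.
Let yv n : y_ n < v. Proof. by rewrite /y_ gtrBl x0. Qed.
Let xy n : x_ n < y_ n.
Proof.
rewrite /x_ /y_ ltrBrDr -mulrDl ltr_pdivrMr ?ltr0n// -mulr2n -(mulr_natr v 2) ltr_pM2l//.
by rewrite ltr_nat.
Qed.

Let FE q : q < 1 -> F q = c * q / (1 - q).
Proof. by move=> q1; rewrite /F; field; rewrite subr_eq0 gt_eqF. Qed.

Let dFE (q : R) : q < 1 -> is_derive q 1 F (dF q).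
Proof.
move=> q1; have q10 : 1 - q != 0 by rewrite subr_eq0 gt_eqF.
have h := @is_deriveB R R^o R^o (cst 1) id q 1 0 1 (is_derive_cst _ _ _) (is_derive_id _ _).
have h2 : is_derive q 1 (fun y : R => (1 - y)^-1) (- (1 - q) ^- 2 *: (0 - 1)) := @is_deriveV R (cst 1 - id) q (0 - 1) 1 q10 h.
have h3 := @is_deriveB R R^o R^o (c \*: (fun y : R => (1 - y)^-1)) (cst c) q 1 _ 0
  (is_deriveZ c h2) (is_derive_cst _ _ _).
apply: (is_derive_eq h3); rewrite /dF /GRing.scale/=; ring.
Qed.

Let F1E (q : R) : q < 1 -> F^`()%classic q = dF q.
Proof. by move=> q1; rewrite derive1E; apply: derive_val; exact: dFE. Qed.

Let FK r : 0 < r -> F (r / (r + c)) = r.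
Proof.
move=> r0; have rc0 : 0 < r + c by rewrite addr_gt0.
by rewrite /F; field; rewrite gt_eqF//= addrAC subrr add0r gt_eqF.
Qed.

Let Fincr p q : q < 1 -> p < q -> F p < F q.
Proof.
move=> q1 pq; rewrite /F ltrD2r ltr_pM2l// ltf_pV2 ?posrE ?subr_gt0//.
  by rewrite ltrD2l ltrN2.
exact: lt_trans q1.
Qed.

Let F0 : F 0 = 0. Proof. by rewrite /F subr0 invr1 mulr1 subrr. Qed.
Let Fv : F v = sg. Proof. exact: FK. Qed.

Let contG r : 0 < r -> r < sg -> {for r, continuous G}.
Proof.
move=> r0 rs; apply: cvgM; [|apply: cvgM].
- apply: (@continuous_comp _ _ _ (fun r => sg - r) (fun y : R => y `^ (a - 1))).
    by apply: cvgB; [exact: cvg_cst|exact: cvg_id].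
  by apply: continuous_powR_gt0; rewrite subr_gt0.
- exact: continuous_powR_gt0.
- apply: (@continuous_comp _ _ _ (fun r => r + c) (fun y : R => y `^ (- a - k))).
    by apply: cvgD; [exact: cvg_id|exact: cvg_cst].
  by apply: continuous_powR_gt0; rewrite addr_gt0.
Qed.

Let contdF q : q < 1 -> {for q, continuous dF}.
Proof.
move=> q1; apply: cvgM; first exact: cvg_cst.
apply: cvgV; first by rewrite expf_neq0// subr_eq0 gt_eqF.
have h : (fun p : R => 1 - p) x @[x --> q] --> 1 - q by apply: cvgB; [exact: cvg_cst|exact: cvg_id].
rewrite expr2; under eq_fun do rewrite expr2; exact: cvgM.
Qed.

Let contF1 q : q < 1 -> {for q, continuous (F^`()%classic : R -> R)}.
Proof.
move=> q1; rewrite /prop_for/continuous_at (F1E q1).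
apply: cvg_trans (contdF q1); apply: near_eq_cvg.
near=> p; rewrite F1E//; near: p; exact: lt_nbhsl.
Unshelve. all: by end_near. Qed.

Let contF q : q < 1 -> {for q, continuous F}.
Proof.
move=> q1; apply: differentiable_continuous; apply/derivable1_diffP.
by have [] := dFE q1.
Qed.

Let GFE q : 0 < q -> q < v -> G (F q) * dF q =
  (c^-1 * (c / (sg + c)) `^ (1 - a)) * (Kt a (v - q) * Kt k (q - 0)).
Proof.
move=> q0 qv; have q1 : q < 1 by apply: lt_trans v1.
have p0 : 0 < 1 - q by rewrite subr_gt0.
have vq0 : 0 < v - q by rewrite subr_gt0.
rewrite subr0 !KtE// /G.
have -> : sg - F q = (sg + c) * (v - q) / (1 - q).
  by rewrite /F /v; field; rewrite !gt_eqF.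
have -> : F q + c = c / (1 - q) by rewrite /F; field; rewrite gt_eqF.
rewrite FE// /dF.
set w := v - q; set p := 1 - q.
rewrite !powRM ?invr_ge0 ?mulr_ge0 ?(ltW sc0, ltW vq0, ltW p0, ltW c0, ltW q0)//.
have I z e : 0 <= z -> (z^-1 : R) `^ e = z `^ (- e).
  by move=> z0; rewrite -powR_inv1// -powRrM mulN1r.
rewrite !I ?(ltW p0, ltW sc0)//.
have -> : c * p ^- 2 = c `^ 1 * p `^ (- 2).
  by rewrite powRr1 ?ltW// (powR_invn 2) ?ltW.
have -> : c^-1 = c `^ (-1) by rewrite powR_inv1 ?ltW.
have D z e f : 0 < z -> z `^ e * z `^ f = z `^ (e + f) :> R.
  by move=> z0; rewrite powRD// (gt_eqF z0) implybT.
transitivity ((sg + c) `^ (a - 1) * w `^ (a - 1) * q `^ (k - 1) *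
   (c `^ (k - 1) * (c `^ (- a - k) * c `^ 1)) *
   (p `^ (- (a - 1)) * (p `^ (- (k - 1)) * (p `^ (- (- a - k)) * p `^ (- 2))))).
  by ring.
transitivity ((sg + c) `^ (- (1 - a)) * w `^ (a - 1) * q `^ (k - 1) * (c `^ (-1) * c `^ (1 - a))).
  rewrite !D//.
  (* All powers of 1 - q cancel; this is what dictates the exponent - a - k and leaves a plain Beta
     integral. *)
  have -> : - (a - 1) + (- (k - 1) + (- (- a - k) + - 2)) = 0 by ring.
  have -> : k - 1 + (- a - k + 1) = -1 + (1 - a) by ring.
  by rewrite powRr0 mulr1 opprB.
by ring.
Qed.

Let S_ n : set RR := `[x_ n, y_ n]%classic.
Let T_ n : set RR := `[F (x_ n), F (y_ n)]%classic.

Let subst n : (\int[mu]_(r in T_ n) (G r)%:E = \int[mu]_(q in S_ n) ((G \o F) q * dF q)%:E)%E.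
Proof.
have yn1 : y_ n < 1 by exact: lt_trans (yv n) v1.
have xn1 : x_ n < 1 by exact: lt_trans (xy n) yn1.
rewrite /T_ /S_ (@integration_by_substitution_increasing _ F G (x_ n) (y_ n)) ?(ltW (xy n))//.
- apply: eq_integral => q; rewrite inE/= in_itv/= => /andP[_ qy].
  congr EFin; change (G (F q) * F^`()%classic q = G (F q) * dF q); rewrite F1E//.
  exact: le_lt_trans qy yn1.
- move=> p q _; rewrite in_itv/= => /andP[_ qy]; apply: Fincr.
  exact: le_lt_trans qy yn1.
- move=> q; rewrite in_itv/= => /andP[_ qy]; apply: contF1; exact: lt_trans qy yn1.
- by apply/cvg_ex; eexists; apply: cvg_at_right_filter; exact: contF1.
- by apply/cvg_ex; eexists; apply: cvg_at_left_filter; exact: contF1.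
- split.
  + move=> q; rewrite in_itv/= => /andP[_ qy]; by have [] := dFE (lt_trans qy yn1).
  + by apply: cvg_at_right_filter; exact: contF.
  + by apply: cvg_at_left_filter; exact: contF.
- apply: continuous_in_subspaceT => r; rewrite inE/= in_itv/= => /andP[r1 r2].
  apply: contG.
    by apply: lt_le_trans r1; rewrite -F0; apply: Fincr.
  by apply: le_lt_trans r2 _; rewrite -Fv; apply: Fincr.
Qed.

Let xnd i j : (i <= j)%N -> x_ j <= x_ i.
Proof.
by move=> ij; rewrite /x_ ler_pM2l// lef_pV2 ?posrE ?ltr0n// ler_nat !ltnS.
Qed.

Let ynd i j : (i <= j)%N -> y_ i <= y_ j.
Proof. by move=> ij; rewrite /y_ lerD2l lerN2; exact: xnd. Qed.

Let capture q : 0 < q -> q < v -> exists n, x_ n <= q <= y_ n.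
Proof.
move=> q0 qv; have vq0 : 0 < v - q by rewrite subr_gt0.
pose n := (Num.truncn (v / q) + Num.truncn (v / (v - q)))%N.
exists n.
have h z : 0 < z -> (Num.truncn (v / z) <= n)%N -> x_ n <= z.
  move=> z0 zn; rewrite /x_ ler_pdivrMr ?ltr0n// mulrC -ler_pdivrMr//.
  by apply/ltW/(lt_le_trans (truncnS_gt _)); rewrite ler_nat ltnS (leq_trans zn)// ltnW.
rewrite h ?leq_addr//= /y_ lerBrDr -lerBrDl.
by apply: h; rewrite ?leq_addl.
Qed.

Let US : \bigcup_n S_ n = `]0, v[%classic.
Proof.
apply/seteqP; split => q; rewrite /S_/=.
  move=> [n _] /=; rewrite !in_itv/= => /andP[h1 h2].
  by rewrite (lt_le_trans (x0 n) h1) (le_lt_trans h2 (yv n)).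
rewrite in_itv/= => /andP[q0 qv]; have [n h] := capture q0 qv.
by exists n => //=; rewrite in_itv.
Qed.

Let leF p q : q < 1 -> p <= q -> F p <= F q.
Proof. by move=> q1; rewrite le_eqVlt => /predU1P[->//|pq]; rewrite ltW// Fincr. Qed.

Let UT : \bigcup_n T_ n = `]0, sg[%classic.
Proof.
have yn1 n : y_ n < 1 by exact: lt_trans (yv n) v1.
apply/seteqP; split => r; rewrite /T_/=.
  move=> [n _] /=; rewrite !in_itv/= => /andP[h1 h2]; apply/andP; split.
    by apply: lt_le_trans h1; rewrite -F0; apply: Fincr => //; exact: lt_trans (xy n) (yn1 n).
  by apply: le_lt_trans h2 _; rewrite -Fv; apply: Fincr.
rewrite in_itv/= => /andP[r0 rs].
have q0 : 0 < r / (r + c) by rewrite divr_gt0// addr_gt0.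
have qv : r / (r + c) < v.
  rewrite /v ltr_pdivrMr ?addr_gt0// mulrAC ltr_pdivlMr// !mulrDr.
  by rewrite [sg * r]mulrC ltrD2l ltr_pM2r.
have [n /andP[h1 h2]] := capture q0 qv.
exists n => //=; rewrite in_itv/= -(FK r0); apply/andP; split; apply: leF => //.
exact: lt_trans v1.
Qed.

(** Apart from a constant independent of sg, k enters the result only as the power of sg/(sg + c):
    varying k produces the successive moments in that variable. *)
Lemma integral_Kt_moebius :
  (\int[mu]_r (Kt a (sg - r) * (Kt k r * (r + c) `^ (- a - k)))%:E =
   (Beta a k * c `^ (- a) * (Kt a sg * (sg / (sg + c)) `^ k))%:E)%E.
Proof.
pose H r := Kt a (sg - r) * (Kt k r * (r + c) `^ (- a - k)).
pose C0 := c^-1 * (c / (sg + c)) `^ (1 - a).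
pose H' q := C0 * (Kt a (v - q) * Kt k (q - 0)).
have C00 : 0 <= C0 by rewrite mulr_ge0 ?powR_ge0// invr_ge0 ltW.
have mH : measurable_fun [set: RR] (fun r : RR => (H r)%:E).
  apply/measurable_EFinP; rewrite /H; mfun.
have mH' : measurable_fun [set: RR] (fun r : RR => (H' r)%:E).
  by apply/measurable_EFinP; rewrite /H'; mfun.
have H0 r : (0 <= (H r)%:E)%E by rewrite lee_fin !mulr_ge0 ?Kt_ge0 ?powR_ge0.
have H'0 r : (0 <= (H' r)%:E)%E by rewrite lee_fin; apply: mulr_ge0 => //; rewrite mulr_ge0 ?Kt_ge0.
have yn1 n : y_ n < 1 by exact: lt_trans (yv n) v1.
have E1 : (\int[mu]_r (H r)%:E = \int[mu]_(r in \bigcup_n T_ n) (H r)%:E)%E.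
  rewrite [RHS]integral_mkcond/= UT; apply: eq_integral => r _; rewrite patchE.
  case: ifPn => //; rewrite notin_setE/= in_itv/= => /negP; rewrite negb_and -!leNgt /H.
  by move=> /orP[h|h]; [rewrite [Kt k _]Kt0// mul0r mulr0|rewrite Kt0 ?mul0r// subr_le0].
have E2 : (\int[mu]_r (H' r)%:E = \int[mu]_(r in \bigcup_n S_ n) (H' r)%:E)%E.
  rewrite [RHS]integral_mkcond/= US; apply: eq_integral => r _; rewrite patchE.
  case: ifPn => //; rewrite notin_setE/= in_itv/= => /negP; rewrite negb_and -!leNgt /H' subr0.
  by move=> /orP[h|h]; [rewrite [Kt k _]Kt0// !mulr0|rewrite Kt0 ?mul0r ?mulr0// subr_le0].
have E3 n : (\int[mu]_(r in T_ n) (H r)%:E = \int[mu]_(q in S_ n) (H' q)%:E)%E.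
  transitivity (\int[mu]_(r in T_ n) (G r)%:E)%E.
    apply: eq_integral => r rT; congr EFin; rewrite /H /G.
    have : (\bigcup_n T_ n) r by exists n => //; rewrite inE in rT.
    by rewrite UT/= in_itv/= => /andP[r0 rs]; rewrite !KtE// subr_gt0.
  rewrite subst; apply: eq_integral => q qS; congr EFin.
  have : (\bigcup_n S_ n) q by exists n => //; rewrite inE in qS.
  by rewrite US/= in_itv/= => /andP[q0 qv]; exact: GFE.
have L1 : (\int[mu]_(r in T_ i) (H r)%:E @[i --> \oo] --> \int[mu]_(r in \bigcup_n T_ n) (H r)%:E)%E.
  apply: ge0_nondecreasing_set_cvg_integral => //.
  - move=> i j ij; apply/subsetPset => r; rewrite /T_/= !in_itv/= => /andP[h1 h2].
    rewrite (le_trans _ h1) ?(le_trans h2)//; apply: leF; rewrite ?ynd ?xnd//.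
    exact: lt_trans (xy _) (yn1 _).
  - by move=> i; exact: measurable_itv.
  - by move=> i; exact: measurable_funS mH.
have L2 : (\int[mu]_(r in S_ i) (H' r)%:E @[i --> \oo] --> \int[mu]_(r in \bigcup_n S_ n) (H' r)%:E)%E.
  apply: ge0_nondecreasing_set_cvg_integral => //.
  - move=> i j ij; apply/subsetPset => r; rewrite /S_/= !in_itv/= => /andP[h1 h2].
    by rewrite (le_trans _ h1) ?(le_trans h2)// ?ynd ?xnd.
  - by move=> i; exact: measurable_itv.
  - by move=> i; exact: measurable_funS mH'.
have -> : (\int[mu]_r (H r)%:E = \int[mu]_r (H' r)%:E)%E.
  rewrite E1 E2 -(cvg_lim _ L1)// -(cvg_lim _ L2)//.
  by congr (limn _); apply/funext => i; exact: E3.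
under eq_integral do rewrite /H' EFinM.
rewrite ge0_integralZl//=.
- rewrite integral_Kt_conv// -EFinM; congr EFin; rewrite subr0 !KtE//.
  rewrite /C0 /v.
  have D z e f : 0 < z -> z `^ (e + f) = z `^ e * z `^ f :> R.
    by move=> z0; rewrite powRD// (gt_eqF z0) implybT.
  have I z e : 0 < z -> (z^-1 : R) `^ e = z `^ (- e).
    by move=> z0; rewrite -powR_inv1 ?ltW// -powRrM mulN1r.
  rewrite !powRM ?invr_ge0 ?ltW// !I// mulrCA -!mulrA; congr (_ * _).
  have -> : c^-1 = c `^ (-1) by rewrite powR_inv1 ?ltW.
  transitivity ((c `^ (-1) * c `^ (1 - a)) * (sg `^ (a + k - 1) * ((sg + c) `^ (- (1 - a)) * (sg + c) `^ (- (a + k - 1))))).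
    by ring.
  rewrite -!D//.
  have -> : -1 + (1 - a) = - a by ring.
  have -> : - (1 - a) - (a + k - 1) = - k by ring.
  by congr (_ * _); rewrite mulrA -D//; congr (_ `^ _ * _); ring.
- by apply/measurable_EFinP; mfun.
- by move=> s _; rewrite lee_fin mulr_ge0 ?Kt_ge0.
Qed.

End moebius.

(** * The fractional heat kernel on space-time *)

Section spacetime_sigma_finite.
Context {R : realType} (n : nat).
Local Notation RR := (measurableTypeR R).
Local Notation mu := (@lebesgue_measure R).
Local Notation Z := (spacetime R n).
Local Notation V := (@spacetime_measure R n).

(** The same measure as [spacetime_measure], packaged with the sigma-finiteness that Tonelli and
    Fubini on pairs of space-time points require. *)
Definition spacetime_sigma_finite : {sigma_finite_measure set Z -> \bar R} :=
  HB.pack (product_measure1 (@lebesgue_vec R n) mu)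
    (Measure_isSigmaFinite.Build _ _ _ (product_measure1 (@lebesgue_vec R n) mu)
      (sigma_finite_prod (@lebesgue_vec R n) mu)).

Lemma spacetime_tonelli (F : Z -> \bar R) :
  measurable_fun [set: Z] F -> (forall z, 0 <= F z)%E ->
  (\int[V]_z F z = \int[mu]_t \int[lebesgue_vec n]_x F (x, t))%E.
Proof. by move=> mF F0; rewrite /spacetime_measure fubini_tonelli2. Qed.

Lemma spacetime_tonelli2 (F : Z * Z -> \bar R) :
  measurable_fun [set: Z * Z] F -> (forall z, 0 <= F z)%E ->
  (\int[V]_z \int[V]_w F (z, w) = \int[V]_w \int[V]_z F (z, w))%E.
Proof.
move=> mF F0.
exact: (@fubini_tonelli _ _ _ _ R spacetime_sigma_finite spacetime_sigma_finite F).
Qed.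

Lemma measurable_spacetime_integral (F : Z * Z -> \bar R) :
  measurable_fun [set: Z * Z] F -> (forall z, 0 <= F z)%E ->
  measurable_fun [set: Z] (fun z => \int[V]_w F (z, w))%E.
Proof.
move=> mF F0.
exact: (@measurable_fun_fubini_tonelli_F _ _ _ _ R spacetime_sigma_finite F).
Qed.

Lemma measurable_spacetime_integral2 (F : Z * Z -> \bar R) :
  measurable_fun [set: Z * Z] F -> (forall z, 0 <= F z)%E ->
  measurable_fun [set: Z] (fun w => \int[V]_z F (z, w))%E.
Proof.
move=> mF F0.
exact: (@measurable_fun_fubini_tonelli_G _ _ _ _ R spacetime_sigma_finite F).
Qed.

Lemma spacetime_fubini2 (F : Z * Z -> \bar R) :
  measurable_fun [set: Z * Z] F ->
  (\int[V]_z \int[V]_w `|F (z, w)| < +oo)%E ->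
  (\int[V]_z \int[V]_w F (z, w) = \int[V]_w \int[V]_z F (z, w))%E.
Proof.
move=> mF Foo.
apply: (@Fubini _ _ _ _ R spacetime_sigma_finite spacetime_sigma_finite F).
exact/integrable12ltyP.
Qed.

End spacetime_sigma_finite.

Section proj_comp.
Context {d d1 d2 : measure_display} {T : measurableType d}
  {T1 : measurableType d1} {T2 : measurableType d2}.

Lemma measurable_fst_comp (f : T -> T1 * T2) :
  measurable_fun [set: T] f -> measurable_fun [set: T] (fun t => (f t).1).
Proof. by move=> mf; exact: (measurableT_comp measurable_fst mf). Qed.

Lemma measurable_snd_comp (f : T -> T1 * T2) :
  measurable_fun [set: T] f -> measurable_fun [set: T] (fun t => (f t).2).
Proof. by move=> mf; exact: (measurableT_comp measurable_snd mf). Qed.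

End proj_comp.

Section kernel.
Context {R : realType} (n : nat).
Local Notation RR := (measurableTypeR R).
Local Notation mu := (@lebesgue_measure R).
Local Notation Z := (spacetime R n).
Local Notation V := (@spacetime_measure R n).

Definition ker (alpha : R) (z w : Z) : R :=
  Phi alpha (vsub z.1 w.1) ((z.2 : R) - w.2).

Lemma kerE alpha z w : ker alpha z w =
  (Gamma alpha)^-1 * Kt alpha ((z.2 : R) - w.2) * gauss (vsub z.1 w.1) ((z.2 : R) - w.2).
Proof.
rewrite /ker /Phi /Kt /gauss; case: ifP => _; last by rewrite mulr0 mul0r.
by rewrite [_ / Gamma _]mulrC -!mulrA.
Qed.

Lemma measurable_ker_comp d (T : measurableType d) alpha (f g : T -> Z) :
  measurable_fun [set: T] f -> measurable_fun [set: T] g ->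
  measurable_fun [set: T] (fun t => ker alpha (f t) (g t)).
Proof.
move=> mf mg; under eq_fun do rewrite kerE.
have mf1 := measurable_fst_comp mf; have mg1 := measurable_fst_comp mg.
have mf2 := measurable_snd_comp mf; have mg2 := measurable_snd_comp mg.
apply: measurable_funM; first by mfun.
by apply: measurable_gauss_comp; [exact: measurable_vsub_comp|mfun].
Qed.

End kernel.

Ltac mfun_step := lazymatch goal with
  | |- measurable_fun _ (fun _ => EFin _) => apply/measurable_EFinP
  | |- measurable_fun _ (@GRing.inv _) => exact: (measurable_inv_comp (@measurable_id _ _ setT))
  | |- measurable_fun _ (fun x => x) => exact: measurable_id
  | |- measurable_fun _ (fun _ => ?c) => exact: measurable_cst
  | |- measurable_fun _ (fun _ => (_ * _)%R) => apply: measurable_funM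
  | |- measurable_fun _ (fun _ => (_ - _)%R) => apply: measurable_funB
  | |- measurable_fun _ (fun _ => (_ + _)%R) => apply: measurable_funD
  | |- measurable_fun _ (fun _ => (- _)%R) => apply: measurable_opp_comp
  | |- measurable_fun _ (fun _ => (_ ^-1)%R) => apply: measurable_inv_comp
  | |- measurable_fun _ (fun _ => (_ ^+ _)%R) => apply: measurable_funX
  | |- measurable_fun _ (fun _ => (_ `^ _)%R) => apply: measurable_powR_comp
  | |- measurable_fun _ (fun _ => expR _) => apply: measurable_expR_comp
  | |- measurable_fun _ (fun x => (nat_of_bool (@?f x < @?g x)%R)%:R) =>
      apply: (@measurable_ltr_comp _ _ _ f g)
  | |- measurable_fun _ (fun _ => Kt _ _) => apply: measurable_Kt_comp
  | |- measurable_fun _ (Kt _) => apply: measurable_Kt_comp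
  | |- measurable_fun _ (fun _ => gauss1 _ _) => apply: measurable_gauss1_comp
  | |- measurable_fun _ (fun _ => gauss _ _) => apply: measurable_gauss_comp
  | |- measurable_fun _ (fun _ => vsub _ _) => apply: measurable_vsub_comp
  | |- measurable_fun _ (vsub _) => apply: measurable_vsub_comp
  | |- measurable_fun _ (fun _ => sqnorm _) => apply: measurable_sqnorm_comp
  | |- measurable_fun _ (fun _ => ker _ _ _) => apply: measurable_ker_comp
  | |- measurable_fun _ (ker _ _) => apply: measurable_ker_comp
  | |- measurable_fun _ (fun _ => fst _) =>
      first [exact: measurable_fst | apply: measurable_fst_comp]
  | |- measurable_fun _ (fun _ => snd _) =>
      first [exact: measurable_snd | apply: measurable_snd_comp]
  | |- measurable_fun _ _ => first [assumption | exact: measurable_cst | exact: measurable_id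
      | exact: measurable_fst | exact: measurable_snd]
  end.

Ltac mfun ::= repeat mfun_step.

Section scaled_integral.
Context d (T : measurableType d) (R : realType) (m : {measure set T -> \bar R}).
Variables (k : R) (f : T -> R).
Hypotheses (k0 : 0 <= k) (mf : measurable_fun [set: T] f) (f0 : forall x, 0 <= f x).

Lemma ge0_integral_EFinMl :
  (\int[m]_x (k * f x)%:E = k%:E * \int[m]_x (f x)%:E)%E.
Proof.
under eq_integral do rewrite EFinM.
by rewrite ge0_integralZl_EFin//; [move=> x _; rewrite lee_fin|exact/measurable_EFinP].
Qed.

Lemma ge0_integral_EFinMr :
  (\int[m]_x (f x * k)%:E = k%:E * \int[m]_x (f x)%:E)%E.
Proof. by under eq_integral do rewrite mulrC; exact: ge0_integral_EFinMl. Qed.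

End scaled_integral.

Section kernel_integrals.
Context {R : realType} (n : nat).
Local Notation RR := (measurableTypeR R).
Local Notation mu := (@lebesgue_measure R).
Local Notation E := (euclid R n).
Local Notation Z := (spacetime R n).
Local Notation V := (@spacetime_measure R n).

Lemma ker_ge0 alpha (z w : Z) : 0 < alpha -> 0 <= ker alpha z w.
Proof.
move=> a0; rewrite kerE; apply: (mulr_ge0 (mulr_ge0 _ (Kt_ge0 _ _)) (gauss_ge0 _ _)).
by rewrite invr_ge0; have [_ /ltW] := integral_GammaE a0.
Qed.

Lemma ker0 alpha (z w : Z) : (z.2 : R) <= w.2 -> ker alpha z w = 0.
Proof. by move=> zw; rewrite kerE Kt0 ?mulr0 ?mul0r// subr_le0. Qed.

Lemma JE alpha (f : Z -> R) z :
  J alpha f z = fine (\int[V]_w (ker alpha z w * f w)%:E).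
Proof.
rewrite /J /Rintegral integral_mkcond/=; congr fine; apply: eq_integral => w _.
rewrite patchE; case: ifPn => //; rewrite notin_setE/= => /negP; rewrite -leNgt => h.
by rewrite ker0// mul0r.
Qed.

(** Each time slice contributes k t times the unit mass of a Gaussian. The Gaussian time is required
    to be positive only where k does not vanish, since the time kernels are extended by 0. *)
Lemma integral_gauss_time (k s : RR -> R) (y : E) :
  measurable_fun [set: RR] k -> measurable_fun [set: RR] s ->
  (forall t, 0 <= k t) -> (forall t, k t != 0 -> 0 < s t) ->
  (\int[V]_w (k w.2 * gauss (vsub w.1 y) (s w.2))%:E = \int[mu]_t (k t)%:E)%E.
Proof.
move=> mk ms k0 ks.
have mk2 : measurable_fun [set: Z] (fun w : Z => k w.2) := measurableT_comp mk measurable_snd.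
have ms2 : measurable_fun [set: Z] (fun w : Z => s w.2) := measurableT_comp ms measurable_snd.
rewrite spacetime_tonelli; last 2 first.
- by mfun.
- by move=> w; rewrite lee_fin mulr_ge0 ?gauss_ge0.
apply: eq_integral => t _; rewrite /=.
have [kt0|kt] := eqVneq (k t) 0.
  by rewrite kt0; apply: integral0_eq => x _; rewrite mul0r.
under eq_integral do rewrite EFinM.
rewrite ge0_integralZl//=.
- by rewrite integral_gauss ?mule1// ks.
- by mfun.
- by move=> x _; rewrite lee_fin gauss_ge0.
- by rewrite lee_fin.
Qed.

Lemma integral_gauss_conv_time (k r s : RR -> R) (x y : E) :
  measurable_fun [set: RR] k -> measurable_fun [set: RR] r ->
  measurable_fun [set: RR] s ->
  (forall t, 0 <= k t) -> (forall t, k t != 0 -> 0 < r t) ->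
  (forall t, k t != 0 -> 0 < s t) ->
  (\int[V]_w (k w.2 * (gauss (vsub x w.1) (r w.2) * gauss (vsub w.1 y) (s w.2)))%:E
   = \int[mu]_t (k t * gauss (vsub x y) (r t + s t))%:E)%E.
Proof.
move=> mk mr ms k0 kr ks.
have mk2 : measurable_fun [set: Z] (fun w : Z => k w.2) := measurableT_comp mk measurable_snd.
have mr2 : measurable_fun [set: Z] (fun w : Z => r w.2) := measurableT_comp mr measurable_snd.
have ms2 : measurable_fun [set: Z] (fun w : Z => s w.2) := measurableT_comp ms measurable_snd.
rewrite spacetime_tonelli; last 2 first.
- by mfun.
- by move=> w; rewrite lee_fin; apply: mulr_ge0 => //; rewrite mulr_ge0 ?gauss_ge0.
apply: eq_integral => t _; rewrite /=.
have [kt0|kt] := eqVneq (k t) 0.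
  by rewrite kt0 mul0r; apply: integral0_eq => z _; rewrite mul0r.
under eq_integral do rewrite EFinM.
rewrite ge0_integralZl//=.
- by rewrite integral_gauss_conv ?kr ?ks.
- by mfun.
- by move=> z _; rewrite lee_fin mulr_ge0 ?gauss_ge0.
- by rewrite lee_fin.
Qed.

Lemma ker_gauss_le alpha (z w : Z) : 0 < alpha -> (w.2 : R) < z.2 ->
  ker alpha z w <= (Gamma alpha)^-1 * ((z.2 : R) - w.2) `^ (alpha - 1 - n%:R / 2).
Proof.
move=> a0 wz; have r0 : 0 < (z.2 : R) - w.2 by rewrite subr_gt0.
have G0 : 0 <= (Gamma alpha)^-1.
  by rewrite invr_ge0; have [_ /ltW] := integral_GammaE a0.
rewrite kerE KtE// -mulrA; apply: ler_wpM2l => //.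
rewrite (@powRD _ _ (alpha - 1)) ?(gt_eqF r0) ?implybT//.
apply: ler_wpM2l; first exact: powR_ge0.
rewrite /gauss -[leRHS]mulr1; apply: ler_pM; rewrite ?invr_ge0 ?powR_ge0 ?expR_ge0//.
  rewrite powRN lef_pV2 ?posrE ?powR_gt0 ?mulr_gt0 ?pi_gt0//.
  apply: ge0_ler_powR; rewrite ?nnegrE ?divr_ge0 ?mulr_ge0 ?pi_ge0 ?(ltW r0)//.
  rewrite ler_peMl ?(ltW r0)//; have := pi_ge2 R; lra.
rewrite -expR0 ler_expR mulNr oppr_le0 divr_ge0 ?mulr_ge0 ?(ltW r0)//.
by apply: sumr_ge0 => i _; rewrite sqr_ge0.
Qed.

Lemma Xspace_integralE (p T : R) (f : Z -> R) : 0 < p ->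
  (\int[V]_w (`|(EFin \o (f \_ [set w : Z | ((w.2 : R) < T)%R])) w| `^ p)
   = \int[V]_w (((w.2 : R) < T)%R%:R * `|f w| `^ p)%:E)%E.
Proof.
move=> p0; apply: eq_integral => w _.
rewrite [LHS](_ : _ = (`|(f \_ [set w : Z | ((w.2 : R) < T)%R]) w| `^ p)%:E); last by rewrite -poweR_EFin.
rewrite patchE; congr EFin.
have -> : (w \in [set w : Z | (w.2 : R) < T]) = ((w.2 : R) < T).
  by apply/idP/idP; rewrite inE.
by case: ifP => _; rewrite ?mul1r// normr0 powR0 ?gt_eqF// mul0r.
Qed.

Lemma XspaceP (p : R) (f : Z -> R) : 0 < p ->
  Xspace p f <-> measurable_fun [set: Z] f /\
    forall T, (\int[V]_w (((w.2 : R) < T)%R%:R * `|f w| `^ p)%:E < +oo)%E.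
Proof.
move=> p0; split => -[mf fp]; split => // T; have := fp T.
  by rewrite -Xspace_integralE// -poweR_Lnorm ?gt_eqF//; exact: poweR_lty.
by rewrite -Xspace_integralE// unlock; exact: poweR_lty.
Qed.

Lemma measurable_norm_comp d (T : measurableType d) (f : T -> R) :
  measurable_fun [set: T] f -> measurable_fun [set: T] (fun t => `|f t|).
Proof. by move=> mf; exact: (measurableT_comp (@normr_measurable R setT) mf). Qed.

Lemma ge0_integral_lty_ae d (T : measurableType d) (m : {measure set T -> \bar R})
    (F : T -> \bar R) :
  measurable_fun [set: T] F -> (forall x, 0 <= F x)%E ->
  (\int[m]_x F x < +oo)%E -> {ae m, forall x, F x < +oo}%E.
Proof.
move=> mF F0 Foo.
have iF : m.-integrable [set: T] F.
  apply/integrableP; split => //.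
  by under eq_integral do rewrite gee0_abs//.
have := integrable_ae measurableT iF.
by apply: filterS => x /(_ Logic.I); rewrite ge0_fin_numE.
Qed.

(** Either a <= g, or a = a^p a^(1 - p) <= a^p g^(1 - p). The threshold g is free: it is tuned to
    the kernel when potentials are shown to converge, and with p replaced by lambda it gives the
    Young inequality of the energy estimate. *)
Lemma powR_split_le (a g p : R) : 1 <= p -> 0 <= a -> 0 < g ->
  a <= g + a `^ p * g `^ (1 - p).
Proof.
move=> p1 a0 g0; have [ag|ga] := leP a g.
  by rewrite (le_trans ag)// lerDl mulr_ge0 ?powR_ge0.
have a1 : 0 < a by apply: lt_trans ga.
rewrite -[leLHS]add0r; apply: lerD; first exact: ltW.
rewrite -[1 - p]opprB powRN ler_pdivlMr ?powR_gt0//.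
rewrite -[X in _ <= X](@mulr_powRB1 _ a p) ?(lt_le_trans _ p1)//.
apply: ler_wpM2l => //; apply: ge0_ler_powR; rewrite ?nnegrE ?subr_ge0// ltW//.
Qed.

(** Both admissible ranges reduce to the existence of m. With the threshold g r = r^(-m) at large
    elapsed times, alpha < m makes the kernel times g integrable, and m (p - 1) <= 1 + n/2 - alpha
    makes the kernel times g^(1 - p) bounded. For p > 1 such an m exists exactly when alpha p < (n +
    2)/2. *)
Lemma admissible_exponent (alpha p : R) :
  [/\ 1 < p, 0 < alpha & alpha < (n%:R + 2) / (2 * p)] \/
  [/\ p = 1, 0 < alpha & alpha <= (n%:R + 2) / 2] ->
  [/\ 0 < alpha, 1 <= p & exists2 m, alpha < m & m * (p - 1) <= 1 + n%:R / 2 - alpha].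
Proof.
move=> [[p1 a0]|[-> a0]] H; split => //; first exact: ltW.
- have p0 : 0 < p by apply: lt_trans p1.
  have p10 : 0 < p - 1 by rewrite subr_gt0.
  exists ((1 + n%:R / 2 - alpha) / (p - 1)); last by rewrite divfK// gt_eqF.
  rewrite ltr_pdivlMr//; move: H; rewrite ltr_pdivlMr ?mulr_gt0//; lra.
- exists (alpha + 1); first by rewrite ltrDl.
  rewrite subrr mulr0; lra.
Qed.

Variables (alpha p : R).
Hypothesis alpha_p : [/\ 1 < p, 0 < alpha & alpha < (n%:R + 2) / (2 * p)] \/
  [/\ p = 1, 0 < alpha & alpha <= (n%:R + 2) / 2].

Let a0 : 0 < alpha. Proof. by case: alpha_p => -[]. Qed.
Let G0 : 0 < (Gamma alpha)^-1.
Proof. by rewrite invr_gt0; have [] := integral_GammaE a0. Qed.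

Lemma ker_abs_lty (f : Z -> R) : Xspace p f ->
  {ae V, forall z, (\int[V]_w (ker alpha z w * `|f w|)%:E < +oo)%E}.
Proof.
have [_ p1 [m am mp]] := admissible_exponent alpha_p.
have p0 : 0 < p by apply: lt_le_trans p1.
move=> /(XspaceP _ p0)[mf fp].
have mnf := measurable_norm_comp mf.
(* With elapsed time below 1 the kernel has finite mass in z, so by Tonelli the truncated potential
   of |f|^p is integrable in z, hence finite almost everywhere. The cutoffs at natural N combine
   into one null set. *)
have near N : {ae V, forall z : Z, (\int[V]_w
    (((z.2 : R) - w.2 < 1)%R%:R * ker alpha z w * (((w.2 : R) < N)%R%:R * `|f w| `^ p))%:E < +oo)%E}.
  pose H (u : Z * Z) := (((u.1.2 : R) - u.2.2 < 1)%R%:R * ker alpha u.1 u.2 * (((u.2.2 : R) < N)%R%:R * `|f u.2| `^ p)).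
  have mf2 : measurable_fun [set: Z * Z] (fun u : Z * Z => `|f u.2|).
    exact: (measurableT_comp mnf measurable_snd).
  have mH : measurable_fun [set: Z * Z] (fun u => (H u)%:E).
    by apply/measurable_EFinP; rewrite /H; mfun.
  have H0 u : (0 <= (H u)%:E)%E.
    by rewrite lee_fin; apply: mulr_ge0; rewrite mulr_ge0 ?ker_ge0 ?powR_ge0.
  apply: (@ge0_integral_lty_ae _ _ V (fun z => \int[V]_w (H (z, w))%:E)%E).
  - exact: (measurable_spacetime_integral (F := fun u => (H u)%:E)).
  - by move=> z; apply: integral_ge0.
  rewrite (spacetime_tonelli2 (F := fun u => (H u)%:E))//.
  pose C := (\int[mu]_t ((Gamma alpha)^-1 * ((t < 1)%R%:R * Kt alpha t))%:E)%E.
  have Cfin : (C < +oo)%E.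
    rewrite /C ge0_integral_EFinMl ?(ltW G0)//.
    - by rewrite lte_mul_pinfty ?lee_fin ?(ltW G0)// (le_lt_trans (integral_Kt_le a0 ltr01))// ltry.
    - by mfun.
    - by move=> t; rewrite mulr_ge0 ?Kt_ge0.
  have C0 : (0 <= C)%E.
    by apply: integral_ge0 => t _; rewrite lee_fin mulr_ge0 ?(ltW G0)// mulr_ge0 ?Kt_ge0.
  have E1 w : (\int[V]_z (H (z, w))%:E = (((w.2 : R) < N)%R%:R * `|f w| `^ p)%:E * C)%E.
    transitivity (\int[V]_z ((((z.2 : R) - w.2 < 1)%R%:R * ker alpha z w) * (((w.2 : R) < N)%R%:R * `|f w| `^ p))%:E)%E => //.
    rewrite ge0_integral_EFinMr; last 3 first.
    - by rewrite mulr_ge0 ?powR_ge0.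
    - by mfun.
    - by move=> z; rewrite mulr_ge0 ?ker_ge0.
    congr (_ * _)%E.
    transitivity (\int[V]_z (((Gamma alpha)^-1 * (((z.2 : R) - w.2 < 1)%R%:R * Kt alpha ((z.2 : R) - w.2))) *
       gauss (vsub z.1 w.1) ((z.2 : R) - w.2))%:E)%E.
      by apply: eq_integral => z _; congr EFin; rewrite kerE; ring.
    rewrite (integral_gauss_time (k := fun t => (Gamma alpha)^-1 * ((t - w.2 < 1)%R%:R * Kt alpha (t - w.2)))
      (s := fun t => t - w.2)).
    - rewrite (ge0_integral_shift (- w.2 : R) (F := fun t : RR => ((Gamma alpha)^-1 * ((t < 1)%R%:R * Kt alpha t))%:E))//.
        by mfun.
      by move=> t; rewrite lee_fin mulr_ge0 ?(ltW G0)// mulr_ge0 ?Kt_ge0.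
    - by mfun.
    - by mfun.
    - by move=> t; rewrite mulr_ge0 ?(ltW G0)// mulr_ge0 ?Kt_ge0.
    - by move=> t; have [//|h] := ltP 0 (t - w.2); rewrite Kt0// !mulr0 eqxx.
  under eq_integral do rewrite E1.
  rewrite -(fineK (_ : C \is a fin_num)) ?ge0_fin_numE//.
  rewrite ge0_integralZr//; last 2 first.
  - by mfun.
  - by rewrite lee_fin fine_ge0.
  by rewrite muleC lte_mul_pinfty// lee_fin fine_ge0.
(* The threshold of [powR_split_le], as a function of the elapsed time. *)
pose g (r : R) := if r < 1 then 1 else r `^ (- m).
have g0 r : 0 < r -> 0 < g r by rewrite /g; case: ifP => // _; exact: powR_gt0.
have mg d (T : measurableType d) (h : T -> R) : measurable_fun [set: T] h ->
    measurable_fun [set: T] (fun t => g (h t)).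
  move=> mh; have -> : (fun t => g (h t)) =
     (fun t => (h t < 1)%R%:R + (1 - (h t < 1)%R%:R) * (h t) `^ (- m)).
    by apply/funext => t; rewrite /g; case: ifP => _; rewrite ?subrr ?mul0r ?addr0// subr0 mul1r add0r.
  by mfun.
have near' := ae_foralln (fun N => near N%:R).
move: near'; apply: filterS => z Hz.
pose N := (Num.truncn (z.2 : R)).+1.
have zN w : (w.2 : R) < z.2 -> (w.2 : R) < N%:R.
  by move=> h; apply: lt_trans h _; exact: truncnS_gt.
have {}Hz := Hz N.
pose A w := ker alpha z w * g ((z.2 : R) - w.2).
pose B w := ((z.2 : R) - w.2 < 1)%R%:R * ker alpha z w * (((w.2 : R) < N%:R)%R%:R * `|f w| `^ p).
pose D w := (Gamma alpha)^-1 * (((w.2 : R) < N%:R)%R%:R * `|f w| `^ p).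
have A0 w : 0 <= A w.
  rewrite /A; have [h|h] := ltP (w.2 : R) z.2; last by rewrite ker0// mul0r.
  by rewrite mulr_ge0 ?ker_ge0// ltW// g0// subr_gt0.
have B0 w : 0 <= B w.
  by rewrite /B; apply: mulr_ge0; rewrite mulr_ge0 ?ker_ge0 ?powR_ge0.
have D0 w : 0 <= D w by rewrite /D mulr_ge0 ?(ltW G0)// mulr_ge0 ?powR_ge0.
have mA : measurable_fun [set: Z] A.
  by rewrite /A; apply: measurable_funM; [mfun|apply: mg; mfun].
have mB : measurable_fun [set: Z] B by rewrite /B; mfun.
have mD : measurable_fun [set: Z] D by rewrite /D; mfun.
(* A is the kernel times the threshold; B and D bound the term with |f|^p at elapsed times below 1
   and from 1 on. In the latter range the kernel times g^(1 - p) is at most 1/Gamma(alpha). *)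
have key w : ker alpha z w * `|f w| <= A w + B w + D w.
  have [wz|zw] := ltP (w.2 : R) z.2; last first.
    by rewrite ker0// mul0r !addr_ge0.
  have r0 : 0 < (z.2 : R) - w.2 by rewrite subr_gt0.
  have k0 : 0 <= ker alpha z w by exact: ker_ge0.
  apply: (@le_trans _ _ (ker alpha z w * (g ((z.2 : R) - w.2) + `|f w| `^ p * g ((z.2 : R) - w.2) `^ (1 - p)))).
    by apply: ler_wpM2l => //; apply: powR_split_le => //; exact: g0.
  rewrite mulrDr -addrA; apply: lerD => //.
  rewrite /B /D zN// /g; case: ifPn => [_|]; first by rewrite powR1 !mul1r mulr1 lerDl mulr_ge0 ?(ltW G0) ?powR_ge0.
  rewrite -leNgt => r1; rewrite !mul0r add0r mul1r mulrCA mulrC.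
  apply: ler_wpM2r; first exact: powR_ge0.
  apply: (@le_trans _ _ ((Gamma alpha)^-1 * ((z.2 : R) - w.2) `^ (alpha - 1 - n%:R / 2) * (((z.2 : R) - w.2) `^ (- m)) `^ (1 - p))).
    by apply: ler_wpM2r; [exact: powR_ge0|exact: ker_gauss_le].
  rewrite -powRrM -mulrA -powRD ?(gt_eqF r0) ?implybT// ler_piMr ?(ltW G0)//.
  rewrite -[leRHS](@powRr0 _ ((z.2 : R) - w.2)); apply: ler_powR => //.
  by move: mp; lra.
have finA : (\int[V]_w (A w)%:E < +oo)%E.
  have -> : (\int[V]_w (A w)%:E = \int[V]_w (((Gamma alpha)^-1 * (Kt alpha ((z.2 : R) - w.2) * g ((z.2 : R) - w.2))) *
       gauss (vsub w.1 z.1) ((z.2 : R) - w.2))%:E)%E.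
    by apply: eq_integral => w _; congr EFin; rewrite /A kerE gauss_vsubC; ring.
  have Kg0 t : 0 <= Kt alpha t * g t.
    by have [h|h] := ltP 0 t; [rewrite mulr_ge0 ?Kt_ge0// ltW// g0|rewrite Kt0// mul0r].
  have mKg : measurable_fun [set: RR] (fun t : RR => Kt alpha t * g t).
    by apply: measurable_funM; [mfun|apply: mg; mfun].
  rewrite (integral_gauss_time (k := fun t => (Gamma alpha)^-1 * (Kt alpha ((z.2 : R) - t) * g ((z.2 : R) - t)))
      (s := fun t => (z.2 : R) - t)); last 4 first.
  - by apply: measurable_funM; [mfun|apply: measurable_funM; [mfun|apply: mg; mfun]].
  - by mfun.
  - by move=> t; rewrite mulr_ge0 ?(ltW G0).
  - by move=> t; have [//|h] := ltP 0 ((z.2 : R) - t); rewrite Kt0// mul0r mulr0 eqxx.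
  rewrite (ge0_integral_reflect (z.2 : R) (F := fun t : RR => ((Gamma alpha)^-1 * (Kt alpha t * g t))%:E)); last 2 first.
  - by apply/measurable_EFinP; apply: measurable_funM => //; mfun.
  - by move=> t; rewrite lee_fin mulr_ge0 ?(ltW G0).
  rewrite ge0_integral_EFinMl ?(ltW G0)// lte_mul_pinfty ?lee_fin ?(ltW G0)//.
  apply: (@le_lt_trans _ _ (\int[mu]_t (((t < 2)%R%:R * Kt alpha t)%:E + ((1 < t)%R%:R * t `^ (alpha - m - 1))%:E))%E).
    apply: ge0_le_integral => //.
    - by move=> t _; rewrite lee_fin.
    - by apply/measurable_EFinP.
    - by apply: emeasurable_funD; mfun.
    - move=> t _; rewrite -EFinD lee_fin.
      have [t0|t0] := leP t 0; first by rewrite Kt0// mul0r addr_ge0 ?mulr_ge0 ?powR_ge0// Kt_ge0.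
      rewrite /g; case: ifPn => [t1|].
        by rewrite mulr1 (lt_trans t1) ?ltr1n// mul1r lerDl mulr_ge0 ?powR_ge0.
      rewrite -leNgt le_eqVlt => /predU1P[<-|t1].
        by rewrite ltr1n ltxx mul0r addr0 mul1r powR1 mulr1.
      rewrite t1 mul1r KtE// -powRD ?(gt_eqF t0) ?implybT//.
      have -> : alpha - 1 - m = alpha - m - 1 by ring.
      by rewrite lerDr mulr_ge0 ?powR_ge0.
  rewrite ge0_integralD//; last 4 first.
  - by move=> t _; rewrite lee_fin mulr_ge0 ?Kt_ge0.
  - by mfun.
  - by move=> t _; rewrite lee_fin mulr_ge0 ?powR_ge0.
  - by mfun.
  apply: lte_add_pinfty.
    by apply: le_lt_trans (integral_Kt_le a0 _) _; rewrite ?ltry.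
  by apply: le_lt_trans (integral_powR_tail _) _; rewrite ?ltry// subr_lt0.
have finD : (\int[V]_w (D w)%:E < +oo)%E.
  rewrite /D ge0_integral_EFinMl ?(ltW G0)//.
  - by rewrite lte_mul_pinfty ?lee_fin ?(ltW G0)//.
  by mfun.
apply: (@le_lt_trans _ _ (\int[V]_w ((A w)%:E + (B w)%:E + (D w)%:E))%E).
  apply: ge0_le_integral => //.
  - by move=> w _; rewrite lee_fin mulr_ge0 ?ker_ge0.
  - by mfun.
  - by do 2?[apply: emeasurable_funD]; exact/measurable_EFinP.
  - by move=> w _; rewrite -!EFinD lee_fin.
rewrite ge0_integralD//; last 4 first.
- by move=> w _; rewrite -EFinD lee_fin addr_ge0.
- by apply: emeasurable_funD; exact/measurable_EFinP.
- by move=> w _; rewrite lee_fin.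
- exact/measurable_EFinP.
rewrite ge0_integralD//; last 4 first.
- by move=> w _; rewrite lee_fin.
- exact/measurable_EFinP.
- by move=> w _; rewrite lee_fin.
- exact/measurable_EFinP.
by rewrite lte_add_pinfty// lte_add_pinfty.
Qed.

End kernel_integrals.

(** * Null potentials: localisation in time *)

Lemma measurable_spacetime_fubini {R : realType} (n : nat)
    (F : spacetime R n * spacetime R n -> \bar R) :
  measurable_fun [set: spacetime R n * spacetime R n] F ->
  (\int[@spacetime_measure R n]_z \int[@spacetime_measure R n]_w `|F (z, w)| < +oo)%E ->
  measurable_fun [set: spacetime R n] (fun z => \int[@spacetime_measure R n]_w F (z, w))%E.
Proof.
move=> mF Foo.
apply: (@measurable_fubini_F _ _ _ _ R (spacetime_sigma_finite n) (spacetime_sigma_finite n) F).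
exact/integrable12ltyP.
Qed.

Section threshold_polynomials.
Context {R : realType}.

(* These converge on [0, 1] to the indicator of v < 1/2, except at v = 1/2. *)
Definition threshold_poly (N : nat) : {poly R} := (1 - 'X^N) ^+ (2 ^ N).

Lemma threshold_polyE N (v : R) : (threshold_poly N).[v] = (1 - v ^+ N) ^+ (2 ^ N).
Proof. by rewrite /threshold_poly !hornerE. Qed.

Lemma threshold_poly_itv N (v : R) : 0 <= v <= 1 -> 0 <= (threshold_poly N).[v] <= 1.
Proof.
move=> /andP[v0 v1]; rewrite threshold_polyE.
have h : 0 <= 1 - v ^+ N <= 1.
  by rewrite subr_ge0 exprn_ile1//= gerBl exprn_ge0.
by case/andP: h => h1 h2; rewrite exprn_ge0// exprn_ile1.
Qed.

Lemma bernoulli_ge (x : R) (m : nat) : 0 <= x <= 1 -> 1 - m%:R * x <= (1 - x) ^+ m.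
Proof.
move=> /andP[x0 x1]; elim: m => [|m IH]; first by rewrite mul0r subr0 expr0.
rewrite exprS; have h : 0 <= 1 - x by rewrite subr_ge0.
apply: le_trans (ler_wpM2l h IH).
have : 0 <= m%:R * x * x by rewrite !mulr_ge0.
rewrite -natr1; lra.
Qed.

(** The exponent m = 2^N satisfies m v^N = (2 v)^N. For v < 1/2 this tends to 0 and the Bernoulli
    inequality bounds the value below by 1 - (2 v)^N; for v > 1/2 it tends to infinity and (1 - x)^m
    <= exp(- m x) <= 1/(m x). *)
Lemma threshold_poly_cvg (v : R) : 0 <= v <= 1 -> v != 2^-1 ->
  (threshold_poly N).[v] @[N --> \oo] --> ((v < 2^-1)%R%:R : R).
Proof.
move=> /andP[v0 v1] v2.
have pw N : (2 ^ N)%N%:R * v ^+ N = (2 * v) ^+ N by rewrite natrX exprMn.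
have vN N : 0 <= v ^+ N <= 1 by rewrite exprn_ge0// exprn_ile1.
have [lt|ge] := ltP v 2^-1.
- have q1 : `|2 * v| < 1 by rewrite ger0_norm ?mulr_ge0//; lra.
  have c1 : (fun N => 1 - (2 * v) ^+ N) @ \oo --> (1 : R).
    by rewrite -[X in _ --> X]subr0; apply: cvgB; [exact: cvg_cst|exact: cvg_expr].
  change ((threshold_poly N).[v] @[N --> \oo] --> (1 : R)).
  apply: (squeeze_cvgr _ c1 (@cvg_cst _ _ _ _ _)).
  apply: nearW => N; rewrite -pw threshold_polyE bernoulli_ge//=.
  have H : 0 <= v <= 1 by rewrite v0 v1.
  by have := threshold_poly_itv N H; rewrite threshold_polyE => /andP[].
- have gt : 2^-1 < v by rewrite lt_neqAle eq_sym v2.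
  have vp : 0 < 2 * v by lra.
  have q1 : `|(2 * v)^-1| < 1.
    by rewrite ger0_norm ?invr_ge0 ?(ltW vp)// invf_lt1//; lra.
  change ((threshold_poly N).[v] @[N --> \oo] --> (0 : R)).
  apply: (squeeze_cvgr _ (@cvg_cst _ _ _ _ _) (cvg_expr q1)).
  have H : 0 <= v <= 1 by rewrite v0 v1.
  apply: nearW => N; have /andP[-> _] /= := threshold_poly_itv N H.
  rewrite threshold_polyE exprVn -pw.
  have w0 : 0 < v ^+ N by rewrite exprn_gt0//; lra.
  have m0 : 0 < (2 ^ N)%N%:R :> R by rewrite ltr0n expn_gt0.
  have e1 : (1 - v ^+ N) ^+ (2 ^ N) <= expR (- v ^+ N) ^+ (2 ^ N).
    apply: lerXn2r; rewrite ?nnegrE ?expR_ge0//.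
      by have /andP[_] := vN N; rewrite subr_ge0.
    exact: expR_ge1Dx.
  apply: le_trans e1 _; rewrite -expRM_natl mulrN expRN lef_pV2 ?posrE ?expR_gt0 ?mulr_gt0//.
  by apply: le_trans (expR_ge1Dx _); rewrite lerDr.
Qed.

End threshold_polynomials.

Section injectivity_time.
Context {R : realType} (n : nat) (alpha : R).
Hypothesis alpha0 : 0 < alpha.
Local Notation RR := (measurableTypeR R).
Local Notation mu := (@lebesgue_measure R).
Local Notation E := (euclid R n).
Local Notation Z := (spacetime R n).
Local Notation V := (@spacetime_measure R n).

Let G0 : 0 < (Gamma alpha)^-1.
Proof. by rewrite invr_gt0; have [] := integral_GammaE alpha0. Qed.

Definition time_ratio (a : R) (z w : Z) : R :=
  ((z.2 : R) - w.2) / ((z.2 : R) - w.2 + a).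

(* Integrated in z against [ker alpha z w], this weight gives back
   [ker alpha z0 w] times a power of [time_ratio a z0 w], up to a constant. *)
Let phi (k a : R) (z0 z : Z) : R :=
  Kt k ((z0.2 : R) - z.2) * ((z0.2 : R) - z.2 + a) `^ (- alpha - k) *
  gauss (vsub z0.1 z.1) ((z0.2 : R) - z.2).

Let phi_ge0 k a z0 z : 0 <= phi k a z0 z.
Proof. by apply: mulr_ge0; [rewrite mulr_ge0 ?Kt_ge0 ?powR_ge0|exact: gauss_ge0]. Qed.

(** In space the two Gaussians merge into one that does not depend on the intermediate time; in time
    there remains [integral_Kt_moebius] with r the time elapsed before z0. *)
Lemma integral_test_ker (k : nat) (a : R) (z0 w : Z) : 0 < a ->
  (\int[V]_z (phi k.+1%:R a z0 z * ker alpha z w)%:E =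
   (Beta alpha k.+1%:R * a `^ (- alpha) * (ker alpha z0 w * time_ratio a z0 w ^+ k.+1))%:E)%E.
Proof.
move=> a0.
pose kap (t : R) := (Gamma alpha)^-1 * (Kt alpha (t - w.2) * (Kt k.+1%:R ((z0.2 : R) - t) *
   ((z0.2 : R) - t + a) `^ (- alpha - k.+1%:R))).
have kap0 t : 0 <= kap t by rewrite mulr_ge0 ?(ltW G0)// mulr_ge0 ?Kt_ge0// mulr_ge0 ?Kt_ge0 ?powR_ge0.
have mkap : measurable_fun [set: RR] kap by rewrite /kap; mfun.
transitivity (\int[V]_z (kap z.2 * (gauss (vsub z0.1 z.1) ((z0.2 : R) - z.2) *
   gauss (vsub z.1 w.1) ((z.2 : R) - w.2)))%:E)%E.
  by apply: eq_integral => z _; congr EFin; rewrite kerE /phi /kap; ring.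
rewrite (integral_gauss_conv_time (k := kap) (r := fun t => (z0.2 : R) - t) (s := fun t => t - w.2))//; last 4 first.
- by mfun.
- by mfun.
- by move=> t; rewrite /kap; have [//|h] := ltP 0 ((z0.2 : R) - t); rewrite [Kt k.+1%:R _]Kt0// mul0r !mulr0 eqxx.
- by move=> t; rewrite /kap; have [//|h] := ltP 0 (t - w.2); rewrite Kt0// mul0r !mulr0 eqxx.
pose sg := (z0.2 : R) - w.2.
have -> : (\int[mu]_t (kap t * gauss (vsub z0.1 w.1) ((z0.2 : R) - t + (t - w.2)))%:E =
   (gauss (vsub z0.1 w.1) sg)%:E * \int[mu]_t (kap t)%:E)%E.
  rewrite -(@ge0_integral_EFinMr _ RR R mu (gauss (vsub z0.1 w.1) sg) kap (gauss_ge0 _ _) mkap kap0).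
  by apply: eq_integral => t _; congr (EFin (_ * gauss _ _)); rewrite /sg; ring.
have -> : (\int[mu]_t (kap t)%:E = ((Gamma alpha)^-1 * (Beta alpha k.+1%:R * a `^ (- alpha) *
     (Kt alpha sg * time_ratio a z0 w ^+ k.+1)))%:E)%E.
  rewrite ge0_integral_EFinMl ?(ltW G0)//; last 2 first.
  - by mfun.
  - by move=> t; rewrite mulr_ge0 ?Kt_ge0// mulr_ge0 ?Kt_ge0 ?powR_ge0.
  rewrite EFinM; congr (_ * _)%E.
  pose F (r : RR) := (Kt alpha (sg - r) * (Kt k.+1%:R r * (r + a) `^ (- alpha - k.+1%:R)))%:E.
  transitivity (\int[mu]_t F ((z0.2 : R) - t)%R)%E.
    by apply: eq_integral => t _; rewrite /F /sg; congr (EFin (Kt _ _ * _)); ring.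
  rewrite ge0_integral_reflect; last 2 first.
  - by apply/measurable_EFinP; mfun.
  - by move=> t; rewrite lee_fin mulr_ge0 ?Kt_ge0// mulr_ge0 ?Kt_ge0 ?powR_ge0.
  have [s0|s0] := ltP 0 sg.
    rewrite /F integral_Kt_moebius ?ltr0n//; congr (EFin (_ * (_ * _))).
    have sa : 0 < sg + a by exact: addr_gt0.
    by rewrite powR_mulrn// divr_ge0 ?(ltW s0) ?(ltW sa).
  rewrite [Kt alpha sg]Kt0// mul0r mulr0 integral0_eq// => r _; rewrite /F.
  have [r0|r0] := leP r 0; first by rewrite [Kt k.+1%:R _]Kt0// mul0r mulr0.
  by rewrite Kt0 ?mul0r// subr_le0 (le_trans s0)// ltW.
by rewrite -EFinM kerE -/sg; congr EFin; ring.
Qed.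

Variable h : Z -> R.
Hypothesis mh : measurable_fun [set: Z] h.
Hypothesis habs : {ae V, forall z, (\int[V]_w (ker alpha z w * `|h w|)%:E < +oo)%E}.
Hypothesis hJ : {ae V, forall z, J alpha h z = 0}.

Let mnh : measurable_fun [set: Z] (fun w => `|h w|) := measurable_norm_comp mh.

Lemma ker_integrable z : (\int[V]_w (ker alpha z w * `|h w|)%:E < +oo)%E ->
  V.-integrable [set: Z] (fun w => (ker alpha z w * h w)%:E).
Proof.
move=> H; apply/integrableP; split; first by mfun.
apply: le_lt_trans H; apply: ge0_le_integral => //.
- by apply: measurableT_comp => //; mfun.
- by mfun.
- by move=> w _; rewrite /= normrM ger0_norm ?ker_ge0.
Qed.

(** At such points J h = 0 states that a convergent integral vanishes, and does not come from the
    default value of a divergent one. *)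
Let good (z : Z) := (\int[V]_w (ker alpha z w * `|h w|)%:E < +oo)%E /\
  (\int[V]_w (ker alpha z w * h w)%:E = 0)%E.

Let good_ae : {ae V, forall z, good z}.
Proof.
apply: filterS2 habs hJ => z H1 H2; split => //.
have := integrable_fin_num measurableT (ker_integrable H1).
by rewrite JE in H2 => /fineK; rewrite H2 => <-.
Qed.

Let ratio_itv a z0 w : 0 < a -> (w.2 : R) < z0.2 -> 0 <= time_ratio a z0 w <= 1.
Proof.
move=> a0 wz; have s0 : 0 < (z0.2 : R) - w.2 by rewrite subr_gt0.
rewrite /time_ratio; have sa : 0 < (z0.2 : R) - w.2 + a by exact: addr_gt0.
by rewrite divr_ge0 ?(ltW s0) ?(ltW sa)//= ler_pdivrMr// mul1r lerDl ltW.
Qed.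

Let mratio a z0 : measurable_fun [set: Z] (fun w => time_ratio a z0 w).
Proof. by rewrite /time_ratio; mfun. Qed.

(** The moment of order 0 is J h at z0 itself; the others come from exchanging the integrals when J
    h = 0 is tested against [phi], whose power of the elapsed time must be positive for the Beta
    integral. *)
Lemma ker_moment0 (k : nat) (a : R) (z0 : Z) : 0 < a -> good z0 ->
  (\int[V]_w (time_ratio a z0 w ^+ k * (ker alpha z0 w * h w))%:E = 0)%E.
Proof.
move=> a0 [g1 g2]; case: k => [|k].
  by under eq_integral do rewrite expr0 mul1r.
pose c := Beta alpha k.+1%:R * a `^ (- alpha).
have c0 : 0 < c.
  by rewrite mulr_gt0 ?powR_gt0//; have [] := @integral_BetaE R alpha k.+1%:R alpha0 (ltr0Sn _ _).
pose F (u : Z * Z) := phi k.+1%:R a z0 u.1 * ker alpha u.1 u.2 * h u.2.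
have mh2 : measurable_fun [set: Z * Z] (fun u : Z * Z => h u.2) := measurableT_comp mh measurable_snd.
have mF : measurable_fun [set: Z * Z] (fun u => (F u)%:E).
  by apply/measurable_EFinP; rewrite /F /phi; mfun.
have mphi : measurable_fun [set: Z] (fun z => phi k.+1%:R a z0 z) by rewrite /phi; mfun.
have mpk w : measurable_fun [set: Z] (fun z => phi k.+1%:R a z0 z * ker alpha z w) by mfun.
have pk0 w z : 0 <= phi k.+1%:R a z0 z * ker alpha z w by rewrite mulr_ge0 ?ker_ge0.
(* Since [time_ratio] is at most 1 in the past of z0, the iterated absolute integral is at most c
   times the potential of |h| at z0. *)
have Foo : (\int[V]_z \int[V]_w `|(F (z, w))%:E| < +oo)%E.
  rewrite (spacetime_tonelli2 (F := fun u => `|(F u)%:E|%E))//; last exact: measurableT_comp.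
  apply: (@le_lt_trans _ _ (\int[V]_w (c * (ker alpha z0 w * `|h w|))%:E)%E); last first.
    rewrite ge0_integral_EFinMl ?(ltW c0)//.
    - by rewrite lte_mul_pinfty ?lee_fin ?(ltW c0).
    - by mfun.
    - by move=> w; rewrite mulr_ge0 ?ker_ge0.
  apply: ge0_le_integral => //.
  - by move=> w _; exact: integral_ge0.
  - apply: (measurable_spacetime_integral2 (F := fun u => `|(F u)%:E|%E)) => //.
    exact: measurableT_comp.
  - by mfun.
  - move=> w _.
    have -> : (\int[V]_z `|(F (z, w))%:E| =
        \int[V]_z ((phi k.+1%:R a z0 z * ker alpha z w) * `|h w|)%:E)%E.
      by apply: eq_integral => z _; rewrite /F/= normrM ger0_norm.
    rewrite ge0_integral_EFinMr// integral_test_ker// -EFinM lee_fin -/c.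
    rewrite mulrC -mulrA ler_pM2l//; apply: ler_wpM2r => //.
    have [wz|zw] := ltP (w.2 : R) z0.2; last by rewrite ker0// mul0r.
    have /andP[h1 h2] := ratio_itv a0 wz.
    by rewrite ler_piMr ?ker_ge0// exprn_ile1.
have := spacetime_fubini2 mF Foo.
have -> : (\int[V]_z \int[V]_w (F (z, w))%:E = 0)%E.
  apply: etrans (integral0 V [set: Z]).
  apply: ae_eq_integral => //.
    exact: (measurable_spacetime_fubini (F := fun u => (F u)%:E)).
  move: good_ae; apply: filterS => z [z1 z2] _.
  transitivity ((phi k.+1%:R a z0 z)%:E * \int[V]_w (ker alpha z w * h w)%:E)%E.
    rewrite -integralZl//; last exact: ker_integrable.
    by apply: eq_integral => w _; rewrite /F -EFinM mulrA.
  by rewrite z2 mule0.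
move=> /esym.
have -> : (\int[V]_w \int[V]_z (F (z, w))%:E = \int[V]_w (c%:E * (time_ratio a z0 w ^+ k.+1 * (ker alpha z0 w * h w))%:E))%E.
  apply: eq_integral => w _.
  transitivity (\int[V]_z (phi k.+1%:R a z0 z * ker alpha z w)%:E * (h w)%:E)%E.
    rewrite -integralZr//; last first.
      apply/integrableP; split; first exact/measurable_EFinP.
      under eq_integral do rewrite gee0_abs ?lee_fin//.
      by rewrite integral_test_ker// ltry.
  by rewrite integral_test_ker// -!EFinM; congr EFin; rewrite -/c; ring.
rewrite integralZl//.
  by move=> /eqP; rewrite mule_eq0 eqe (gt_eqF c0)/= => /eqP.
apply: (@le_integrable _ _ _ V _ measurableT _ (fun w => (ker alpha z0 w * h w)%:E)).
- by mfun.
- move=> w _; rewrite !abse_EFin lee_fin normrM.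
  have [wz|zw] := ltP (w.2 : R) z0.2; last by rewrite [ker _ _ _]ker0// mul0r normr0 mulr0.
  have /andP[h1 h2] := ratio_itv a0 wz.
  by rewrite ler_piMl// normrX ger0_norm// exprn_ile1.
- exact: ker_integrable.
Qed.

Lemma ker_poly0 (P : {poly R}) (a : R) (z0 : Z) : 0 < a -> good z0 ->
  (\int[V]_w (P.[time_ratio a z0 w] * (ker alpha z0 w * h w))%:E = 0)%E.
Proof.
move=> a0 g0.
have ik k : V.-integrable [set: Z] (fun w => (time_ratio a z0 w ^+ k * (ker alpha z0 w * h w))%:E).
  apply: (@le_integrable _ _ _ V _ measurableT _ (fun w => (ker alpha z0 w * h w)%:E)).
  - by mfun.
  - move=> w _; rewrite !abse_EFin lee_fin normrM.
    have [wz|zw] := ltP (w.2 : R) z0.2; last by rewrite [ker _ _ _]ker0// mul0r normr0 mulr0.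
    have /andP[h1 h2] := ratio_itv a0 wz.
    by rewrite ler_piMl// normrX ger0_norm// exprn_ile1.
  - by case: g0 => g1 _; exact: ker_integrable.
under eq_integral => w _.
  have -> : ((P.[time_ratio a z0 w] * (ker alpha z0 w * h w))%:E =
    (\sum_(i <- index_iota 0 (size P)) (P`_i)%:E * (time_ratio a z0 w ^+ i * (ker alpha z0 w * h w))%:E))%E.
    rewrite horner_coef -(big_mkord xpredT (fun i => P`_i * time_ratio a z0 w ^+ i)) mulr_suml -sumEFin.
    by apply: eq_bigr => i _; rewrite -EFinM -!mulrA.
  over.
rewrite integral_sum//; last by move=> i; exact: integrableZl.
apply: big1 => i _; rewrite integralZl//.
by rewrite ker_moment0 ?mule0.
Qed.

Lemma spacetime_slice0 (c : R) : {ae V, forall w, (w.2 : R) != c}.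
Proof.
exists ([set: E] `*` [set c : RR]); split.
- by apply: measurableX => //; exact: measurable_set1.
- transitivity ((@lebesgue_vec R n \x mu)%E ([set: E] `*` [set c : RR])) => //.
  rewrite product_measure1E//.
  rewrite [X in (_ * X)%E](_ : _ = 0%E) ?mule0//; exact: lebesgue_measure_set1.
- by move=> w /= /negP; rewrite negbK => /eqP wc; split.
Qed.

(** [time_ratio] is below 1/2 exactly when the elapsed time is below a. Dominated convergence
    applies with the kernel times |h| as majorant; the slice where the ratio equals 1/2 is null. *)
Lemma ker_short_memory0 (a : R) (z0 : Z) : 0 < a -> good z0 ->
  (\int[V]_w (((z0.2 : R) - w.2 < a)%R%:R * (ker alpha z0 w * h w))%:E = 0)%E.
Proof.
move=> a0 g0.
pose f_ N w := ((threshold_poly N).[time_ratio a z0 w] * (ker alpha z0 w * h w))%:E.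
pose f w := (((z0.2 : R) - w.2 < a)%R%:R * (ker alpha z0 w * h w))%:E.
have mf_ N : measurable_fun [set: Z] (f_ N).
  have -> : f_ N = (fun w => ((1 - time_ratio a z0 w ^+ N) ^+ (2 ^ N) * (ker alpha z0 w * h w))%:E).
    by apply/funext => w; rewrite /f_ threshold_polyE.
  by mfun.
have mf : measurable_fun [set: Z] f by apply/measurable_EFinP; mfun.
have cv : {ae V, forall w, [set: Z] w -> f_ ^~ w @ \oo --> f w}.
  have sl := spacetime_slice0 ((z0.2 : R) - a).
  have FF : Filter (nbhs (almost_everywhere V)) by typeclasses eauto.
  apply: (@filterS _ _ FF _ _ _ sl) => w wa _.
  have [wz|zw] := ltP (w.2 : R) z0.2; last first.
    rewrite /f_ /f ker0// mul0r mulr0; under eq_fun do rewrite mulr0.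
    exact: cvg_cst.
  have s0 : 0 < (z0.2 : R) - w.2 by rewrite subr_gt0.
  have sa : 0 < (z0.2 : R) - w.2 + a by exact: addr_gt0.
  apply: cvg_EFin; first exact: nearW.
  apply: cvgM; last exact: cvg_cst.
  have -> : ((z0.2 : R) - w.2 < a) = (time_ratio a z0 w < 2^-1).
    by rewrite /time_ratio ltr_pdivrMr//; apply/idP/idP; lra.
  apply: threshold_poly_cvg; first exact: ratio_itv.
  apply: contra wa => /eqP; rewrite /time_ratio => /(congr1 (fun x => x * ((z0.2 : R) - w.2 + a))).
  rewrite divfK; last exact: lt0r_neq0.
  move=> H; apply/eqP; apply: (_ : (w.2 : R) = (z0.2 : R) - a); lra.
have [] := @dominated_convergence _ _ _ V _ measurableT f_ f
  (fun w => `|(ker alpha z0 w * h w)%:E|%E) mf_ mf.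
- exact: cv.
- by case: g0 => g1 _; apply: integrable_abse; exact: ker_integrable.
- apply: nearW => w N _; rewrite /f_ !abse_EFin lee_fin normrM.
  have [wz|zw] := ltP (w.2 : R) z0.2; last by rewrite [ker _ _ _]ker0// mul0r normr0 mulr0.
  have /andP[h1 h2] := threshold_poly_itv N (ratio_itv a0 wz).
  by rewrite ler_piMl// ger0_norm.
move=> _ _ H; rewrite -(cvg_lim _ H)//.
under [X in limn X]eq_fun do rewrite /f_ ker_poly0//.
exact: lim_cst.
Qed.

Lemma ker_short_memory_ae : {ae V, forall z, forall a, 0 < a ->
  (\int[V]_w (((z.2 : R) - w.2 < a)%R%:R * (ker alpha z w * h w))%:E = 0)%E}.
Proof. by apply: filterS good_ae => z gz a a0; exact: ker_short_memory0. Qed.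

End injectivity_time.

(** * Null potentials: localisation in space *)

Section gauss_bounds.
Context {R : realType} (n : nat).
Local Notation E := (euclid R n).
Implicit Types (x y : E) (r : R).

Lemma sqnorm_ge0 x : 0 <= sqnorm x.
Proof. by apply: sumr_ge0 => i _; rewrite sqr_ge0. Qed.

Lemma sqnorm_triangle x y : sqnorm x <= 2 * sqnorm (vsub y x) + 2 * sqnorm y.
Proof.
rewrite /sqnorm !mulr_sumr -big_split/=; apply: ler_sum => i _.
rewrite tnth_mktuple -subr_ge0.
have -> : 2 * (tnth y i - tnth x i) ^+ 2 + 2 * tnth y i ^+ 2 - tnth x i ^+ 2 =
  (2 * tnth y i - tnth x i) ^+ 2 :> R by ring.
exact: sqr_ge0.
Qed.

(** Half of the Gaussian exponent is split off as a free decaying factor, at the price of doubling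
    the time. The two bounds that follow spend this factor differently. *)
Lemma gauss_dilate x r : 0 < r ->
  gauss x r = 2 `^ (n%:R / 2) * gauss x (2 * r) * expR (- sqnorm x / (8 * r)).
Proof.
move=> r0; rewrite /gauss.
have -> : 4 * pi * (2 * r) = 2 * (4 * pi * r) by ring.
rewrite [in RHS]powRM ?mulr_ge0 ?pi_ge0 ?(ltW r0)//.
set P := (4 * pi * r) `^ _; set D := 2 `^ _.
have P0 : P != 0 by rewrite gt_eqF ?powR_gt0// !mulr_gt0 ?pi_gt0.
have D0 : D != 0 by rewrite gt_eqF ?powR_gt0.
transitivity (P^-1 * (expR (- sqnorm x / (4 * (2 * r))) * expR (- sqnorm x / (8 * r)))).
  rewrite -expRD; congr (_ * expR _); field; exact: lt0r_neq0.
by field; rewrite P0 D0.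
Qed.

(** The split-off factor satisfies u exp(- u/(8 r)) <= 8 r. This quantifies the concentration of the
    kernel for small r. *)
Lemma gauss_second_moment_le x r : 0 < r ->
  sqnorm x * gauss x r <= 8 * r * (2 `^ (n%:R / 2)) * gauss x (2 * r).
Proof.
move=> r0; rewrite (gauss_dilate _ r0).
have g0 := gauss_ge0 x (2 * r).
have D0 : 0 <= 2 `^ (n%:R / 2) :> R by exact: powR_ge0.
have s0 := sqnorm_ge0 x.
have r80 : 0 < 8 * r by rewrite mulr_gt0.
have u : sqnorm x * expR (- sqnorm x / (8 * r)) <= 8 * r.
  rewrite mulNr expRN ler_pdivrMr ?expR_gt0// mulrC -ler_pdivrMr//.
  by apply: le_trans (expR_ge1Dx _); rewrite lerDr.
have -> : sqnorm x * (2 `^ (n%:R / 2) * gauss x (2 * r) * expR (- sqnorm x / (8 * r))) =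
  (sqnorm x * expR (- sqnorm x / (8 * r))) * (2 `^ (n%:R / 2) * gauss x (2 * r)) by ring.
by rewrite -[leRHS]mulrA; apply: ler_wpM2r => //; rewrite mulr_ge0.
Qed.

(** For y in a bounded set the split-off factor decays in x uniformly in r <= 1, because |y - x|^2/8
    >= |x|^2/16 - |y|^2/8. *)
Lemma gauss_local_le x y r M : 0 < r -> r <= 1 -> sqnorm y <= M ->
  gauss (vsub y x) r <=
  2 `^ (n%:R / 2) * expR (M / 8) * expR (- sqnorm x / 16) * gauss (vsub y x) (2 * r).
Proof.
move=> r0 r1 yM; rewrite (gauss_dilate _ r0).
have g0 := gauss_ge0 (vsub y x) (2 * r).
have D0 : 0 <= 2 `^ (n%:R / 2) :> R by exact: powR_ge0.
have -> : 2 `^ (n%:R / 2) * expR (M / 8) * expR (- sqnorm x / 16) * gauss (vsub y x) (2 * r) =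
  2 `^ (n%:R / 2) * gauss (vsub y x) (2 * r) * (expR (M / 8) * expR (- sqnorm x / 16)) by ring.
apply: ler_wpM2l; first by rewrite mulr_ge0.
rewrite -expRD ler_expR.
apply: (@le_trans _ _ (- sqnorm (vsub y x) / 8)).
  rewrite !mulNr lerN2; apply: ler_wpM2l; first exact: sqnorm_ge0.
  by rewrite lef_pV2 ?posrE ?mulr_gt0// ler_piMr.
by have := sqnorm_triangle x y; lra.
Qed.

End gauss_bounds.

Section boxes.
Context {R : realType} (n : nat).
Local Notation RR := (measurableTypeR R).
Local Notation E := (euclid R n).
Local Notation Z := (spacetime R n).
Local Notation V := (@spacetime_measure R n).

Definition box (l u : 'I_n -> R) (c d : R) : set Z :=
  [set z | (forall i, l i < (tnth z.1 i : R) < u i) /\ c < (z.2 : R) < d].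

Lemma measurable_coord_itv (i : 'I_n) (I : set RR) : measurable I ->
  measurable [set z : Z | I (tnth z.1 i)].
Proof.
move=> mI; have mt : measurable_fun [set: Z] (fun z : Z => tnth z.1 i).
  by apply: (measurableT_comp (measurable_tnth i)); exact: measurable_fst.
by have := mt measurableT _ mI; rewrite setTI.
Qed.

Lemma measurable_box l u c d : measurable (box l u c d).
Proof.
have -> : box l u c d =
  (\bigcap_(i in [set: 'I_n]) [set z : Z | `]l i, u i[%classic (tnth z.1 i)]) `&`
  ([set: E] `*` `]c, d[%classic).
  apply/seteqP; split => z; rewrite /box/=.
    by move=> [h1 h2]; split => [i _ /=|]; rewrite ?in_itv/=.
  by move=> [h1 [_]]; rewrite /= in_itv/= => h2; split => // i; have := h1 i Logic.I; rewrite /= in_itv.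
apply: measurableI; last by apply: measurableX => //; exact: measurable_itv.
apply: fin_bigcap_measurable => // i _; apply: measurable_coord_itv; exact: measurable_itv.
Qed.

Lemma box_sqnorm_le l u c d : exists M, forall z : Z, box l u c d z -> sqnorm z.1 <= M.
Proof.
exists (\sum_(i < n) ((l i) ^+ 2 + (u i) ^+ 2)) => z [h _].
apply: ler_sum => i _; have /andP[h1 h2] := h i.
have [t0|t0] := leP 0 (tnth z.1 i : R).
  apply: (@le_trans _ _ ((u i) ^+ 2)); last by rewrite lerDr sqr_ge0.
  by rewrite ler_sqr ?nnegrE// ?ltW// (le_lt_trans t0).
apply: (@le_trans _ _ ((l i) ^+ 2)); last by rewrite lerDl sqr_ge0.
rewrite -[leLHS]sqrrN -[leRHS]sqrrN ler_sqr ?nnegrE ?oppr_ge0 ?ltW// ?ltrN2//.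
exact: lt_trans t0.
Qed.

Lemma coord_sqr_le (x y : E) i : ((tnth y i : R) - tnth x i) ^+ 2 <= sqnorm (vsub y x).
Proof.
rewrite /sqnorm (bigD1 i)//= tnth_mktuple lerDl.
by apply: sumr_ge0 => j _; rewrite sqr_ge0.
Qed.

Definition box_boundary (l u : 'I_n -> R) (c d : R) (w : Z) : Prop :=
  (exists i, (tnth w.1 i : R) = l i \/ (tnth w.1 i : R) = u i) \/ (w.2 : R) = c \/ (w.2 : R) = d.

Lemma box_locally_constant l u c d w : ~ box_boundary l u c d w ->
  exists2 dl : R, 0 < dl & forall z : Z, sqnorm (vsub z.1 w.1) < dl ^+ 2 ->
    `|(z.2 : R) - w.2| < dl -> (box l u c d z <-> box l u c d w).
Proof.
move=> nb.
(* The radius is 1/S, where S dominates the inverse distance from w to every face; hence 1/S is at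
   most each distance. The summand 1 keeps S positive. *)
pose D i := `|(tnth w.1 i : R) - l i|^-1 + `|(tnth w.1 i : R) - u i|^-1.
pose S := (\sum_(i < n) D i) + (`|(w.2 : R) - c|^-1 + `|(w.2 : R) - d|^-1) + 1.
have D0 i : 0 <= D i by rewrite addr_ge0// invr_ge0.
have S0 : 0 < S.
  by rewrite /S ltr_pwDr// !addr_ge0// ?invr_ge0//; exact: sumr_ge0.
have step (x b y : R) : x != b -> `|x - b|^-1 <= S -> `|y - x| < S^-1 ->
    ((y < b) = (x < b)) /\ ((b < y) = (b < x)).
  move=> xb le yx; have xb0 : 0 < `|x - b| by rewrite normr_gt0 subr_eq0.
  have : `|y - x| < `|x - b|.
    by apply: lt_le_trans yx _; rewrite -[leRHS]invrK lef_pV2 ?posrE ?invr_gt0.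
  have [xltb|bltx|xeqb] := ltgtP x b; last by rewrite xeqb eqxx in xb.
    rewrite (ltr0_norm (_ : x - b < 0)) ?subr_lt0// ltr_norml => /andP[h1 h2].
    have yb : y < b by lra.
    by rewrite yb (ltNge b) (ltW yb).
  rewrite (gtr0_norm (_ : 0 < x - b)) ?subr_gt0// ltr_norml => /andP[h1 h2].
  have yb : b < y by lra.
  by rewrite yb (ltNge y) (ltW yb).
exists S^-1; first by rewrite invr_gt0.
move=> z hz1 hz2.
have hD i : D i <= S.
  have : D i <= \sum_(i < n) D i by rewrite (bigD1 i)//= lerDl sumr_ge0.
  have : 0 <= `|(w.2 : R) - c|^-1 by rewrite invr_ge0.
  have : 0 <= `|(w.2 : R) - d|^-1 by rewrite invr_ge0.
  rewrite /S; lra.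
have hsum : 0 <= \sum_(i < n) D i by exact: sumr_ge0.
have hc : `|(w.2 : R) - c|^-1 <= S.
  by rewrite /S; have := invr_ge0 `|(w.2 : R) - d|; rewrite normr_ge0 => ?; lra.
have hd : `|(w.2 : R) - d|^-1 <= S.
  by rewrite /S; have := invr_ge0 `|(w.2 : R) - c|; rewrite normr_ge0 => ?; lra.
have wc : (w.2 : R) != c by apply/eqP => H; apply: nb; right; left.
have wd : (w.2 : R) != d by apply/eqP => H; apply: nb; right; right.
have [_ ec] := step _ _ _ wc hc hz2.
have [ed _] := step _ _ _ wd hd hz2.
have ei i : (l i < (tnth z.1 i : R) < u i) = (l i < (tnth w.1 i : R) < u i).
  have wl : (tnth w.1 i : R) != l i by apply/eqP => H; apply: nb; left; exists i; left.
  have wu : (tnth w.1 i : R) != u i by apply/eqP => H; apply: nb; left; exists i; right.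
  have zi : `|(tnth z.1 i : R) - tnth w.1 i| < S^-1.
    rewrite -ltr_sqr ?nnegrE ?invr_ge0 ?(ltW S0)// real_normK ?num_real//.
    by apply: le_lt_trans hz1; exact: coord_sqr_le.
  have hl : `|(tnth w.1 i : R) - l i|^-1 <= S.
    by apply: le_trans (hD i); rewrite lerDl invr_ge0.
  have hu : `|(tnth w.1 i : R) - u i|^-1 <= S.
    by apply: le_trans (hD i); rewrite lerDr invr_ge0.
  have [_ ->] := step _ _ _ wl hl zi.
  by have [-> _] := step _ _ _ wu hu zi.
rewrite /box/= ec ed.
by split=> -[h1 h2]; split=> // i; [rewrite -ei|rewrite ei].
Qed.

Lemma coord_slice0 (i : 'I_n) (c : R) : {ae V, forall w, (tnth w.1 i : R) != c}.
Proof.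
pose A (j : 'I_n) : set RR := if j == i then [set c] else setT.
have mA j : measurable (A j) by rewrite /A; case: ifP => // _; exact: measurable_set1.
pose B := [set v : E | forall j, A j (tnth v j)].
have mB : measurable B.
  have -> : B = \bigcap_(j in [set: 'I_n]) ((@tnth n RR ^~ j) @^-1` A j).
    by apply/seteqP; split => v /= h j; [move=> _; exact: h | exact: h].
  apply: fin_bigcap_measurable => // j _.
  by rewrite -[X in measurable X]setTI; exact: measurable_tnth.
exists (B `*` [set: RR]); split.
- exact: measurableX.
- transitivity ((@lebesgue_vec R n \x @lebesgue_measure R)%E (B `*` [set: RR])) => //.
  rewrite product_measure1E// [X in (X * _)%E](_ : _ = 0%E) ?mul0e//.
  transitivity (\prod_(j < n) @lebesgue_measure R (A j))%E; first exact: lebesgue_vec_box.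
  rewrite (bigD1 i)//= [X in (X * _)%E](_ : _ = 0%E) ?mul0e//.
  by rewrite /A eqxx; exact: lebesgue_measure_set1.
- move=> w /= /negP; rewrite negbK => /eqP wc; split => //= j.
  by rewrite /A; case: eqP => [->|].
Qed.

Lemma box_boundary_ae l u c d : {ae V, forall w, ~ box_boundary l u c d w}.
Proof.
have FF : Filter (nbhs (almost_everywhere V)) by typeclasses eauto.
have h1 : {ae V, forall w : Z, forall i : 'I_n, (tnth w.1 i : R) != l i /\ (tnth w.1 i : R) != u i}.
  apply: filter_forall => i.
  exact: (@filterI _ _ FF _ _ (coord_slice0 i (l i)) (coord_slice0 i (u i))).
have h2 := @filterI _ _ FF _ _ (spacetime_slice0 n c) (spacetime_slice0 n d).
apply: (@filterS _ _ FF _ _ _ (@filterI _ _ FF _ _ h1 h2)) => w [k1 [k2 k3]].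
move=> [[i [e|e]]|[e|e]].
- by have [+ _] := k1 i; rewrite e eqxx.
- by have [_ +] := k1 i; rewrite e eqxx.
- by move: k2; rewrite e eqxx.
- by move: k3; rewrite e eqxx.
Qed.

End boxes.

Section injectivity.
Context {R : realType} (n : nat) (alpha : R).
Hypothesis alpha0 : 0 < alpha.
Local Notation RR := (measurableTypeR R).
Local Notation mu := (@lebesgue_measure R).
Local Notation E := (euclid R n).
Local Notation Z := (spacetime R n).
Local Notation V := (@spacetime_measure R n).

Let G0 : 0 < (Gamma alpha)^-1.
Proof. by rewrite invr_gt0; have [] := integral_GammaE alpha0. Qed.

Let short (a : R) (t : R) : R := (t < a)%R%:R * ((Gamma alpha)^-1 * Kt alpha t).

Let short_ge0 a t : 0 <= short a t.
Proof. by rewrite mulr_ge0// mulr_ge0 ?Kt_ge0// ltW. Qed.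

Let mshort a d (T : measurableType d) (f : T -> R) : measurable_fun [set: T] f ->
  measurable_fun [set: T] (fun t => short a (f t)).
Proof. by move=> mf; rewrite /short; mfun. Qed.

Definition short_mass (a : R) : R := fine (\int[mu]_t (short a t)%:E).

Lemma short_massE a : 0 < a ->
  (\int[mu]_t (short a t)%:E = (short_mass a)%:E)%E /\ 0 < short_mass a.
Proof.
move=> a0.
have fin : (\int[mu]_t (short a t)%:E < +oo)%E.
  have -> : (\int[mu]_t (short a t)%:E = \int[mu]_t ((Gamma alpha)^-1 * ((t < a)%R%:R * Kt alpha t))%:E)%E.
    by apply: eq_integral => t _; rewrite /short mulrCA.
  rewrite ge0_integral_EFinMl ?(ltW G0)//.
  - by rewrite lte_mul_pinfty ?lee_fin ?(ltW G0)// (le_lt_trans (integral_Kt_le alpha0 a0))// ltry.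
  - by mfun.
  - by move=> t; rewrite mulr_ge0 ?Kt_ge0.
have pos : (0 < \int[mu]_t (short a t)%:E)%E.
  apply: (@ge0_integral_gt0 _ _ _ mu `]0, a[%classic) => //.
  - by apply/measurable_EFinP; apply: mshort.
  - by move=> t; rewrite lee_fin.
  - have : (0 < @lebesgue_measure R `]0%R, a[)%E.
      by rewrite lebesgue_measure_itv/= lte_fin a0 oppr0 adde0 lte_fin.
    by [].
  - move=> t /=; rewrite in_itv/= => /andP[t0 ta].
    by rewrite lte_fin /short ta mul1r mulr_gt0// Kt_gt0.
have fn : (\int[mu]_t (short a t)%:E)%E \is a fin_num by rewrite ge0_fin_numE// ltW.
by rewrite /short_mass fineK//; split => //; rewrite fine_gt0// pos fin.
Qed.

(** The mass does not depend on the dilation q: q = 1 is the truncated kernel, q = 2 the majorant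
    produced by [gauss_dilate]. *)
Let integral_short_gauss a q (w : Z) : 0 < a -> 0 < q ->
  (\int[V]_z (short a ((z.2 : R) - w.2) * gauss (vsub z.1 w.1) (q * ((z.2 : R) - w.2)))%:E
   = (short_mass a)%:E)%E.
Proof.
move=> a0 q0.
rewrite (integral_gauss_time (k := fun t => short a (t - w.2)) (s := fun t => q * (t - w.2)))//.
- rewrite (ge0_integral_shift (- w.2 : R) (F := fun t : RR => (short a t)%:E))//.
  + by have [-> _] := short_massE a0.
  + by apply/measurable_EFinP; apply: mshort.
  + by move=> t; rewrite lee_fin.
- by apply: mshort; mfun.
- by mfun.
- move=> t; have [h _|h] := ltP 0 (t - w.2); first by rewrite mulr_gt0.
  by rewrite /short Kt0// !mulr0 eqxx.
Qed.

Let kera a (z w : Z) : R := ((z.2 : R) - w.2 < a)%R%:R * ker alpha z w.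

Let keraE a z w : kera a z w = short a ((z.2 : R) - w.2) * gauss (vsub z.1 w.1) ((z.2 : R) - w.2).
Proof. by rewrite /kera kerE /short !mulrA. Qed.

Let kera_ge0 a z w : 0 <= kera a z w.
Proof. by rewrite mulr_ge0// ker_ge0. Qed.

Let D : R := 2 `^ (n%:R / 2).
Let D0 : 0 < D. Proof. by rewrite powR_gt0. Qed.

Let mkera a d (T : measurableType d) (f g : T -> Z) :
  measurable_fun [set: T] f -> measurable_fun [set: T] g ->
  measurable_fun [set: T] (fun t => kera a (f t) (g t)).
Proof. by move=> mf mg; rewrite /kera; mfun. Qed.

Section one_box.
Variables (l u : 'I_n -> R) (c d : R).
Let A := box l u c d.
Let mA : measurable A := measurable_box l u c d.

Let mIA d1 (T : measurableType d1) (f : T -> Z) : measurable_fun [set: T] f ->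
  measurable_fun [set: T] (fun t => \1_A (f t) : R).
Proof.
move=> mf; have m1 : measurable_fun [set: Z] (\1_A : Z -> R) by exact: measurable_indic.
exact: (measurableT_comp m1 mf).
Qed.

Let IA01 z : 0 <= (\1_A z : R) <= 1.
Proof. by rewrite indicE; case: (_ \in _); rewrite ?lexx ?ler01. Qed.

(** The adjoint of the truncated kernel applied to the indicator of the box: integrating the
    short-memory potential of h over the box amounts to testing h against it. *)
Let Psi a w := (\int[V]_z (\1_A z * kera a z w)%:E)%E.

Let Psi_ge0 a w : (0 <= Psi a w)%E.
Proof.
by apply: integral_ge0 => z _; rewrite lee_fin mulr_ge0//; have /andP[] := IA01 z.
Qed.

(** Dominates [Psi a], divided by its mass, uniformly in a <= 1 up to a constant: a memory below 1
    reaches back from ]c, d[ to c - 1 at most, and the spatial decay is that of [gauss_local_le]. *)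
Let weight (w : Z) : R := (c - 1 < (w.2 : R))%R%:R * ((w.2 : R) < d)%R%:R * expR (- sqnorm w.1 / 16).

Let Psi_dom : exists2 C : R, 0 <= C & forall a w, 0 < a -> a <= 1 ->
  (Psi a w <= (C * weight w * short_mass a)%:E)%E.
Proof.
have [M HM] := box_sqnorm_le l u c d.
exists (D * expR (M / 8)); first by rewrite mulr_ge0 ?expR_ge0// ltW.
move=> a w a0 a1.
have C0 : 0 <= D * expR (M / 8) * weight w.
  by rewrite mulr_ge0 ?mulr_ge0 ?expR_ge0 ?(ltW D0).
rewrite EFinM -(integral_short_gauss w a0 (ltr0n R 2)).
rewrite -ge0_integral_EFinMl//; last 2 first.
- by apply: measurable_funM; [apply: mshort|]; mfun.
- by move=> z; rewrite mulr_ge0 ?gauss_ge0.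
apply: ge0_le_integral => //.
- by move=> z _; rewrite lee_fin mulr_ge0//; have /andP[] := IA01 z.
- by apply/measurable_EFinP; apply: measurable_funM; [exact: mIA|apply: mkera; mfun].
- apply/measurable_EFinP; apply: measurable_funM => //; apply: measurable_funM; [apply: mshort|]; mfun.
move=> z _; rewrite lee_fin keraE.
have rhs0 : 0 <= D * expR (M / 8) * weight w * (short a ((z.2 : R) - w.2) * gauss (vsub z.1 w.1) (2 * ((z.2 : R) - w.2))).
  by rewrite mulr_ge0// mulr_ge0 ?gauss_ge0.
have [zA|zA] := pselect (A z); last by rewrite indicE memNset// mul0r.
rewrite indicE mem_set// mul1r.
have [r0|r0] := leP ((z.2 : R) - w.2) 0; first by apply: le_trans rhs0; rewrite /short Kt0// !mulr0 mul0r.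
have [ra|ra] := leP a ((z.2 : R) - w.2); first by apply: le_trans rhs0; rewrite /short ltNge ra !mul0r.
have [_ /andP[z1 z2]] := zA.
have -> : weight w = expR (- sqnorm w.1 / 16).
  rewrite /weight; have -> : c - 1 < (w.2 : R) by lra.
  have -> : (w.2 : R) < d by lra.
  by rewrite !mul1r.
have := @gauss_local_le _ _ w.1 z.1 ((z.2 : R) - w.2) M r0 (ltW (lt_le_trans ra a1)) (HM _ zA).
rewrite -/D => H.
have -> : D * expR (M / 8) * expR (- sqnorm w.1 / 16) * (short a ((z.2 : R) - w.2) * gauss (vsub z.1 w.1) (2 * ((z.2 : R) - w.2))) =
  short a ((z.2 : R) - w.2) * (D * expR (M / 8) * expR (- sqnorm w.1 / 16) * gauss (vsub z.1 w.1) (2 * ((z.2 : R) - w.2))) by ring.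
exact: ler_wpM2l.
Qed.

(** Chebyshev's inequality: within distance dl of w the indicator is constant, and beyond it the
    kernel is at most |z - w|^2/dl^2 times itself, which [gauss_second_moment_le] bounds by a
    multiple of a times a kernel of the same mass. *)
Let Psi_close w : ~ box_boundary l u c d w -> exists2 dl : R, 0 < dl &
  forall a, 0 < a -> a <= dl -> let e := 8 * D / dl ^+ 2 * a in
    (((\1_A w - e) * short_mass a)%:E <= Psi a w)%E /\
    (Psi a w <= ((\1_A w + e) * short_mass a)%:E)%E.
Proof.
move=> nb; have [dl dl0 H] := box_locally_constant nb.
exists dl => // a a0 adl e.
have dl20 : 0 < dl ^+ 2 by rewrite exprn_gt0.
have e0 : 0 <= e by rewrite mulr_ge0 ?(ltW a0)// divr_ge0 ?(ltW dl20)// mulr_ge0// ltW.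
have m0 : 0 <= short_mass a by have [_ /ltW] := short_massE a0.
pose g z := short a ((z.2 : R) - w.2) * gauss (vsub z.1 w.1) (2 * ((z.2 : R) - w.2)).
have g0 z : 0 <= g z by rewrite mulr_ge0 ?gauss_ge0.
have mg : measurable_fun [set: Z] g by apply: measurable_funM; [apply: mshort|]; mfun.
have mk : measurable_fun [set: Z] (fun z => kera a z w) by apply: mkera; mfun.
have mIk : measurable_fun [set: Z] (fun z => \1_A z * kera a z w).
  by apply: measurable_funM => //; exact: mIA.
have I0 z : 0 <= (\1_A z : R) by have /andP[] := IA01 z.
have I1 z : (\1_A z : R) <= 1 by have /andP[] := IA01 z.
have intk : (\int[V]_z (kera a z w)%:E = (short_mass a)%:E)%E.
  rewrite -(integral_short_gauss w a0 ltr01).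
  by apply: eq_integral => z _; rewrite keraE mul1r.
have intg : (\int[V]_z (e * g z)%:E = (e * short_mass a)%:E)%E.
  by rewrite ge0_integral_EFinMl// (integral_short_gauss w a0 (ltr0n R 2)).
have key z : (z \in A) != (w \in A) -> kera a z w <= e * g z.
  move=> zw; rewrite keraE.
  have eg0 : 0 <= e * g z by rewrite mulr_ge0.
  have [r0|r0] := leP ((z.2 : R) - w.2) 0.
    by apply: le_trans eg0; rewrite /short Kt0// !mulr0 mul0r.
  have [ra|ra] := leP a ((z.2 : R) - w.2).
    by apply: le_trans eg0; rewrite /short ltNge ra !mul0r.
  have far : dl ^+ 2 <= sqnorm (vsub z.1 w.1).
    rewrite leNgt; apply/negP => lt.
    have t : `|(z.2 : R) - w.2| < dl by rewrite gtr0_norm// (lt_le_trans ra).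
    have [h1 h2] := H z lt t.
    by move/eqP: zw; apply; apply/idP/idP; rewrite !inE.
  have -> : e * g z = short a ((z.2 : R) - w.2) * (e * gauss (vsub z.1 w.1) (2 * ((z.2 : R) - w.2))).
    by rewrite /g mulrCA.
  apply: ler_wpM2l => //.
  apply: (@le_trans _ _ (sqnorm (vsub z.1 w.1) / dl ^+ 2 * gauss (vsub z.1 w.1) ((z.2 : R) - w.2))).
    by rewrite ler_peMl ?gauss_ge0// ler_pdivlMr// mul1r.
  rewrite mulrAC ler_pdivrMr//; apply: le_trans (gauss_second_moment_le _ r0) _.
  rewrite -/D -[leRHS]mulrA [leRHS]mulrC -[leRHS]mulrA [leRHS]mulrC.
  have -> : dl ^+ 2 * e = 8 * D * a by rewrite /e; field; exact: lt0r_neq0.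
  apply: ler_wpM2r; first exact: gauss_ge0.
  have := ltW ra; have := ltW D0; nra.
have up : (Psi a w <= ((\1_A w + e) * short_mass a)%:E)%E.
  rewrite mulrDl EFinD -intg.
  have -> : ((\1_A w * short_mass a)%:E = \int[V]_z (\1_A w * kera a z w)%:E)%E.
    by rewrite ge0_integral_EFinMl// intk.
  rewrite -ge0_integralD//; last 4 first.
  - by move=> z _; rewrite lee_fin mulr_ge0.
  - by apply/measurable_EFinP; apply: measurable_funM.
  - by move=> z _; rewrite lee_fin mulr_ge0.
  - by apply/measurable_EFinP; apply: measurable_funM.
  apply: ge0_le_integral => //.
  - by move=> z _; rewrite lee_fin mulr_ge0.
  - exact/measurable_EFinP.
  - by apply: emeasurable_funD; apply/measurable_EFinP; apply: measurable_funM.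
  move=> z _; rewrite -EFinD lee_fin; have [zw|zw] := eqVneq (z \in A) (w \in A).
    by rewrite !indicE zw lerDl mulr_ge0.
  apply: (@le_trans _ _ (kera a z w)); first by rewrite ler_piMl.
  by apply: le_trans (key _ zw) _; rewrite lerDr mulr_ge0.
split => //.
have Pfin : Psi a w \is a fin_num.
  by rewrite ge0_fin_numE// (le_lt_trans up)// ltry.
rewrite mulrBl EFinB leeBlDr// -intg.
have -> : ((\1_A w * short_mass a)%:E = \int[V]_z (\1_A w * kera a z w)%:E)%E.
  by rewrite ge0_integral_EFinMl// intk.
rewrite /Psi -ge0_integralD//; last 4 first.
- by move=> z _; rewrite lee_fin mulr_ge0.
- exact/measurable_EFinP.
- by move=> z _; rewrite lee_fin mulr_ge0.
- by apply/measurable_EFinP; apply: measurable_funM.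
apply: ge0_le_integral => //.
- by move=> z _; rewrite lee_fin mulr_ge0.
- by apply/measurable_EFinP; apply: measurable_funM.
- by apply: emeasurable_funD; apply/measurable_EFinP => //; apply: measurable_funM.
move=> z _; rewrite -EFinD lee_fin; have [zw|zw] := eqVneq (z \in A) (w \in A).
  by rewrite !indicE zw lerDl mulr_ge0.
apply: (@le_trans _ _ (kera a z w)); first by rewrite ler_piMl.
by apply: le_trans (key _ zw) _; rewrite lerDr mulr_ge0.
Qed.

Variable h : Z -> R.
Hypothesis mh : measurable_fun [set: Z] h.
Hypothesis hshort : {ae V, forall z, forall a, 0 < a ->
  (\int[V]_w (((z.2 : R) - w.2 < a)%R%:R * (ker alpha z w * h w))%:E = 0)%E}.
Hypothesis hloc : forall c d : R, (\int[V]_w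
  ((c < (w.2 : R))%R%:R * ((w.2 : R) < d)%R%:R * expR (- sqnorm w.1 / 16) * `|h w|)%:E < +oo)%E.

Let mnh : measurable_fun [set: Z] (fun w => `|h w|) := measurable_norm_comp mh.
(* As a tends to 0 the truncated kernel [kera a] concentrates on the diagonal,
   so that [theta a] tends to the indicator of the box off its boundary. *)
Let theta a w : R := fine (Psi a w) / short_mass a.

Let mPsi a : measurable_fun [set: Z] (Psi a).
Proof.
apply: (measurable_spacetime_integral2 (F := fun u : Z * Z => (\1_A u.1 * kera a u.1 u.2)%:E)).
  apply/measurable_EFinP; apply: measurable_funM; first by apply: mIA; exact: measurable_fst.
  by apply: mkera; [exact: measurable_fst|exact: measurable_snd].
by move=> q; rewrite lee_fin mulr_ge0//; have /andP[] := IA01 q.1.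
Qed.

Let mtheta a : measurable_fun [set: Z] (theta a).
Proof.
apply: measurable_funM => //.
exact: (measurableT_comp (fine_measurable measurableT) (mPsi a)).
Qed.

Let theta_dom : exists2 C : R, 0 <= C & forall a w, 0 < a -> a <= 1 ->
  0 <= theta a w <= C * weight w /\ Psi a w = (theta a w * short_mass a)%:E.
Proof.
have [C C0 H] := Psi_dom; exists C => // a w a0 a1.
have [_ m0] := short_massE a0.
have Pfin : Psi a w \is a fin_num.
  by rewrite ge0_fin_numE// (le_lt_trans (H a w a0 a1))// ltry.
split; last by rewrite /theta divfK ?gt_eqF// fineK.
rewrite /theta; apply/andP; split.
  by apply: divr_ge0; [exact: fine_ge0|exact: ltW].
by rewrite (ler_pdivrMr _ _ m0) -lee_fin fineK// H.
Qed.

Let theta_cvg w : ~ box_boundary l u c d w ->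
  theta j.+1%:R^-1 w @[j --> \oo] --> (\1_A w : R).
Proof.
move=> nb; have [dl dl0 H] := Psi_close nb.
pose K := 8 * D / dl ^+ 2.
have ch : (fun j : nat => K * j.+1%:R^-1) @ \oo --> (0 : R).
  by rewrite -(mulr0 K); apply: cvgM; [exact: cvg_cst|exact: cvg_harmonic].
have c1 : (fun j : nat => \1_A w - K * j.+1%:R^-1) @ \oo --> (\1_A w : R).
  by rewrite -[X in _ --> X]subr0; apply: cvgB => //; exact: cvg_cst.
have c2 : (fun j : nat => \1_A w + K * j.+1%:R^-1) @ \oo --> (\1_A w : R).
  by rewrite -[X in _ --> X]addr0; apply: cvgD => //; exact: cvg_cst.
apply: (squeeze_cvgr _ c1 c2).
have : \forall j \near \oo, (j.+1%:R^-1 : R) <= dl.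
  have := @cvg_harmonic R => /cvgr0_norm_le /(_ _ dl0).
  by apply: filterS => j; rewrite /harmonic ger0_norm ?invr_ge0.
apply: filterS => j jdl.
have a0 : 0 < (j.+1%:R^-1 : R) by rewrite invr_gt0.
have [_ m0] := short_massE a0.
have [h1 h2] := H _ a0 jdl.
have Pfin : Psi j.+1%:R^-1 w \is a fin_num.
  by rewrite ge0_fin_numE// (le_lt_trans h2)// ltry.
by rewrite /theta ler_pdivlMr// ler_pdivrMr// -!lee_fin fineK// h1 h2.
Qed.

Let hweight : V.-integrable [set: Z] (fun w => (weight w * h w)%:E).
Proof.
apply/integrableP; split.
  by apply/measurable_EFinP; rewrite /weight; mfun.
have := hloc (c - 1) d; congr (_ < _)%E; apply: eq_integral => w _.
by rewrite abse_EFin normrM [`|weight w|]ger0_norm// !mulr_ge0 ?expR_ge0.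
Qed.

Let theta_int0 a : 0 < a -> a <= 1 -> (\int[V]_w (theta a w * h w)%:E = 0)%E.
Proof.
move=> a0 a1; have [C C0 H] := theta_dom; have [_ m0] := short_massE a0.
pose F (q : Z * Z) := \1_A q.1 * (kera a q.1 q.2 * h q.2).
have mh2 : measurable_fun [set: Z * Z] (fun q : Z * Z => h q.2) := measurableT_comp mh measurable_snd.
have mF : measurable_fun [set: Z * Z] (fun q => (F q)%:E).
  apply/measurable_EFinP; apply: measurable_funM; first by apply: mIA; exact: measurable_fst.
  by apply: measurable_funM => //; apply: mkera; [exact: measurable_fst|exact: measurable_snd].
have mIk w : measurable_fun [set: Z] (fun z => \1_A z * kera a z w).
  by apply: measurable_funM; [exact: mIA|apply: mkera; mfun].
have Ik0 w z : 0 <= \1_A z * kera a z w.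
  by rewrite mulr_ge0//; have /andP[] := IA01 z.
have Foo : (\int[V]_z \int[V]_w `|(F (z, w))%:E| < +oo)%E.
  rewrite (spacetime_tonelli2 (F := fun q => `|(F q)%:E|%E))//; last exact: measurableT_comp.
  have /integrableP[_] := integrableZl measurableT (C * short_mass a) hweight.
  apply: le_lt_trans; apply: ge0_le_integral => //.
  - by move=> w _; exact: integral_ge0.
  - apply: (measurable_spacetime_integral2 (F := fun q => `|(F q)%:E|%E)) => //.
    exact: measurableT_comp.
  - by apply: measurableT_comp => //; apply/measurable_EFinP; rewrite /weight; mfun.
  - move=> w _.
    have -> : (\int[V]_z `|(F (z, w))%:E| = \int[V]_z ((\1_A z * kera a z w) * `|h w|)%:E)%E.
      by apply: eq_integral => z _; rewrite /F/= mulrA normrM ger0_norm.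
    rewrite ge0_integral_EFinMr//.
    have [/andP[t0 t1] PE] := H a w a0 a1.
    rewrite -/(Psi a w) PE -EFinM abse_EFin lee_fin normrM [`|C * _|]ger0_norm ?mulr_ge0 ?(ltW m0)//.
    rewrite normrM [`|weight w|]ger0_norm ?mulr_ge0 ?expR_ge0//.
    have := ler_wpM2r (mulr_ge0 (normr_ge0 (h w)) (ltW m0)) t1.
    by congr (_ <= _); ring.
have := spacetime_fubini2 mF Foo.
have -> : (\int[V]_z \int[V]_w (F (z, w))%:E = 0)%E.
  apply: etrans (integral0 V [set: Z]).
  apply: ae_eq_integral => //.
    exact: (measurable_spacetime_fubini (F := fun q => (F q)%:E)).
  have FF : Filter (nbhs (almost_everywhere V)) by typeclasses eauto.
  apply: (@filterS _ _ FF _ _ _ hshort) => z hz _.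
  transitivity (\int[V]_w (\1_A z * (kera a z w * h w))%:E)%E => //.
  rewrite indicE; case: (z \in A); last by apply: integral0_eq => w _; rewrite mul0r.
  rewrite -[RHS](hz a a0); apply: eq_integral => w _; congr EFin.
  by rewrite mul1r /kera mulrA.
move=> /esym.
have -> : (\int[V]_w \int[V]_z (F (z, w))%:E = \int[V]_w ((short_mass a)%:E * (theta a w * h w)%:E))%E.
  apply: eq_integral => w _.
  transitivity (\int[V]_z (\1_A z * kera a z w)%:E * (h w)%:E)%E.
    rewrite -integralZr//; last first.
      apply/integrableP; split; first exact/measurable_EFinP.
      under eq_integral do rewrite gee0_abs ?lee_fin//.
      by have [_ PE] := H a w a0 a1; rewrite -/(Psi a w) PE ltry.
    by apply: eq_integral => z _; rewrite /F -EFinM mulrA.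
  by have [_ PE] := H a w a0 a1; rewrite -/(Psi a w) PE -!EFinM; congr EFin; ring.
rewrite integralZl//.
  by move=> /eqP; rewrite mule_eq0 eqe (gt_eqF m0)/= => /eqP.
apply: (@le_integrable _ _ _ V _ measurableT _ (fun w => C%:E * (weight w * h w)%:E)%E).
- by apply/measurable_EFinP; apply: measurable_funM.
- move=> w _; have [/andP[t0 t1] _] := H a w a0 a1.
  rewrite -EFinM !abse_EFin lee_fin mulrA !normrM; apply: ler_wpM2r => //.
  by rewrite -normrM !ger0_norm// (le_trans t0).
- exact: integrableZl.
Qed.

Lemma box_integral0 : (\int[V]_w (\1_A w * h w)%:E = 0)%E.
Proof.
have [C C0 H] := theta_dom.
pose f_ j w := (theta j.+1%:R^-1 w * h w)%:E.
have mf_ j : measurable_fun [set: Z] (f_ j).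
  by apply/measurable_EFinP; apply: measurable_funM.
have mf : measurable_fun [set: Z] (fun w => (\1_A w * h w)%:E).
  by apply/measurable_EFinP; apply: measurable_funM => //; exact: mIA.
have FF : Filter (nbhs (almost_everywhere V)) by typeclasses eauto.
have cv : {ae V, forall w, [set: Z] w -> f_ ^~ w @ \oo --> (\1_A w * h w)%:E}.
  apply: (@filterS _ _ FF _ _ _ (box_boundary_ae l u c d)) => w nb _.
  apply: cvg_EFin; first exact: nearW.
  by apply: cvgM; [exact: theta_cvg|exact: cvg_cst].
have j1 j : (j.+1%:R^-1 : R) <= 1 by rewrite invf_le1 ?ltr0n// ler1n.
have j0 j : 0 < (j.+1%:R^-1 : R) by rewrite invr_gt0.
have [] := @dominated_convergence _ _ _ V _ measurableT f_ (fun w => (\1_A w * h w)%:E)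
  (fun w => `|C%:E * (weight w * h w)%:E|%E) mf_ mf cv.
- by apply: integrable_abse; exact: integrableZl.
- apply: nearW => w j _; have [/andP[t0 t1] _] := H _ w (j0 j) (j1 j).
  rewrite /f_ -EFinM !abse_EFin lee_fin mulrA !normrM; apply: ler_wpM2r => //.
  by rewrite -normrM !ger0_norm// (le_trans t0).
move=> _ _ L; rewrite -(cvg_lim _ L)//.
under [X in limn X]eq_fun do rewrite /f_ theta_int0//.
exact: lim_cst.
Qed.

End one_box.
End injectivity.

(** * Injectivity of J *)

Section box_generation.
Context {R : realType} (n : nat).
Local Notation RR := (measurableTypeR R).
Local Notation Z := (spacetime R n).
Local Notation V := (@spacetime_measure R n).

Definition boxes : set (set Z) := [set A | exists l u c d, A = box l u c d].

Lemma box_setI l u c d l' u' c' d' : box l u c d `&` box l' u' c' d' =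
  @box R n (fun i => Num.max (l i) (l' i)) (fun i => Num.min (u i) (u' i))
    (Num.max c c') (Num.min d d').
Proof.
apply/seteqP; split => z; rewrite /box/= !gt_max !lt_min.
  move=> [[h /andP[-> ->]] [h' /andP[-> ->]]]; split => // i; rewrite gt_max lt_min.
  by have /andP[-> ->] := h i; have /andP[-> ->] := h' i.
move=> [h /andP[/andP[-> ->] /andP[-> ->]]]; split; split => // i;
by have := h i; rewrite gt_max lt_min => /andP[/andP[h1 h2] /andP[h3 h4]]; apply/andP.
Qed.

Lemma boxes_setI_closed : setI_closed boxes.
Proof.
move=> _ _ [l [u [c [d ->]]]] [l' [u' [c' [d' ->]]]]; rewrite box_setI.
by do 4 eexists.
Qed.

Lemma bounded_coordinates (z : Z) : exists k : nat,
  (forall j, `|(tnth z.1 j : R)| < k%:R) /\ `|(z.2 : R)| < k%:R.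
Proof.
pose M := \sum_(j < n) `|(tnth z.1 j : R)| + `|(z.2 : R)|.
have M0 : 0 <= M by rewrite addr_ge0// sumr_ge0.
exists (Num.truncn M).+1.
have MN : M < (Num.truncn M).+1%:R by have /andP[] := Num.Theory.truncn_itv M0.
split=> [j|]; apply: le_lt_trans MN; last by rewrite lerDr sumr_ge0.
by rewrite /M (bigD1 j)//= -addrA lerDl addr_ge0// sumr_ge0.
Qed.

Lemma coord_halfspace_boxes (i : 'I_n) (x : R) :
  [set z : Z | x < (tnth z.1 i : R)] =
  \bigcup_k box (fun j => if j == i then x else - k%:R) (fun=> k%:R) (- k%:R) k%:R.
Proof.
apply/seteqP; split => z /=; last first.
  by move=> [k _ [/(_ i)]]; rewrite eqxx => /andP[].
move=> xz; have [k [zk tk]] := bounded_coordinates z; exists k => //.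
split; last by rewrite -ltr_norml.
move=> j; have := zk j; rewrite ltr_norml => /andP[h1 ->].
by rewrite andbT; case: eqP => [->|_].
Qed.

Lemma time_halfspace_boxes (x : R) :
  [set z : Z | x < (z.2 : R)] =
  \bigcup_k box (fun j => - k%:R) (fun=> k%:R) x k%:R.
Proof.
apply/seteqP; split => z /=; last by move=> [k _ [_ /andP[]]].
move=> xz; have [k [zk tk]] := bounded_coordinates z; exists k => //.
split; first by move=> j; rewrite -ltr_norml.
by rewrite xz/=; move: tk; rewrite ltr_norml => /andP[].
Qed.

Lemma bigcup_boxes : \bigcup_k @box R n (fun=> - k%:R) (fun=> k%:R) (- k%:R) k%:R = setT.
Proof.
apply/seteqP; split => // z _; have [k [zk tk]] := bounded_coordinates z.
by exists k => //; split; [move=> j|]; rewrite -ltr_norml.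
Qed.

Lemma measurable_boxesE : @measurable _ Z = <<s boxes >>.
Proof.
apply/seteqP; split; last first.
  apply: smallest_sub; first exact: sigma_algebra_measurable.
  by move=> _ [l [u [c [d ->]]]]; exact: measurable_box.
pose T := g_sigma_algebraType boxes.
have mb (k : nat) l u c d : @measurable _ T (box l u c d).
  by apply: sub_sigma_algebra; exists l, u, c, d.
(* Measurability of the identity from the sigma-algebra of boxes to the Borel one is the missing
   inclusion; it is checked on half-lines in each coordinate, whose preimages are countable unions
   of boxes. *)
have mid : @measurable_fun _ _ T Z setT (fun z : Z => z).
  apply/measurable_fun_pairP; split; last first.
    apply: (measurability _ (RGenOInfty.measurableE R)) => _ [_ [x ->] <-].
    rewrite setTI.
    have -> : (snd \o (fun z : Z => z)) @^-1` `]x, +oo[%classic = [set z : Z | x < (z.2 : R)].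
      by apply/seteqP; split => z /=; rewrite in_itv/= andbT.
    by rewrite time_halfspace_boxes; apply: bigcup_measurable => k _; exact: mb.
  apply/measurable_fun_tnthP => i.
  apply: (measurability _ (RGenOInfty.measurableE R)) => _ [_ [x ->] <-].
  rewrite setTI.
  have -> : ((@tnth n RR)^~ i \o (fst \o (fun z : Z => z))) @^-1` `]x, +oo[%classic = [set z : Z | x < (tnth z.1 i : R)].
    by apply/seteqP; split => z /=; rewrite in_itv/= andbT.
  by rewrite coord_halfspace_boxes; apply: bigcup_measurable => k _; exact: mb.
by move=> A mA; have := mid measurableT A mA; rewrite setTI.
Qed.

(** A Dynkin class argument. Since h is integrable only on boxes, it is first cut off to one of
    countably many boxes covering space-time; the integrals of the cut-off function then vanish on
    all boxes, hence on all measurable sets. *)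
Lemma ae_eq0_box_integrals (h : Z -> R) : measurable_fun [set: Z] h ->
  (forall l u c d, V.-integrable [set: Z] (fun w => (\1_(box l u c d) w * h w)%:E)) ->
  (forall l u c d, (\int[V]_w (\1_(box l u c d) w * h w)%:E = 0)%E) ->
  {ae V, forall w, h w = 0}.
Proof.
move=> mh ih h0.
have FF : Filter (nbhs (almost_everywhere V)) by typeclasses eauto.
pose B (k : nat) := @box R n (fun=> - k%:R) (fun=> k%:R) (- k%:R) k%:R.
suff : {ae V, forall w, forall k, \1_(B k) w * h w = 0}.
  apply: (@filterS _ _ FF) => w hw.
  have : [set: Z] w by []; rewrite -bigcup_boxes => -[k _ Bk].
  by have := hw k; rewrite indicE mem_set// mul1r.
apply: ae_foralln => k; pose g w := (\1_(B k) w * h w)%:E.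
have ig : V.-integrable [set: Z] g by exact: ih.
have mg : measurable_fun [set: Z] g by case/integrableP: ig.
have gT : (\int[V]_(w in [set: Z]) g w = 0)%E by exact: h0.
have gS : forall S, <<s boxes >> S -> (\int[V]_(w in S) g w = 0)%E.
  apply: (dynkin_induction measurable_boxesE boxes_setI_closed) => //.
  - move=> _ [l [u [c [d ->]]]]; rewrite integral_mkcond.
    rewrite -[RHS](h0 (fun i => Num.max (l i) (- k%:R)) (fun i => Num.min (u i) k%:R) (Num.max c (- k%:R)) (Num.min d k%:R)).
    rewrite -box_setI -/(B k); apply: eq_integral => w _.
    rewrite patchE /g !indicE in_setI; case: (w \in box l u c d) => //=.
    by rewrite mul0r.
  - move=> S mS S0; have mC : measurable (~` S) by exact: measurableC.
    have := integral_setU V mS mC (f := g).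
    rewrite setUv gT S0 add0e => /(_ mg) H; symmetry; apply: H.
    by apply/disj_setPS; rewrite setICr.
  - move=> F mF tF F0; rewrite integral_bigcup//.
      by apply: eseries0 => j _ _; exact: F0.
    by apply: integrableS ig => //; exact: bigcup_measurable.
have := @integral_ae_eq _ _ _ V [set: Z] measurableT (cst 0%E) g ig (@measurable_cst _ _ _ _ _ _).
have H E : E `<=` [set: Z] -> measurable E -> (\int[V]_(x in E) g x = \int[V]_(x in E) 0)%E.
  by move=> _ mE; rewrite integral0; apply: gS; rewrite -measurable_boxesE.
move=> /(_ H); apply: (@filterS _ _ FF) => w /(_ Logic.I) [].
by [].
Qed.

End box_generation.

Lemma integral_ind_oo {R : realType} (c d : R) :
  (\int[@lebesgue_measure R]_t ((c < t)%R%:R * (t < d)%R%:R : R)%:E =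
   (if (c < d)%R then d - c else 0)%:E)%E.
Proof.
transitivity (\int[@lebesgue_measure R]_(t in `]c, d[) 1)%E.
  rewrite [RHS]integral_mkcond; apply: eq_integral => t _; rewrite patchE.
  case: ifPn; first by rewrite inE/= in_itv/= => /andP[-> ->]; rewrite mul1r.
  rewrite notin_setE/= in_itv/= => /negP.
  by case: (c < t); case: (t < d) => //=; rewrite ?mul0r ?mulr0.
rewrite integral_cst//= mul1e lebesgue_measure_itv/= lte_fin.
by case: ifP => //; rewrite EFinB.
Qed.

Section J_injective.
Context {R : realType} (n : nat) (alpha p : R).
Hypothesis alpha_p : [/\ 1 < p, 0 < alpha & alpha < (n%:R + 2) / (2 * p)] \/
               [/\ p = 1, 0 < alpha & alpha <= (n%:R + 2) / 2].
Local Notation RR := (measurableTypeR R).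
Local Notation mu := (@lebesgue_measure R).
Local Notation E := (euclid R n).
Local Notation Z := (spacetime R n).
Local Notation V := (@spacetime_measure R n).

Definition origin : E := [tuple (0 : R) | i < n].

Lemma vsub_origin (x : E) : vsub x origin = x.
Proof. by apply: eq_from_tnth => i; rewrite !tnth_mktuple subr0. Qed.

Lemma integral_slab_gauss (k : RR -> R) (r : R) : 0 < r ->
  measurable_fun [set: RR] k -> (forall t, 0 <= k t) ->
  (\int[V]_w (k w.2 * gauss w.1 r)%:E = \int[mu]_t (k t)%:E)%E.
Proof.
move=> r0 mk k0; apply: etrans (integral_gauss_time (s := fun=> r) origin mk _ k0 (fun _ _ => r0)).
  by apply: eq_integral => w _; rewrite vsub_origin.
exact: measurable_cst.
Qed.

(** By |f| <= 1 + |f|^p: the weight is integrable, its spatial factor being a multiple K of the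
    Gaussian at time 4, and it is at most the indicator of t < d. *)
Lemma Xspace_weighted_lty (f : Z -> R) : Xspace p f -> forall c d : R, (\int[V]_w
  ((c < (w.2 : R))%R%:R * ((w.2 : R) < d)%R%:R * expR (- sqnorm w.1 / 16) * `|f w|)%:E < +oo)%E.
Proof.
have [a0 p1 _] := admissible_exponent alpha_p.
move=> /(XspaceP _ (lt_le_trans ltr01 p1))[mf fp] c d.
have mnf := measurable_norm_comp mf.
pose K := (4 * pi * 4) `^ (n%:R / 2) : R.
have K0 : 0 < K by rewrite powR_gt0// !mulr_gt0 ?pi_gt0.
pose W (w : Z) : R := (c < (w.2 : R))%R%:R * ((w.2 : R) < d)%R%:R * gauss w.1 4.
have W0 w : 0 <= W w by rewrite mulr_ge0 ?gauss_ge0.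
have mW : measurable_fun [set: Z] W by rewrite /W; mfun.
have WE w : (c < (w.2 : R))%R%:R * ((w.2 : R) < d)%R%:R * expR (- sqnorm w.1 / 16) = K * W w.
  rewrite /W /gauss mulrCA [K * _]mulrA divff ?gt_eqF// mul1r; congr (_ * expR (_ / _)).
  by rewrite -natrM.
have IW : (\int[V]_w (K * W w)%:E < +oo)%E.
  rewrite ge0_integral_EFinMl ?(ltW K0)//.
  rewrite (integral_slab_gauss (k := fun t => (c < t)%R%:R * (t < d)%R%:R))//; last by mfun.
  rewrite lte_mul_pinfty ?lee_fin ?(ltW K0)//.
  by rewrite integral_ind_oo ltry.
have mT : measurable_fun [set: Z] (fun w : Z => ((w.2 : R) < d)%R%:R * `|f w| `^ p).
  by mfun.
have T0 w : 0 <= ((w.2 : R) < d)%R%:R * `|f w| `^ p by rewrite mulr_ge0 ?powR_ge0.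
apply: (@le_lt_trans _ _ (\int[V]_w (K * W w)%:E + \int[V]_w (((w.2 : R) < d)%R%:R * `|f w| `^ p)%:E)%E); last first.
  by apply: lte_add_pinfty => //; exact: fp.
rewrite -ge0_integralD//; last 3 first.
- by move=> w _; rewrite lee_fin mulr_ge0 ?(ltW K0).
- by mfun.
- exact/measurable_EFinP.
apply: ge0_le_integral => //.
- by mfun.
- by apply: emeasurable_funD; mfun.
move=> w _; rewrite -EFinD lee_fin -WE.
set e := expR _; have e0 : 0 <= e by exact: expR_ge0.
have e1 : e <= 1.
  by rewrite -expR0 ler_expR mulNr oppr_le0 divr_ge0 ?sqnorm_ge0.
have a1 := powR_split_le p1 (normr_ge0 (f w)) ltr01.
rewrite powR1 mulr1 in a1.
have P0 : 0 <= `|f w| `^ p by exact: powR_ge0.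
set A : R := (c < _)%R%:R; set D : R := (_ < d)%R%:R.
have A0 : 0 <= A by exact: ler0n.
have D0 : 0 <= D by exact: ler0n.
have A1 : A <= 1 by rewrite /A; case: (c < _).
apply: (@le_trans _ _ (A * D * e * (1 + `|f w| `^ p))).
  by apply: ler_wpM2l => //; rewrite !mulr_ge0.
rewrite mulrDr mulr1 lerD2l; have -> : A * D * e * `|f w| `^ p = (A * e) * (D * `|f w| `^ p) by ring.
by rewrite ler_piMl ?mulr_ge0// mulr_ile1.
Qed.

Lemma J_inj_ae (f g : Z -> R) : Xspace p f -> Xspace p g ->
  J alpha f = J alpha g %[ae V] -> f = g %[ae V].
Proof.
move=> Xf Xg Jfg; have [a0 p1 _] := admissible_exponent alpha_p.
have p0 := lt_le_trans ltr01 p1.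
have FF : Filter (nbhs (almost_everywhere V)) by typeclasses eauto.
have /(XspaceP _ p0)[mf _] := Xf; have /(XspaceP _ p0)[mg _] := Xg.
have mnf := measurable_norm_comp mf; have mng := measurable_norm_comp mg.
pose h w := f w - g w.
have mh : measurable_fun [set: Z] h by rewrite /h; mfun.
have mnh := measurable_norm_comp mh.
have dom (k : Z -> R) : measurable_fun [set: Z] k -> (forall w, 0 <= k w) ->
    (\int[V]_w (k w * `|f w|)%:E < +oo)%E -> (\int[V]_w (k w * `|g w|)%:E < +oo)%E ->
    (\int[V]_w (k w * `|h w|)%:E < +oo)%E.
  move=> mk k0 If Ig.
  apply: (@le_lt_trans _ _ (\int[V]_w (k w * `|f w|)%:E + \int[V]_w (k w * `|g w|)%:E)%E); last first.
    exact: lte_add_pinfty.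
  rewrite -ge0_integralD//; last 4 first.
  - by move=> w _; rewrite lee_fin mulr_ge0.
  - by mfun.
  - by move=> w _; rewrite lee_fin mulr_ge0.
  - by mfun.
  apply: ge0_le_integral => //.
  - by move=> w _; rewrite lee_fin mulr_ge0.
  - by mfun.
  - by apply: emeasurable_funD; mfun.
  by move=> w _; rewrite -EFinD lee_fin -mulrDr ler_wpM2l// ler_normB.
have If := ker_abs_lty alpha_p Xf; have Ig := ker_abs_lty alpha_p Xg.
have habs : {ae V, forall z, (\int[V]_w (ker alpha z w * `|h w|)%:E < +oo)%E}.
  apply: (@filterS2 _ _ FF _ _ _ _ If Ig) => z; apply: dom; first by mfun.
  by move=> w; exact: ker_ge0.
have hJ : {ae V, forall z, J alpha h z = 0}.
  apply: (@filterS3 _ _ FF _ _ _ _ _ If Ig Jfg) => z Ifz Igz /(_ Logic.I).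
  have kf := ker_integrable a0 mf Ifz; have kg := ker_integrable a0 mg Igz.
  rewrite !JE => e.
  transitivity (fine (\int[V]_w ((ker alpha z w * f w)%:E - (ker alpha z w * g w)%:E))%E).
    by congr fine; apply: eq_integral => w _; rewrite /h mulrBr.
  rewrite integralB// fineB ?integrable_fin_num//.
  by rewrite e subrr.
have hloc (c d : R) : (\int[V]_w
    ((c < (w.2 : R))%R%:R * ((w.2 : R) < d)%R%:R * expR (- sqnorm w.1 / 16) * `|h w|)%:E < +oo)%E.
  apply: dom; first by mfun.
  - by move=> w; rewrite mulr_ge0 ?expR_ge0.
  - exact: Xspace_weighted_lty.
  - exact: Xspace_weighted_lty.
have hs := ker_short_memory_ae a0 mh habs hJ.
have h0 : {ae V, forall w, h w = 0}.
  apply: ae_eq0_box_integrals => // l u c d; last exact: (box_integral0 a0 l u c d mh hs hloc).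
  have [M HM] := box_sqnorm_le l u c d.
  have mI : measurable_fun [set: Z] (\1_(box l u c d) : Z -> R).
    by apply: measurable_indic; exact: measurable_box.
  apply/integrableP; split.
    by apply/measurable_EFinP; apply: measurable_funM.
  have := hloc c d => /(lte_mul_pinfty (x := (expR (M / 16))%:E)) H.
  have {H} := H _ _ => /(_ (expR_ge0 _)) /(_ isT).
  pose k (w : Z) : R := (c < (w.2 : R))%R%:R * ((w.2 : R) < d)%R%:R * expR (- sqnorm w.1 / 16) * `|h w|.
  have k0 w : 0 <= k w by rewrite mulr_ge0// mulr_ge0 ?expR_ge0.
  have mk : measurable_fun [set: Z] k by rewrite /k; mfun.
  rewrite -(ge0_integral_EFinMl _ (expR_ge0 (M / 16)) mk k0).
  apply: le_lt_trans; apply: ge0_le_integral => //.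
  - by apply: measurableT_comp => //; apply/measurable_EFinP; apply: measurable_funM.
  - by mfun.
  move=> w _; rewrite abse_EFin lee_fin indicE.
  have [wB|wB] := pselect (box l u c d w); last first.
    by rewrite memNset// mul0r normr0 mulr_ge0 ?expR_ge0.
  rewrite mem_set// mul1r /k; have [_ /andP[-> ->]] := wB.
  rewrite !mul1r mulrA -expRD ler_peMl// -[X in X <= _]expR0 ler_expR.
  by have := HM w wB; lra.
by apply: (@filterS _ _ FF _ _ _ h0) => w e _; apply/eqP; rewrite -subr_eq0; apply/eqP.
Qed.

(** [frac_heat] selects an arbitrary source of u; by injectivity the selection agrees with f almost
    everywhere. *)
Lemma frac_heat_ae (f u : Z -> R) : Xspace p f -> u = J alpha f %[ae V] ->
  frac_heat p alpha u = f %[ae V].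
Proof.
move=> Xf uJ; have FF : Filter (nbhs (almost_everywhere V)) by typeclasses eauto.
have [Xg uG] : [set f | Xspace p f /\ u = J alpha f %[ae V]] (frac_heat p alpha u).
  by apply: xgetPex; exists f.
apply: J_inj_ae => //.
by apply: (@filterS2 _ _ FF _ _ _ _ uG uJ) => z h1 h2 _; rewrite -h1// h2.
Qed.

End J_injective.

(** * Existence *)

Section existence.
Context {R : realType} (n : nat) (lambda alpha p : R).
Hypothesis lambda0 : 0 < lambda.
Hypothesis alpha_p : [/\ 1 < p, 0 < alpha & alpha < (n%:R + 2) / (2 * p)] \/
               [/\ p = 1, 0 < alpha & alpha <= (n%:R + 2) / 2].
Local Notation RR := (measurableTypeR R).
Local Notation mu := (@lebesgue_measure R).
Local Notation E := (euclid R n).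
Local Notation Z := (spacetime R n).
Local Notation V := (@spacetime_measure R n).

Lemma gauss_gt0 (x : E) (r : R) : 0 < r -> 0 < gauss x r.
Proof.
by move=> r0; rewrite /gauss mulr_gt0 ?expR_gt0// invr_gt0 powR_gt0// !mulr_gt0 ?pi_gt0.
Qed.

Lemma gauss_le_powR (x : E) (r : R) : 0 < r -> gauss x r <= r `^ (- (n%:R / 2)).
Proof.
move=> r0; rewrite /gauss -[leRHS]mulr1.
apply: ler_pM; rewrite ?invr_ge0 ?powR_ge0 ?expR_ge0//.
  rewrite powRN lef_pV2 ?posrE ?powR_gt0// ?mulr_gt0 ?pi_gt0//.
  apply: ge0_ler_powR; rewrite ?nnegrE ?divr_ge0 ?mulr_ge0 ?pi_ge0 ?(ltW r0)//.
  by rewrite ler_peMl ?(ltW r0)//; have := pi_ge2 R; lra.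
by rewrite -expR0 ler_expR mulNr oppr_le0 divr_ge0 ?sqnorm_ge0// mulr_ge0 ?(ltW r0).
Qed.

Lemma time_pos_not_null : ~ {ae V, forall w, (w.2 : R) <= 0}.
Proof.
move=> H; have FF : Filter (nbhs (almost_everywhere V)) by typeclasses eauto.
have mk : measurable_fun [set: RR] (fun t : RR => (0 < t)%R%:R * (t < 1)%R%:R : R) by mfun.
have := integral_slab_gauss n ltr01 mk (fun t => mulr_ge0 (ler0n _ _) (ler0n _ _)).
rewrite (_ : (\int[V]_w _)%E = 0%E); last first.
  apply: etrans (integral0 V [set: Z]); apply: ae_eq_integral => //.
    by mfun.
  by apply: (@filterS _ _ FF _ _ _ H) => w w0 _; rewrite ltNge w0/= !mul0r.
move=> /esym H0; have : (0 < \int[mu]_t ((0 < t)%R%:R * (t < 1)%R%:R : R)%:E)%E.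
  apply: (@ge0_integral_gt0 _ _ _ mu `]0%R, 1%R[%classic) => //.
  - by apply/measurable_EFinP.
  - exact: lebesgue_measure_itv01_gt0.
  - by move=> t /=; rewrite in_itv/= => /andP[-> ->]; rewrite mul1r lte_fin.
by rewrite H0 ltxx.
Qed.

Lemma Xspace0 : Xspace p (cst 0 : Z -> R).
Proof.
have [a0 p1 _] := admissible_exponent alpha_p; have p0 := lt_le_trans ltr01 p1.
apply/(XspaceP _ p0); split => [|T]; first exact: measurable_cst.
rewrite integral0_eq// => w _.
by rewrite /cst normr0 powR0 ?gt_eqF// mulr0.
Qed.

(** * Supersolutions from a source with Gaussian profile in space *)

Section gauss_source.
Variables g i : R -> R.
Hypothesis mg : measurable_fun [set: RR] (g : RR -> R).
Hypothesis g_gt0 : forall t, 0 < t -> 0 < g t.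
Hypothesis g_bounded : forall T, exists M, forall t, 0 < t -> t < T -> g t <= M.
Hypothesis g_conv_le : forall t, 0 < t ->
  (\int[mu]_s (Kt alpha (t - s) * ((0 < s)%R%:R * g s))%:E <= (Gamma alpha * i t)%:E)%E.
Hypothesis g_super : forall (x : E) t, 0 < t ->
  (i t * gauss x (t + 1)) `^ lambda <= g t * gauss x (t + 1).

Let a0 : 0 < alpha. Proof. by have [] := admissible_exponent alpha_p. Qed.
Let p1 : 1 <= p. Proof. by have [] := admissible_exponent alpha_p. Qed.
Let G0 : 0 < Gamma alpha. Proof. by have [] := integral_GammaE a0. Qed.
(** The shift of time by 1 keeps the Gaussian bounded down to t = 0. *)
Let f (w : Z) : R := (0 < (w.2 : R))%R%:R * g w.2 * gauss w.1 ((w.2 : R) + 1).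

Let mg2 : measurable_fun [set: Z] (fun w : Z => g w.2).
Proof. exact: (measurableT_comp mg measurable_snd). Qed.

Let mf : measurable_fun [set: Z] f.
Proof. by rewrite /f; mfun. Qed.

Let f_ge0 w : 0 <= f w.
Proof.
rewrite /f; have [t0|t0] := ltP 0 (w.2 : R); last by rewrite !mul0r.
by rewrite mul1r mulr_ge0 ?gauss_ge0// ltW// g_gt0.
Qed.

Let Xf : Xspace p f.
Proof.
have p0 := lt_le_trans ltr01 p1.
apply/(XspaceP _ p0); split => // T; have [M HM] := g_bounded T.
pose N := Num.max M 0; have N0 : 0 <= N by rewrite le_max lexx orbT.
pose k (t : RR) : R := (0 < t)%R%:R * (t < T)%R%:R.
have mk : measurable_fun [set: RR] k by rewrite /k; mfun.
have mk2 : measurable_fun [set: Z] (fun w : Z => k w.2) := measurableT_comp mk measurable_snd.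
have k0 t : 0 <= k t by rewrite mulr_ge0.
apply: (@le_lt_trans _ _ (\int[V]_w (N `^ p * (k w.2 * gauss w.1 ((w.2 : R) + 1)))%:E)%E).
  have mnf := measurable_norm_comp mf.
  apply: ge0_le_integral => //.
  - by mfun.
  - by mfun.
  move=> w _; rewrite lee_fin ger0_norm// /f /k.
  have [t0|t0] := ltP 0 (w.2 : R); last by rewrite !mul0r powR0 ?gt_eqF// !mulr0.
  have [tT|tT] := ltP (w.2 : R) T; last by rewrite !(mul0r, mulr0).
  rewrite !mul1r powRM ?gauss_ge0 ?(ltW (g_gt0 t0))//.
  have t1 : 0 < (w.2 : R) + 1 by rewrite addr_gt0.
  apply: ler_pM; rewrite ?powR_ge0//.
    apply: ge0_ler_powR; rewrite ?nnegrE ?(ltW p0) ?(ltW (g_gt0 t0))//.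
    by rewrite le_max HM.
  (* At times above 1 the Gaussian is at most 1, so its p-th power is at most itself and has slice
     integral at most 1. *)
  have gam1 : gauss w.1 ((w.2 : R) + 1) <= 1.
    apply: le_trans (gauss_le_powR _ t1) _.
    rewrite -[leRHS](@powRr0 _ ((w.2 : R) + 1)); apply: ler_powR.
      by rewrite lerDr ltW.
    by rewrite oppr_le0 divr_ge0.
  rewrite -[leRHS]powRr1 ?gauss_ge0//; apply: ger_powR => //.
  by rewrite gauss_gt0.
rewrite ge0_integral_EFinMl ?powR_ge0//; last 2 first.
- by mfun.
- by move=> w; rewrite mulr_ge0 ?gauss_ge0.
rewrite lte_mul_pinfty ?lee_fin ?powR_ge0//.
have -> : (\int[V]_w (k w.2 * gauss w.1 ((w.2 : R) + 1))%:E = \int[mu]_t (k t)%:E)%E.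
  rewrite -(integral_gauss_time (s := fun t => (t : R) + 1) (origin n) mk _ k0).
  - by apply: eq_integral => w _; rewrite vsub_origin.
  - by mfun.
  - move=> t; rewrite /k; have [t0 _|] := ltP 0 (t : R); last by rewrite mul0r eqxx.
    by rewrite addr_gt0.
by rewrite /k integral_ind_oo ltry.
Qed.

(** By the semigroup law the Gaussian of the source at time t, transported to time z.2, is
    [gauss z.1 (z.2 + 1)] whatever t. What remains is the one-dimensional convolution bounded by
    [g_conv_le]. *)
Let ker_f_le z : 0 < (z.2 : R) ->
  (\int[V]_w (ker alpha z w * f w)%:E <= (i z.2 * gauss z.1 ((z.2 : R) + 1))%:E)%E.
Proof.
move=> z0; pose k (t : RR) : R := Kt alpha ((z.2 : R) - t) * ((0 < t)%R%:R * g t).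
have k0 t : 0 <= k t.
  rewrite mulr_ge0 ?Kt_ge0//; have [t0|t0] := ltP 0 (t : R); last by rewrite mul0r.
  by rewrite mul1r ltW// g_gt0.
have mk : measurable_fun [set: RR] k by rewrite /k; mfun.
have mk2 : measurable_fun [set: Z] (fun w : Z => k w.2) := measurableT_comp mk measurable_snd.
have kt t : k t != 0 -> 0 < t < (z.2 : R).
  rewrite /k; have [t0|t0] := ltP 0 (t : R); last by rewrite mul0r mulr0 eqxx.
  by rewrite -subr_gt0; have [//|s0] := ltP 0 ((z.2 : R) - t); rewrite Kt0// mul0r eqxx.
have -> : (\int[V]_w (ker alpha z w * f w)%:E = \int[V]_w ((Gamma alpha)^-1 *
    (k w.2 * (gauss (vsub z.1 w.1) ((z.2 : R) - w.2) * gauss (vsub w.1 (origin n)) ((w.2 : R) + 1))))%:E)%E.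
  by apply: eq_integral => w _; rewrite kerE /f /k vsub_origin; congr EFin; ring.
rewrite ge0_integral_EFinMl ?invr_ge0 ?(ltW G0)//; last 2 first.
- by mfun.
- by move=> w; apply: mulr_ge0 => //; rewrite mulr_ge0 ?gauss_ge0.
rewrite (integral_gauss_conv_time (k := k) (r := fun t => (z.2 : R) - t) (s := fun t => (t : R) + 1))//; last 4 first.
- by mfun.
- by mfun.
- by move=> t /kt /andP[_ ?]; rewrite subr_gt0.
- by move=> t /kt /andP[t0 _]; rewrite addr_gt0.
have -> : (\int[mu]_t (k t * gauss (vsub z.1 (origin n)) ((z.2 : R) - t + (t + 1)))%:E =
    \int[mu]_t (gauss z.1 ((z.2 : R) + 1) * k t)%:E)%E.
  apply: eq_integral => t _; rewrite vsub_origin mulrC; congr (_ * _)%:E; congr gauss; ring.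
rewrite ge0_integral_EFinMl ?gauss_ge0//.
have -> : (i z.2 * gauss z.1 ((z.2 : R) + 1))%:E =
   ((Gamma alpha)^-1%:E * ((gauss z.1 ((z.2 : R) + 1))%:E * (Gamma alpha * i z.2)%:E))%E.
  by rewrite -!EFinM; congr EFin; field; rewrite gt_eqF.
apply: lee_wpmul2l; first by rewrite lee_fin invr_ge0 ltW.
by apply: lee_wpmul2l; [rewrite lee_fin gauss_ge0|exact: g_conv_le].
Qed.

Let ker_f_ge0 z : (0 <= \int[V]_w (ker alpha z w * f w)%:E)%E.
Proof. by apply: integral_ge0 => w _; rewrite lee_fin mulr_ge0// ker_ge0. Qed.

Let J_f_nonpos z : (z.2 : R) <= 0 -> J alpha f z = 0.
Proof.
move=> z0; rewrite JE integral0_eq// => w _; have [wz|wz] := leP (z.2 : R) w.2.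
  by rewrite ker0// mul0r.
by rewrite /f ltNge (ltW (lt_le_trans wz z0)) !mul0r mulr0.
Qed.

Lemma gauss_supersolution : exists u : Z -> R,
  nonneg_solution p alpha lambda u /\ ~ (u = cst 0 %[ae V]).
Proof.
have FF : Filter (nbhs (almost_everywhere V)) by typeclasses eauto.
exists (J alpha f); split; last first.
  (* If J f were trivial, f would vanish almost everywhere by injectivity, whereas it is positive
     for t > 0. *)
  move=> H; apply: time_pos_not_null.
  have : f = cst 0 %[ae V].
    apply: (J_inj_ae alpha_p Xf Xspace0).
    apply: (@filterS _ _ FF _ _ _ H) => z h _; rewrite h// [RHS]JE integral0_eq// => w _.
    by rewrite mulr0.
  apply: (@filterS _ _ FF) => z /(_ Logic.I) h; rewrite leNgt; apply/negP => z0.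
  move: h; rewrite /f z0 mul1r => /eqP; apply/negP.
  by rewrite mulf_neq0 ?gt_eqF ?g_gt0 ?gauss_gt0// addr_gt0.
have e : J alpha f = J alpha f %[ae V] by apply: nearW.
split.
- exists f; [exact: Xf|exact: e].
- by apply: nearW => z; rewrite JE fine_ge0.
- have := frac_heat_ae alpha_p Xf e; apply: (@filterS _ _ FF) => z /(_ Logic.I) ->.
  have [z0|z0] := ltP 0 (z.2 : R); last by rewrite J_f_nonpos// powR0 ?gt_eqF.
  have H := ker_f_le z0.
  have Jfin : (\int[V]_w (ker alpha z w * f w)%:E)%E \is a fin_num.
    by rewrite ge0_fin_numE// (le_lt_trans H)// ltry.
  apply: (@le_trans _ _ ((i z.2 * gauss z.1 ((z.2 : R) + 1)) `^ lambda)); last first.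
    by rewrite /f z0 mul1r; exact: g_super.
  have J0 : 0 <= J alpha f z by rewrite JE fine_ge0.
  have Jle : J alpha f z <= i z.2 * gauss z.1 ((z.2 : R) + 1) by rewrite JE -lee_fin fineK.
  by apply: ge0_ler_powR; rewrite ?nnegrE ?(ltW lambda0)// (le_trans J0).
- by apply: nearW => z z0; rewrite J_f_nonpos// ltW.
Qed.

End gauss_source.

(** Convolving the kernel with e^s over all past times gives exactly Gamma(alpha) e^t; dropping the
    times s <= 0 only decreases the result. *)
Lemma existence_linear : lambda = 1 -> exists u : Z -> R,
  nonneg_solution p alpha lambda u /\ ~ (u = cst 0 %[ae V]).
Proof.
move=> l1; have [a0 p1 _] := admissible_exponent alpha_p.
have [GE G0] := integral_GammaE a0.
apply: (gauss_supersolution (g := expR) (i := expR)).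
- exact: measurable_expR.
- by move=> t _; exact: expR_gt0.
- by move=> T; exists (expR T) => t _ tT; rewrite ler_expR ltW.
- move=> t t0; rewrite mulrC EFinM -GE.
  rewrite -(ge0_integral_reflect t (F := fun s : RR => (Kt alpha s * expR (- s))%:E)); last 2 first.
  + by mfun.
  + by move=> s; rewrite lee_fin mulr_ge0 ?Kt_ge0 ?expR_ge0.
  rewrite -ge0_integral_EFinMl ?expR_ge0//; last 2 first.
  + by mfun.
  + by move=> s; rewrite mulr_ge0 ?Kt_ge0 ?expR_ge0.
  apply: ge0_le_integral => //.
  + by move=> s _; rewrite lee_fin mulr_ge0 ?Kt_ge0// mulr_ge0 ?expR_ge0.
  + by mfun.
  + by mfun.
  move=> s _; rewrite lee_fin [leRHS]mulrCA; apply: ler_wpM2l; first exact: Kt_ge0.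
  rewrite -expRD opprB addrCA subrr addr0.
  by case: (0 < s); rewrite ?mul1r// mul0r expR_ge0.
- by move=> x t t0; rewrite l1 powRr1// mulr_ge0 ?expR_ge0 ?gauss_ge0.
Qed.

Lemma existence_superlinear : 1 < lambda -> alpha < (n%:R + 2) / 2 * (1 - lambda^-1) ->
  exists u : Z -> R, nonneg_solution p alpha lambda u /\ ~ (u = cst 0 %[ae V]).
Proof.
move=> l1 al; have [a0 p1 _] := admissible_exponent alpha_p.
have [_ G0] := integral_GammaE a0.
have l10 : 0 < lambda - 1 by rewrite subr_gt0.
(* The source [ep (t + 1)^(- b) gauss x (t + 1)] has potential of order
   [(t + 1)^(alpha - b) gauss x (t + 1)]; the choice of [b] makes the
   inequality homogeneous up to the bound [gauss x r <= r^(- n / 2)]. *)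
pose b := Num.max 0 (lambda * alpha / (lambda - 1) - n%:R / 2).
have b0 : 0 <= b by rewrite le_max lexx.
(* The condition on alpha enters here; b < 1 is what makes [Beta alpha (1 - b)] finite. *)
have b1 : b < 1.
  rewrite gt_max ltr01/= ltrBlDr ltr_pdivrMr//.
  have -> : (1 + n%:R / 2) * (lambda - 1) = lambda * ((n%:R + 2) / 2 * (1 - lambda^-1)).
    by field; rewrite gt_eqF.
  by rewrite ltr_pM2l.
have bE : lambda * alpha - n%:R / 2 * (lambda - 1) <= b * (lambda - 1).
  have : lambda * alpha / (lambda - 1) - n%:R / 2 <= b by rewrite le_max lexx orbT.
  move=> /(ler_wpM2r (ltW l10)); rewrite mulrBl divfK ?gt_eqF//.
have b10 : 0 < 1 - b by rewrite subr_gt0.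
have [_ B0] := integral_BetaE a0 b10.
pose C := Beta alpha (1 - b) / Gamma alpha.
have C0 : 0 < C by rewrite divr_gt0.
(* Solution of (ep C)^lambda = ep, which makes the constants on both sides of the inequality
   agree. *)
pose ep := C `^ (- (lambda / (lambda - 1))).
have ep0 : 0 < ep by rewrite powR_gt0.
have epE : ep `^ lambda * C `^ lambda = ep.
  rewrite /ep -powRrM -powRD; last by rewrite (gt_eqF C0) implybT.
  by congr (_ `^ _); field; rewrite gt_eqF.
apply: (gauss_supersolution (g := fun t => ep * (t + 1) `^ (- b)) (i := fun t => ep * (C * (t + 1) `^ (alpha - b)))).
- by mfun.
- by move=> t t0; rewrite mulr_gt0// powR_gt0// addr_gt0.
- move=> T; exists ep => t t0 _; rewrite -[leRHS]mulr1 ler_wpM2l ?(ltW ep0)//.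
  rewrite -[leRHS](@powRr0 _ (t + 1)); apply: ler_powR; first by rewrite lerDr ltW.
  by rewrite oppr_le0.
- move=> t t0.
  (* Enlarging the range of integration from s > 0 to s > -1 turns the convolution into a Beta
     integral between -1 and t. *)
  have -> : (Gamma alpha * (ep * (C * (t + 1) `^ (alpha - b))))%:E =
      (ep%:E * (Beta alpha (1 - b) * Kt (alpha + (1 - b)) (t - (- 1)))%:E)%E.
    rewrite opprK KtE ?addr_gt0// -EFinM /C.
    have -> : alpha + (1 - b) - 1 = alpha - b by ring.
    by congr EFin; field; rewrite gt_eqF.
  rewrite -integral_Kt_conv// -ge0_integral_EFinMl ?(ltW ep0)//; last 2 first.
  + by mfun.
  + by move=> s; rewrite mulr_ge0 ?Kt_ge0.
  have Hs (s : R) : (0 < s)%R%:R * (ep * (s + 1) `^ (- b)) <= ep * Kt (1 - b) (s - (- 1)).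
    have [s0|s0] := ltP 0 s; last by rewrite mul0r mulr_ge0 ?Kt_ge0 ?(ltW ep0).
    rewrite mul1r opprK KtE ?addr_gt0//.
    by have -> : 1 - b - 1 = - b by ring.
  apply: ge0_le_integral => //.
  + by move=> s _; rewrite lee_fin mulr_ge0 ?Kt_ge0// mulr_ge0// mulr_ge0 ?powR_ge0 ?(ltW ep0).
  + by mfun.
  + by mfun.
  by move=> s _; rewrite lee_fin [leRHS]mulrCA; apply: ler_wpM2l; [exact: Kt_ge0|exact: Hs].
- move=> x t t0; have t1 : 0 < t + 1 by rewrite addr_gt0.
  have t1' : 1 <= t + 1 by rewrite lerDr ltW.
  set y := t + 1 in t1 t1' *; have ga0 := gauss_gt0 x t1; have gle := gauss_le_powR x t1.
  set ga := gauss x y in ga0 gle *; clearbody ga; clearbody ep; clearbody C.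
  have -> : (ep * (C * y `^ (alpha - b)) * ga) `^ lambda =
      ep * (y `^ (lambda * (alpha - b)) * ga `^ (lambda - 1)) * ga.
    rewrite !powRM ?mulr_ge0 ?powR_ge0 ?(ltW ep0) ?(ltW C0) ?(ltW ga0)//.
    rewrite -powRrM [_ * lambda]mulrC mulrA epE -[ga `^ lambda](@mulr_powRB1 _ ga lambda) ?(ltW ga0)//.
    by ring.
  apply: ler_wpM2r; first exact: ltW.
  apply: ler_wpM2l; first exact: ltW.
  apply: (@le_trans _ _ (y `^ (lambda * (alpha - b)) * y `^ (- (n%:R / 2) * (lambda - 1)))).
    apply: ler_wpM2l; first exact: powR_ge0.
    rewrite powRrM; apply: ge0_ler_powR; rewrite ?nnegrE ?powR_ge0 ?(ltW l10) ?(ltW ga0)//.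
  rewrite -powRD; last by rewrite (gt_eqF t1) implybT.
  by apply: ler_powR => //; lra.
Qed.

End existence.

(** * Nonexistence *)

Section supersolution.
Context {R : realType} (n : nat) (lambda alpha p : R).
Hypothesis lambda0 : 0 < lambda.
Hypothesis alpha_p : [/\ 1 < p, 0 < alpha & alpha < (n%:R + 2) / (2 * p)] \/
               [/\ p = 1, 0 < alpha & alpha <= (n%:R + 2) / 2].
Local Notation RR := (measurableTypeR R).
Local Notation mu := (@lebesgue_measure R).
Local Notation E := (euclid R n).
Local Notation Z := (spacetime R n).
Local Notation V := (@spacetime_measure R n).

Let a0 : 0 < alpha. Proof. by have [] := admissible_exponent alpha_p. Qed.
Let p1 : 1 <= p. Proof. by have [] := admissible_exponent alpha_p. Qed.
Let p0 : 0 < p. Proof. exact: lt_le_trans p1. Qed.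
Let G0 : 0 < Gamma alpha. Proof. by have [] := integral_GammaE a0. Qed.
Let Gi0 : 0 < (Gamma alpha)^-1. Proof. by rewrite invr_gt0. Qed.
Let FF : Filter (nbhs (almost_everywhere V)). Proof. by typeclasses eauto. Qed.

Lemma powR_near1_ge (e q : R) : 2^-1 <= q <= 2 -> 2 `^ (- `|e|) <= q `^ e.
Proof.
move=> /andP[q1 q2]; have q0 : 0 < q by apply: lt_le_trans q1.
rewrite /powR !gt_eqF// ler_expR mulNr lerNl.
apply: le_trans (ler_norm _) _; rewrite normrN normrM; apply: ler_wpM2l => //.
rewrite ler_norml; apply/andP; split; last by rewrite ler_ln ?posrE.
by rewrite -lnV ?posrE// ler_ln ?posrE// invr_gt0.
Qed.

Lemma sqnorm_vsub_le (x y : E) : sqnorm (vsub x y) <= 2 * sqnorm x + 2 * sqnorm y.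
Proof.
rewrite /sqnorm !mulr_sumr -big_split/=; apply: ler_sum => i _.
rewrite tnth_mktuple -subr_ge0.
have -> : 2 * tnth x i ^+ 2 + 2 * tnth y i ^+ 2 - (tnth x i - tnth y i) ^+ 2 =
  (tnth x i + tnth y i) ^+ 2 :> R by ring.
exact: sqr_ge0.
Qed.

Lemma expR_sqnormE (B : R) (x : E) : 0 < B ->
  expR (- (B * sqnorm x)) = (pi / B) `^ (n%:R / 2) * gauss x (4 * B)^-1.
Proof.
move=> B0; rewrite /gauss.
have -> : 4 * pi * (4 * B)^-1 = pi / B :> R by field; rewrite gt_eqF.
have -> : - sqnorm x / (4 * (4 * B)^-1) = - (B * sqnorm x) :> R by field; rewrite gt_eqF.
by rewrite mulrA divff ?mul1r// gt_eqF// powR_gt0// divr_gt0// pi_gt0.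
Qed.

Let e : R := alpha - 1 - n%:R / 2.

(** At late times t the elapsed time r lies between t/2 and 2 t, so its power is comparable to that
    of t. From |x - y|^2 <= 2 |x|^2 + 2 M and 4 r >= 2 t the Gaussian exponent is at most |x|^2/t +
    M/t. *)
Lemma ker_lower (M r0 : R) (z w : Z) : 1 <= r0 -> 0 <= M -> sqnorm w.1 <= M ->
  `|w.2 : R| <= r0 -> 2 * r0 <= (z.2 : R) ->
  (Gamma alpha)^-1 * ((4 * pi) `^ (n%:R / 2))^-1 * 2 `^ (- `|e|) * expR (- M) *
    ((z.2 : R) `^ e * expR (- sqnorm z.1 / z.2)) <= ker alpha z w.
Proof.
move=> r01 M0 wM; rewrite ler_norml => /andP[w1 w2] z2.
set r : R := (z.2 : R) - w.2; have t0 : 0 < (z.2 : R) by lra.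
have r0' : 0 < r by rewrite /r; lra.
have q : 2^-1 <= r / z.2 <= 2.
  by rewrite ler_pdivlMr// ler_pdivrMr//; apply/andP; split; rewrite /r; lra.
have P0 : 0 < (4 * pi) `^ (n%:R / 2) :> R by rewrite powR_gt0// mulr_gt0 ?pi_gt0.
have Pn : (4 * pi) `^ (n%:R / 2) != 0 :> R by rewrite gt_eqF.
have r_pow : r `^ (alpha - 1) * ((4 * pi * r) `^ (n%:R / 2))^-1 = ((4 * pi) `^ (n%:R / 2))^-1 * r `^ e.
  rewrite (@powRM _ (4 * pi)) ?mulr_ge0 ?pi_ge0 ?(ltW r0')// invfM /e.
  rewrite (@powRD _ r (alpha - 1) (- (n%:R / 2))) ?(gt_eqF r0') ?implybT// powRN.
  by ring.
have e_pow : r `^ e = (z.2 : R) `^ e * (r / z.2) `^ e.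
  by rewrite -powRM ?(ltW t0) ?divr_ge0 ?(ltW r0') ?(ltW t0)// mulrC divfK ?gt_eqF.
rewrite kerE -/r KtE// /gauss.
have -> : (Gamma alpha)^-1 * r `^ (alpha - 1) * (((4 * pi * r) `^ (n%:R / 2))^-1 * expR (- sqnorm (vsub z.1 w.1) / (4 * r))) =
  (Gamma alpha)^-1 * ((4 * pi) `^ (n%:R / 2))^-1 * ((z.2 : R) `^ e * ((r / z.2) `^ e * expR (- sqnorm (vsub z.1 w.1) / (4 * r)))).
  rewrite [(z.2 : R) `^ e * _]mulrA -e_pow.
  transitivity ((Gamma alpha)^-1 * (r `^ (alpha - 1) * ((4 * pi * r) `^ (n%:R / 2))^-1) * expR (- sqnorm (vsub z.1 w.1) / (4 * r))); first by ring.
  by rewrite r_pow; ring.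
have -> : (Gamma alpha)^-1 * ((4 * pi) `^ (n%:R / 2))^-1 * 2 `^ (- `|e|) * expR (- M) * ((z.2 : R) `^ e * expR (- sqnorm z.1 / z.2)) =
  (Gamma alpha)^-1 * ((4 * pi) `^ (n%:R / 2))^-1 * ((z.2 : R) `^ e * (2 `^ (- `|e|) * (expR (- M) * expR (- sqnorm z.1 / z.2)))) by ring.
apply: ler_wpM2l; first by rewrite mulr_ge0 ?invr_ge0 ?(ltW G0) ?(ltW P0).
apply: ler_wpM2l; first exact: powR_ge0.
apply: ler_pM; rewrite ?powR_ge0 ?mulr_ge0 ?expR_ge0//; first exact: powR_near1_ge.
rewrite -expRD ler_expR !mulNr -opprD lerN2.
apply: (@le_trans _ _ ((2 * sqnorm z.1 + 2 * M) / (2 * z.2))).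
  apply: ler_pM; rewrite ?sqnorm_ge0 ?invr_ge0 ?mulr_ge0 ?(ltW r0')//.
    by apply: le_trans (sqnorm_vsub_le _ _) _; rewrite lerD2l ler_wpM2l.
  by rewrite lef_pV2 ?posrE ?mulr_gt0// /r; lra.
have -> : (2 * sqnorm z.1 + 2 * M) / (2 * z.2) = sqnorm z.1 / z.2 + M / z.2 :> R.
  by field; rewrite gt_eqF.
by rewrite addrC lerD2r ler_piMr// invf_le1//; lra.
Qed.

Variable F : Z -> R.
Hypothesis XF : Xspace p F.
Hypothesis F0 : forall w, 0 <= F w.
Hypothesis F_nontrivial : ~ {ae V, forall w, F w = 0}.
Let Kf z := (\int[V]_w (ker alpha z w * F w)%:E)%E.
(** Phrased through real lower bounds b of the extended-valued potential, so that such a bound can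
    be used without knowing that the potential is finite. *)
Hypothesis F_super : {ae V, forall z, forall b, 0 <= b -> (b%:E <= Kf z)%E -> b `^ lambda <= F z}.

Let mF : measurable_fun [set: Z] F. Proof. by have /(XspaceP _ p0)[] := XF. Qed.

Let Fp_lty T : (\int[V]_w (((w.2 : R) < T)%R%:R * F w `^ p)%:E < +oo)%E.
Proof.
have /(XspaceP _ p0)[_ /(_ T)] := XF; apply: le_lt_trans.
rewrite le_eqVlt; apply/orP; left; apply/eqP.
by apply: eq_integral => w _; rewrite ger0_norm.
Qed.

(** Otherwise F would vanish almost everywhere on each of countably many boxes covering
    space-time. *)
Lemma box_integral_gt0 : exists k : nat,
  (0 < \int[V]_w (\1_(@box R n (fun=> - k%:R) (fun=> k%:R) (- k%:R) k%:R) w * F w)%:E)%E.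
Proof.
apply: contrapT => H; apply: F_nontrivial.
pose B (k : nat) := @box R n (fun=> - k%:R) (fun=> k%:R) (- k%:R) k%:R.
have mB k : measurable_fun [set: Z] (\1_(B k) : Z -> R).
  by apply: measurable_indic; exact: measurable_box.
have BF0 k w : 0 <= \1_(B k) w * F w by rewrite mulr_ge0// indicE.
have HB : {ae V, forall w, forall k, (\1_(B k) w * F w)%:E = 0%E}.
  apply: ae_foralln => k.
  have mk : measurable_fun [set: Z] (fun w => (\1_(B k) w * F w)%:E).
    by apply/measurable_EFinP; apply: measurable_funM.
  have [+ _] := ae_eq_integral_abs V measurableT mk.
  have -> : (\int[V]_w `|(\1_(B k) w * F w)%:E| = 0)%E.
    under eq_integral do rewrite gee0_abs ?lee_fin//.
    apply/eqP; rewrite eq_le; apply/andP; split.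
      by rewrite leNgt; apply/negP => h; apply: H; exists k.
    by apply: integral_ge0 => w _; rewrite lee_fin.
  by move=> /(_ erefl); apply: (@filterS _ _ FF) => w /(_ Logic.I).
apply: (@filterS _ _ FF _ _ _ HB) => w hw.
have : [set: Z] w by []; rewrite -bigcup_boxes => -[k _ Bk].
by have [] := hw k; rewrite indicE mem_set// mul1r.
Qed.

Lemma potential_lower : exists m r0, [/\ 0 < m, 1 <= r0 &
  forall z : Z, 2 * r0 <= (z.2 : R) ->
    ((m * ((z.2 : R) `^ e * expR (- sqnorm z.1 / z.2)))%:E <= Kf z)%E].
Proof.
have [k] := box_integral_gt0; set B := box _ _ _ _ => IB.
have mB : measurable_fun [set: Z] (\1_B : Z -> R).
  by apply: measurable_indic; exact: measurable_box.
have B0 w : 0 <= (\1_B w : R) by rewrite indicE.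
(* The mass on the box is taken here as an extended real; any positive real number below it
   suffices. *)
have [m0 m00 Hm0] : exists2 m0 : R, 0 < m0 & (m0%:E <= \int[V]_w (\1_B w * F w)%:E)%E.
  move: IB; case: (integral _ _ _) => [y||]//; last by exists 1 => //; rewrite leey.
  by rewrite lte_fin => y0; exists y.
have [M HM] := @box_sqnorm_le R n (fun=> - k%:R) (fun=> k%:R) (- k%:R : R) k%:R.
pose M' := Num.max M 0; have M'0 : 0 <= M' by rewrite le_max lexx orbT.
pose c := (Gamma alpha)^-1 * ((4 * pi) `^ (n%:R / 2))^-1 * 2 `^ (- `|e|) * expR (- M').
have c0 : 0 < c.
  rewrite /c !mulr_gt0 ?expR_gt0 ?powR_gt0// invr_gt0 powR_gt0// mulr_gt0 ?pi_gt0//.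
exists (c * m0), (Num.max 1 k%:R); split; first exact: mulr_gt0.
  by rewrite le_max lexx.
move=> z z2; set y := (_ `^ e * _).
have y0 : 0 <= y by rewrite mulr_ge0 ?powR_ge0 ?expR_ge0.
have cy0 : 0 <= c * y by rewrite mulr_ge0// ltW.
apply: (@le_trans _ _ (\int[V]_w (c * y * (\1_B w * F w))%:E)%E).
  rewrite ge0_integral_EFinMl//; last 2 first.
  - exact: measurable_funM.
  - by move=> w; rewrite mulr_ge0.
  have -> : c * m0 * y = c * y * m0 by ring.
  by rewrite EFinM; apply: lee_wpmul2l => //; rewrite lee_fin.
have mk : measurable_fun [set: Z] (fun w => ker alpha z w * F w) by mfun.
apply: ge0_le_integral => //.
- by move=> w _; rewrite lee_fin mulr_ge0// mulr_ge0.
- apply/measurable_EFinP; apply: measurable_funM => //; exact: measurable_funM.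
- exact/measurable_EFinP.
move=> w _; rewrite lee_fin mulrA; apply: ler_wpM2r => //.
have [wB|wB] := pselect (B w); last by rewrite indicE memNset// mulr0 ker_ge0.
rewrite indicE mem_set// mulr1; apply: ker_lower z2 => //.
- by rewrite le_max lexx.
- by rewrite le_max HM.
- by have [_ /andP[w1 w2]] := wB; rewrite le_max; apply/orP; right; rewrite ler_norml !ltW.
Qed.

(** * Nonexistence for lambda < 1 *)

Section sublinear.
Hypothesis lambda1 : lambda < 1.

Let b : R := alpha / (1 - lambda).
Let l10 : 0 < 1 - lambda. Proof. by rewrite subr_gt0. Qed.
Let b0 : 0 < b. Proof. by rewrite divr_gt0. Qed.
Let bE : alpha + lambda * b = b.
Proof. by rewrite /b; field; rewrite gt_eqF. Qed.
Let lb0 : 0 < lambda * b + 1. Proof. by rewrite addr_gt0// mulr_gt0. Qed.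

Variables (r0 : R).
Hypothesis r01 : 1 <= r0.
Let r00 : 0 < r0. Proof. exact: lt_le_trans r01. Qed.
Let t0 : R := 2 * r0.

(* Since [alpha + lambda * b = b], the lower bound with parameters (c, a)
   reproduces itself with the flatter Gaussian of parameter [lambda * a]. *)
Let bounded_below (c a : R) := forall z : Z, 0 < (z.2 : R) - t0 < r0 ->
  ((c * expR (- (a * sqnorm z.1)) * ((z.2 : R) - t0) `^ b)%:E <= Kf z)%E.

(** The factor acquired in one iteration. It does not decrease when a gets smaller, so it stays at
    least its initial value and the constant c survives all iterations. *)
Let D (a : R) : R := ((4 * (lambda * a) * r0 + 1) `^ (n%:R / 2))^-1 *
  ((Gamma alpha)^-1 * Beta alpha (lambda * b + 1)).

Let D_gt0 a : 0 <= a -> 0 < D a.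
Proof.
move=> ha; have [_ B0] := integral_BetaE a0 lb0.
rewrite /D !mulr_gt0// invr_gt0 powR_gt0// ltr_wpDl// !mulr_ge0// ltW//.
Qed.

Let bounded_below_step c a : 0 < c -> 0 < a -> bounded_below c a ->
  bounded_below (c `^ lambda * D a) (lambda * a).
Proof.
move=> c0 ha H z /andP[z1 z2].
set B := lambda * a; have B0 : 0 < B by rewrite mulr_gt0.
(* Raised to the power lambda, the Gaussian with parameter a becomes exp(- B |x|^2), a multiple of
   the heat kernel at time r1, to which the semigroup law applies. *)
pose r1 := (4 * B)^-1; have r10 : 0 < r1 by rewrite invr_gt0 mulr_gt0.
pose k (t : RR) : R := Kt alpha ((z.2 : R) - t) * Kt (lambda * b + 1) ((t : R) - t0).
have k0 t : 0 <= k t by rewrite mulr_ge0 ?Kt_ge0.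
have mk : measurable_fun [set: RR] k by rewrite /k; mfun.
have mk2 : measurable_fun [set: Z] (fun w : Z => k w.2) := measurableT_comp mk measurable_snd.
have kt t : k t != 0 -> t0 < t < (z.2 : R).
  move=> h; apply/andP; split; rewrite -subr_gt0 ltNge; apply/negP => h'; move: h.
    by rewrite /k [Kt _ ((t : R) - t0)]Kt0 ?mulr0 ?eqxx//.
  by rewrite /k Kt0 ?mul0r ?eqxx.
pose P := (pi / B) `^ (n%:R / 2).
have P0 : 0 < P by rewrite powR_gt0// divr_gt0 ?pi_gt0.
pose C := c `^ lambda * (P * (Gamma alpha)^-1).
have C0 : 0 < C by rewrite mulr_gt0 ?powR_gt0// mulr_gt0.
pose h (w : Z) : R := k w.2 * (gauss (vsub z.1 w.1) ((z.2 : R) - w.2) * gauss (vsub w.1 (origin n)) r1).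
have h0 w : 0 <= h w by apply: mulr_ge0 => //; rewrite mulr_ge0 ?gauss_ge0.
have mh : measurable_fun [set: Z] h by rewrite /h; mfun.
have [BE _] := integral_BetaE a0 lb0.
apply: (@le_trans _ _ (\int[V]_w (C * h w)%:E)%E); last first.
  apply: ae_ge0_le_integral => //.
  - by move=> w _; rewrite lee_fin mulr_ge0// ltW.
  - by mfun.
  - by move=> w _; rewrite lee_fin mulr_ge0// ker_ge0.
  - by mfun.
  apply: (@filterS _ _ FF _ _ _ F_super) => w Hw _; rewrite lee_fin.
  have [->|kn0] := eqVneq (h w) 0; first by rewrite mulr0 mulr_ge0// ker_ge0.
  have /kt /andP[w1 w2] : k w.2 != 0.
    by apply: contra_neq kn0 => kz; rewrite /h kz mul0r.
  have wr : 0 < (w.2 : R) - t0 < r0 by apply/andP; split; lra.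
  have := Hw _ _ (H w wr); rewrite !mulr_ge0 ?expR_ge0 ?powR_ge0 ?(ltW c0)// => /(_ isT).
  rewrite !powRM ?mulr_ge0 ?expR_ge0 ?powR_ge0 ?(ltW c0)// -powRrM.
  have -> : expR (- (a * sqnorm w.1)) `^ lambda = P * gauss w.1 r1.
    rewrite -expR_sqnormE// -expRM; congr expR; rewrite /B; ring.
  move=> Fw; rewrite kerE.
  have -> : C * h w = (Gamma alpha)^-1 * Kt alpha ((z.2 : R) - w.2) * gauss (vsub z.1 w.1) ((z.2 : R) - w.2) *
     (c `^ lambda * (P * gauss w.1 r1) * ((w.2 : R) - t0) `^ (b * lambda)).
    rewrite /C /h /k vsub_origin [Kt (lambda * b + 1) _]KtE ?subr_gt0//.
    have -> : lambda * b + 1 - 1 = b * lambda by ring.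
    by ring.
  apply: ler_wpM2l => //.
  by apply: (mulr_ge0 (mulr_ge0 (ltW Gi0) (Kt_ge0 _ _)) (gauss_ge0 _ _)).
rewrite ge0_integral_EFinMl ?(ltW C0)//.
rewrite (integral_gauss_conv_time (k := k) (r := fun t => (z.2 : R) - t) (s := fun=> r1))//; last 2 first.
- by mfun.
- by move=> t /kt /andP[_ ?]; rewrite subr_gt0.
(* The Gaussian time z.2 - t + r1 lies between r1 and r0 + r1; the prefactor is bounded at the upper
   end and the exponent at the lower end, where 1/(4 r1) = B. *)
pose g := ((4 * pi * (r0 + r1)) `^ (n%:R / 2))^-1 * expR (- (B * sqnorm z.1)).
have g0 : 0 <= g by rewrite mulr_ge0 ?expR_ge0 ?invr_ge0 ?powR_ge0.
apply: (@le_trans _ _ (C%:E * \int[mu]_t (g * k t)%:E)%E); last first.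
  apply: lee_wpmul2l; first by rewrite lee_fin ltW.
  apply: ge0_le_integral => //.
  - by move=> t _; rewrite lee_fin mulr_ge0.
  - by mfun.
  - by mfun.
  move=> t _; rewrite lee_fin mulrC vsub_origin.
  have [->|/kt /andP[t1 t2]] := eqVneq (k t) 0; first by rewrite !mul0r.
  apply: ler_wpM2l => //; rewrite /g /gauss.
  have q0 : 0 < (z.2 : R) - t + r1 by rewrite addr_gt0// subr_gt0.
  apply: ler_pM; rewrite ?invr_ge0 ?powR_ge0 ?expR_ge0//.
    have rr : 0 < r0 + r1 by rewrite addr_gt0.
    rewrite lef_pV2 ?posrE ?powR_gt0 ?mulr_gt0 ?pi_gt0//.
    apply: ge0_ler_powR; rewrite ?nnegrE ?divr_ge0 ?mulr_ge0 ?pi_ge0 ?(ltW q0) ?(ltW rr)//.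
    by apply: ler_wpM2l; rewrite ?mulr_ge0 ?pi_ge0//; lra.
  rewrite ler_expR mulNr lerN2 ler_pdivrMr ?mulr_gt0//.
  rewrite mulrC mulrA ler_peMl ?sqnorm_ge0//.
  have r1B : 4 * r1 * B = 1 by rewrite /r1; field; rewrite gt_eqF.
  apply: (@le_trans _ _ (4 * r1 * B)); first by rewrite r1B.
  by apply: ler_wpM2r; [exact: ltW|apply: ler_wpM2l => //; lra].
rewrite ge0_integral_EFinMl// integral_Kt_conv// KtE//.
have -> : alpha + (lambda * b + 1) - 1 = b by rewrite -[RHS]bE; ring.
rewrite -!EFinM lee_fin.
have E1 : (4 * (lambda * a) * r0 + 1) `^ (n%:R / 2) * P = (4 * pi * (r0 + r1)) `^ (n%:R / 2).
  rewrite /P -powRM ?divr_ge0 ?pi_ge0 ?(ltW B0)//.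
    by congr (_ `^ _); rewrite -/B /r1; field; rewrite gt_eqF.
  by rewrite addr_ge0// mulr_ge0 ?(ltW r00)// mulr_ge0 ?(ltW B0).
rewrite /C /g /D -E1 invfM.
have X0 : (4 * (lambda * a) * r0 + 1) `^ (n%:R / 2) != 0.
  by rewrite gt_eqF// powR_gt0// ltr_wpDl// mulr_ge0 ?(ltW r00)// mulr_ge0 ?(ltW B0).
rewrite le_eqVlt; apply/orP; left; apply/eqP.
by field; rewrite X0 (gt_eqF P0) (gt_eqF G0).
Qed.

Lemma sublinear_spread (m : R) : 0 < m ->
  (forall z : Z, 2 * r0 <= (z.2 : R) ->
    ((m * ((z.2 : R) `^ e * expR (- sqnorm z.1 / z.2)))%:E <= Kf z)%E) ->
  exists2 c : R, 0 < c & forall d, 0 < d -> exists2 a, 0 < a <= d & bounded_below c a.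
Proof.
move=> m0 Hm; pose A := t0^-1; have t00 : 0 < t0 by rewrite mulr_gt0.
have A0 : 0 < A by rewrite invr_gt0.
(* For t0 < t < 3 r0 the ratio t/t0 lies in [1/2, 2] and (t - t0)^b <= r0^b, which c0 absorbs; also
   |x|^2/t <= A |x|^2. *)
pose c0 := m * (t0 `^ e * 2 `^ (- `|e|)) / r0 `^ b.
have c00 : 0 < c0 by rewrite divr_gt0 ?mulr_gt0 ?powR_gt0.
have H0 : bounded_below c0 A.
  move=> z /andP[z1 z2]; apply: le_trans (Hm z _); last by rewrite -/t0; lra.
  have y1 : 2 * r0 < (z.2 : R) by rewrite -/t0; lra.
  have y2 : (z.2 : R) < 3 * r0 by move: z2; rewrite /t0 => ?; lra.
  have zp : 0 < (z.2 : R) by lra.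
  rewrite lee_fin /c0.
  have -> : m * (t0 `^ e * 2 `^ (- `|e|)) / r0 `^ b * expR (- (A * sqnorm z.1)) * ((z.2 : R) - t0) `^ b =
    m * (t0 `^ e * 2 `^ (- `|e|) * (expR (- (A * sqnorm z.1)) * (((z.2 : R) - t0) `^ b / r0 `^ b))).
    by ring.
  apply: ler_wpM2l; first exact: ltW.
  apply: ler_pM; rewrite ?mulr_ge0 ?powR_ge0 ?expR_ge0 ?invr_ge0 ?powR_ge0//.
    have -> : (z.2 : R) `^ e = t0 `^ e * (z.2 / t0) `^ e.
      by rewrite -powRM ?(ltW t00) ?divr_ge0 ?(ltW zp) ?(ltW t00)// mulrC divfK ?gt_eqF.
    apply: ler_wpM2l; first exact: powR_ge0.
    by apply: powR_near1_ge; rewrite ler_pdivlMr// ler_pdivrMr// /t0; apply/andP; split; lra.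
  rewrite -[leRHS]mulr1; apply: ler_pM; rewrite ?expR_ge0 ?divr_ge0 ?powR_ge0//.
    rewrite ler_expR mulNr lerN2 mulrC; apply: ler_wpM2r; first exact: sqnorm_ge0.
    by rewrite /A lef_pV2 ?posrE//; lra.
  rewrite ler_pdivrMr ?powR_gt0// mul1r; apply: ge0_ler_powR; rewrite ?nnegrE ?(ltW b0) ?(ltW z1) ?(ltW r00) ?(ltW z2)//.
(* The second term is the fixed point of c |-> c^lambda D(A); at or below it one iteration does not
   lower the constant. *)
pose c := Num.min c0 (D A `^ (1 - lambda)^-1).
have c_gt0 : 0 < c by rewrite lt_min c00 powR_gt0// D_gt0// ltW.
exists c => //.
have weaken x y a : x <= y -> bounded_below y a -> bounded_below x a.
  move=> xy H z hz; apply: le_trans (H z hz); rewrite lee_fin.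
  by apply: ler_wpM2r; [exact: powR_ge0|apply: ler_wpM2r => //; exact: expR_ge0].
have iter j : bounded_below c (lambda ^+ j * A).
  elim: j => [|j IH]; first by rewrite expr0 mul1r; apply: weaken H0; rewrite ge_min lexx.
  set a := lambda ^+ j * A in IH *; have ha : 0 < a by rewrite mulr_gt0 ?exprn_gt0.
  have aA : a <= A by rewrite ler_piMl ?(ltW A0)// exprn_ile1 ?(ltW lambda0) ?(ltW lambda1).
  rewrite exprS -mulrA -/a; apply: weaken (bounded_below_step c_gt0 ha IH).
  rewrite [leLHS](_ : c = c `^ lambda * c `^ (1 - lambda)); last first.
    by rewrite -powRD ?(gt_eqF c_gt0) ?implybT// addrC subrK powRr1 ?ltW.
  apply: ler_wpM2l; first exact: powR_ge0.
  apply: (@le_trans _ _ (D A)).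
    have -> : D A = (D A `^ (1 - lambda)^-1) `^ (1 - lambda).
      by rewrite -powRrM mulVf ?gt_eqF// powRr1// ltW// D_gt0// ltW.
    by apply: ge0_ler_powR; rewrite ?nnegrE ?powR_ge0 ?(ltW l10) ?(ltW c_gt0)// ge_min lexx orbT.
  have [_ B0] := integral_BetaE a0 lb0.
  rewrite /D; apply: ler_wpM2r; first by rewrite mulr_ge0 ?(ltW Gi0) ?(ltW B0).
  have pos x : 0 < x -> 0 < 4 * (lambda * x) * r0 + 1 by move=> x0; rewrite addr_gt0// !mulr_gt0.
  rewrite lef_pV2 ?posrE ?powR_gt0 ?pos//.
  apply: ge0_ler_powR; rewrite ?nnegrE ?divr_ge0 ?(ltW (pos _ _))//.
  rewrite lerD2r; apply: ler_wpM2r; first exact: ltW.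
  by apply: ler_wpM2l => //; apply: ler_wpM2l => //; exact: ltW.
move=> d d0.
have [j Hj] : exists j, lambda ^+ j * A <= d.
  have := @cvg_expr R lambda; rewrite ger0_norm ?(ltW lambda0)// => /(_ lambda1).
  move=> /cvgr0_norm_le /(_ (d / A) (divr_gt0 d0 A0)) [N _ /(_ N (leqnn N))] /= H.
  exists N; rewrite -ler_pdivlMr//; apply: le_trans H; exact: ler_norm.
by exists (lambda ^+ j * A); rewrite ?mulr_gt0 ?exprn_gt0.
Qed.

End sublinear.

Lemma nonexistence_sublinear : lambda < 1 -> (1 <= n)%N -> False.
Proof.
move=> l1 n1; have [m [r0 [m0 r01 Hm]]] := potential_lower.
have [c c0 H] := sublinear_spread l1 r01 m0 Hm.
have r00 : 0 < r0 by apply: lt_le_trans r01.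
set b := alpha / (1 - lambda) in H.
(* Only the upper half of the slab is used, where t - 2 r0 >= r0/2 and the factor (t - 2 r0)^b stays
   away from 0. *)
pose k (t : RR) : R := (2 * r0 + r0 / 2 < t)%R%:R * (t < 3 * r0)%R%:R.
have mk : measurable_fun [set: RR] k by rewrite /k; mfun.
have k0 t : 0 <= k t by rewrite mulr_ge0.
have mk2 : measurable_fun [set: Z] (fun w : Z => k w.2) := measurableT_comp mk measurable_snd.
pose q := lambda * p; have q0 : 0 < q by rewrite mulr_gt0.
have b0 : 0 < b by rewrite divr_gt0// subr_gt0.
pose C := (c * (r0 / 2) `^ b) `^ q.
have C0 : 0 < C by rewrite powR_gt0// mulr_gt0// powR_gt0// divr_gt0.
have lower a : 0 < a -> (forall z : Z, 0 < (z.2 : R) - 2 * r0 < r0 ->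
  ((c * expR (- (a * sqnorm z.1)) * ((z.2 : R) - 2 * r0) `^ b)%:E <= Kf z)%E) ->
  ((C * (pi / (q * a)) `^ (n%:R / 2) * (r0 / 2))%:E <= \int[V]_w (((w.2 : R) < 3 * r0)%R%:R * F w `^ p)%:E)%E.
  move=> ha Ha; have qa0 : 0 < q * a by rewrite mulr_gt0.
  have P0 : 0 < (pi / (q * a)) `^ (n%:R / 2) by rewrite powR_gt0// divr_gt0 ?pi_gt0.
  have g0 : 0 < (4 * (q * a))^-1 by rewrite invr_gt0 mulr_gt0.
  have -> : ((C * (pi / (q * a)) `^ (n%:R / 2) * (r0 / 2))%:E =
    \int[V]_w (C * (pi / (q * a)) `^ (n%:R / 2) * (k w.2 * gauss w.1 (4 * (q * a))^-1))%:E)%E.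
    rewrite ge0_integral_EFinMl ?mulr_ge0 ?(ltW C0) ?(ltW P0)//; last 2 first.
    - by mfun.
    - by move=> w; rewrite mulr_ge0 ?gauss_ge0.
    rewrite integral_slab_gauss// /k integral_ind_oo EFinM.
    have -> : 2 * r0 + r0 / 2 < 3 * r0 by lra.
    by congr (_ * _%:E)%E; lra.
  apply: ae_ge0_le_integral => //.
  - move=> w _; rewrite lee_fin; apply: mulr_ge0; first by apply: mulr_ge0; exact: ltW.
    by apply: mulr_ge0 => //; exact: gauss_ge0.
  - by mfun.
  - by move=> w _; rewrite lee_fin mulr_ge0 ?powR_ge0.
  - by mfun.
  apply: (@filterS _ _ FF _ _ _ F_super) => w Hw _; rewrite lee_fin /k.
  have [w1|w1] := ltP (2 * r0 + r0 / 2) (w.2 : R); last first.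
    by rewrite !mul0r mulr0 mulr_ge0 ?powR_ge0.
  have [w2|w2] := ltP (w.2 : R) (3 * r0); last first.
    by rewrite !(mulr0, mul0r).
  rewrite !mul1r -mulrA -expR_sqnormE//.
  have := Hw _ _ (Ha w _).
  have -> : 0 < (w.2 : R) - 2 * r0 < r0 by apply/andP; split; lra.
  rewrite !mulr_ge0 ?expR_ge0 ?powR_ge0 ?(ltW c0)// => /(_ isT isT) Fw.
  apply: (@le_trans _ _ (((c * expR (- (a * sqnorm w.1)) * ((w.2 : R) - 2 * r0) `^ b) `^ lambda) `^ p)); last first.
    by apply: ge0_ler_powR; rewrite ?nnegrE ?powR_ge0 ?(ltW p0).
  rewrite -powRrM -/q.
  have -> : c * expR (- (a * sqnorm w.1)) * ((w.2 : R) - 2 * r0) `^ b =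
    (c * ((w.2 : R) - 2 * r0) `^ b) * expR (- (a * sqnorm w.1)) by ring.
  rewrite [leRHS]powRM ?mulr_ge0 ?expR_ge0 ?powR_ge0 ?(ltW c0)//.
  have -> : expR (- (a * sqnorm w.1)) `^ q = expR (- (q * a * sqnorm w.1)).
    by rewrite -expRM; congr expR; ring.
  apply: ler_wpM2r; first exact: expR_ge0.
  apply: ge0_ler_powR; rewrite ?nnegrE ?(ltW q0) ?mulr_ge0 ?powR_ge0 ?(ltW c0)//.
  apply: ler_wpM2l; first exact: ltW.
  by apply: ge0_ler_powR; rewrite ?nnegrE ?(ltW b0) ?divr_ge0 ?(ltW r00)//; lra.
have Sfin := Fp_lty (3 * r0).
set S := integral _ _ _ in Sfin lower.
have [s s0 SE] : exists2 s : R, 0 <= s & S = s%:E.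
  have S0 : (0 <= S)%E by apply: integral_ge0 => w _; rewrite lee_fin mulr_ge0 ?powR_ge0.
  by move: S0 Sfin; case: S {lower} => [s||]//; rewrite lee_fin => s0 _; exists s.
(* The value of (pi/(q a))^(n/2) at which the lower bound for the slab integral s reaches s + 1.
   Solving for a gives d, which needs n/2 > 0, hence n at least 1. *)
pose y := (s + 1) / (C * (r0 / 2)).
have y0 : 0 < y by rewrite divr_gt0 ?mulr_gt0 ?divr_gt0// ltr_wpDl.
have hn : 0 < n%:R / 2 :> R by rewrite divr_gt0// ltr0n.
pose d := pi / (q * y `^ (n%:R / 2)^-1).
have d0 : 0 < d by rewrite divr_gt0 ?pi_gt0// mulr_gt0// powR_gt0.
have [a /andP[ha ad] Ha] := H d d0.
have := lower a ha Ha; rewrite SE lee_fin.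
have : y <= (pi / (q * a)) `^ (n%:R / 2).
  have -> : y = (y `^ (n%:R / 2)^-1) `^ (n%:R / 2).
    by rewrite -powRrM mulVf ?gt_eqF// powRr1// ltW.
  have qa0 : 0 < q * a by rewrite mulr_gt0.
  apply: ge0_ler_powR; rewrite ?nnegrE ?powR_ge0 ?(ltW hn) ?divr_ge0 ?pi_ge0 ?(ltW qa0)//.
  have qy0 : 0 < q * y `^ (n%:R / 2)^-1 by rewrite mulr_gt0// powR_gt0.
  rewrite (ler_pdivlMr _ _ qa0); move: ad; rewrite /d (ler_pdivlMr _ _ qy0).
  by congr (_ <= _); ring.
move=> /(ler_wpM2l (ltW (mulr_gt0 C0 (divr_gt0 r00 (ltr0n R 2))))).
have -> : C * (r0 / 2) * y = s + 1.
  by rewrite /y; field; rewrite (gt_eqF C0) (gt_eqF r00).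
move=> h1 h2.
have : s + 1 <= s by apply: le_trans h1 _; apply: le_trans h2; rewrite le_eqVlt; apply/orP; left; apply/eqP; ring.
by rewrite gerDl ler10.
Qed.

(** * Nonexistence for lambda > 1 at or above the critical order *)

Section superlinear.
Hypothesis lambda1 : 1 < lambda.
Hypothesis alpha_ge : (n%:R + 2) / 2 * (1 - lambda^-1) <= alpha.

Let l10 : 0 < lambda - 1. Proof. by rewrite subr_gt0. Qed.
Let hn : 0 <= n%:R / 2 :> R. Proof. by rewrite divr_ge0. Qed.
(** The self-similar decay rate, characterised by (r^(- kappa))^(1 - lambda) = r^alpha; this
    identity balances the terms of [young]. *)
Let kappa : R := alpha / (lambda - 1).
Let kappa0 : 0 < kappa. Proof. by rewrite divr_gt0. Qed.
(* Large enough for [psi (k + 1 + alpha) T] to be bounded and for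
   [psi (k + 1 - kappa) T] to be integrable. *)
Let k : R := n%:R / 2 + kappa.
Let k0 : 0 < k + 1. Proof. by rewrite ltr_pwDr// /k addr_ge0// ltW. Qed.

(** This and [kappa_alpha] are the two working forms of [alpha_ge]: the first bounds the time
    integrand of the energy below by 1/t, the second makes the accompanying power of T at least n/2
    + 1. *)
Let alpha_lambda : (n%:R / 2 + 1) * (lambda - 1) <= alpha * lambda.
Proof.
have -> : (n%:R / 2 + 1) * (lambda - 1) = (n%:R + 2) / 2 * (1 - lambda^-1) * lambda.
  by field; rewrite gt_eqF.
by apply: ler_wpM2r => //; exact: ltW.
Qed.

Let kappa_alpha : n%:R / 2 + 1 <= kappa + alpha.
Proof.
have -> : kappa + alpha = alpha * lambda / (lambda - 1).
  by rewrite /kappa; field; rewrite gt_eqF.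
by rewrite ler_pdivlMr.
Qed.

Let psi (s T : R) (w : Z) : R := Kt s (T - w.2) * gauss w.1 (T - w.2).

Let psi_ge0 s T w : 0 <= psi s T w.
Proof. by rewrite mulr_ge0 ?Kt_ge0 ?gauss_ge0. Qed.

Let mpsi s T : measurable_fun [set: Z] (psi s T).
Proof. by rewrite /psi; mfun. Qed.

Let integral_psi s T : 0 < s -> 0 < T ->
  (\int[V]_w ((0 < (w.2 : R))%R%:R * psi s T w)%:E <= (T `^ s / s)%:E)%E.
Proof.
move=> s0 T0; apply: le_trans (integral_Kt_le s0 T0).
have mK : measurable_fun [set: RR] (fun t : RR => ((t < T)%R%:R * Kt s t)%:E).
  by mfun.
rewrite -(ge0_integral_reflect T mK); last by move=> t; rewrite lee_fin mulr_ge0 ?Kt_ge0.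
have mK' : measurable_fun [set: RR] (fun t : RR => (T - t < T)%R%:R * Kt s (T - t)).
  by mfun.
rewrite -(integral_gauss_time (s := fun t => T - (t : R)) (origin n) mK')//.
- rewrite le_eqVlt; apply/orP; left; apply/eqP; apply: eq_integral => w _.
  by rewrite vsub_origin /psi mulrA gtrDl oppr_lt0.
- by mfun.
- by move=> t; rewrite mulr_ge0 ?Kt_ge0.
- move=> t; have [//|h] := ltP 0 (T - t); by rewrite Kt0// mulr0 eqxx.
Qed.

Let Ck : R := (Gamma alpha)^-1 * Beta (k + 1) alpha.
Let Ck0 : 0 < Ck.
Proof. by have [_ B0] := integral_BetaE k0 a0; rewrite mulr_gt0. Qed.

(** The family [psi] is stable under the adjoint potential: the powers of time combine by the Beta
    integral, the backward heat kernels by the semigroup law. *)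
Let adjoint T (w : Z) :
  (\int[V]_z (ker alpha z w * psi (k + 1) T z)%:E = (Ck * psi (k + 1 + alpha) T w)%:E)%E.
Proof.
pose q (t : RR) : R := Kt (k + 1) (T - t) * Kt alpha ((t : R) - w.2).
have q0 t : 0 <= q t by rewrite mulr_ge0 ?Kt_ge0.
have mq : measurable_fun [set: RR] q by rewrite /q; mfun.
have mq2 : measurable_fun [set: Z] (fun z : Z => q z.2) := measurableT_comp mq measurable_snd.
have qt t : q t != 0 -> (w.2 : R) < t < T.
  move=> h; apply/andP; split; rewrite -subr_gt0 ltNge; apply/negP => h'; move: h.
    by rewrite /q [Kt alpha _]Kt0 ?mulr0 ?eqxx.
  by rewrite /q Kt0 ?mul0r ?eqxx.
transitivity (\int[V]_z ((Gamma alpha)^-1 * (q z.2 * (gauss (vsub w.1 z.1) ((z.2 : R) - w.2) *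
    gauss (vsub z.1 (origin n)) (T - z.2))))%:E)%E.
  by apply: eq_integral => z _; rewrite kerE /psi /q vsub_origin gauss_vsubC; congr EFin; ring.
rewrite ge0_integral_EFinMl ?(ltW Gi0)//; last 2 first.
- by mfun.
- by move=> z; apply: mulr_ge0 => //; rewrite mulr_ge0 ?gauss_ge0.
rewrite (integral_gauss_conv_time (k := q) (r := fun t => (t : R) - w.2) (s := fun t => T - (t : R)))//; last 4 first.
- by mfun.
- by mfun.
- by move=> t /qt /andP[? _]; rewrite subr_gt0.
- by move=> t /qt /andP[_ ?]; rewrite subr_gt0.
have -> : (\int[mu]_t (q t * gauss (vsub w.1 (origin n)) (t - w.2 + (T - t)))%:E =
    \int[mu]_t (gauss w.1 (T - w.2) * q t)%:E)%E.
  apply: eq_integral => t _; rewrite vsub_origin mulrC; congr (_ * _)%:E; congr gauss; ring.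
rewrite (ge0_integral_EFinMl _ (gauss_ge0 _ _) mq q0).
rewrite [X in (_ * (_ * X))%E](integral_Kt_conv _ _ k0 a0) -!EFinM /Ck /psi.
by congr EFin; ring.
Qed.

Let U z : R := fine (Kf z).

Let mU : measurable_fun [set: Z] U.
Proof.
apply: (measurableT_comp (fine_measurable measurableT)).
apply: (measurable_spacetime_integral (F := fun q : Z * Z => (ker alpha q.1 q.2 * F q.2)%:E)).
  apply/measurable_EFinP; apply: measurable_funM; first by mfun.
  exact: (measurableT_comp mF measurable_snd).
by move=> q; rewrite lee_fin mulr_ge0// ker_ge0.
Qed.

Let Kf_ge0 z : (0 <= Kf z)%E.
Proof. by apply: integral_ge0 => w _; rewrite lee_fin mulr_ge0// ker_ge0. Qed.

Let U_ge0 z : 0 <= U z. Proof. by rewrite fine_ge0. Qed.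

Let Kf_lty : {ae V, forall z, (Kf z < +oo)%E}.
Proof.
apply: (@filterS _ _ FF _ _ _ (ker_abs_lty alpha_p XF)) => z; apply: le_lt_trans.
rewrite le_eqVlt; apply/orP; left; apply/eqP.
by apply: eq_integral => w _; rewrite ger0_norm.
Qed.

Let UE : {ae V, forall z, Kf z = (U z)%:E /\ U z `^ lambda <= F z}.
Proof.
apply: (@filterS2 _ _ FF _ _ _ _ Kf_lty F_super) => z h1 h2.
have e1 : Kf z = (U z)%:E by rewrite fineK// ge0_fin_numE.
by split => //; apply: h2 => //; rewrite e1.
Qed.

Let X T := (\int[V]_w ((0 < (w.2 : R))%R%:R * (U w `^ lambda * psi (k + 1 + alpha) T w))%:E)%E.

Let mX T : measurable_fun [set: Z] (fun w : Z => (0 < (w.2 : R))%R%:R * (U w `^ lambda * psi (k + 1 + alpha) T w)).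
Proof. by have := mpsi (k + 1 + alpha) T => ?; mfun. Qed.

(** Finiteness is what later allows a fraction of X T to be absorbed. It follows from U^lambda <= F
    <= 1 + F^p: the test function is integrable and, by [gauss_le_powR], bounded for 0 < t < T. *)
Let X_lty T : 0 < T -> (X T < +oo)%E.
Proof.
move=> T0; set s := k + 1 + alpha; have s0 : 0 < s by rewrite /s addr_gt0.
have mp := mpsi s T; pose c := T `^ (s - 1 - n%:R / 2).
have c0 : 0 <= c by exact: powR_ge0.
apply: (@le_lt_trans _ _ (\int[V]_w ((0 < (w.2 : R))%R%:R * psi s T w)%:E +
   c%:E * \int[V]_w (((w.2 : R) < T)%R%:R * F w `^ p)%:E)%E); last first.
  apply: lte_add_pinfty; last by apply: lte_mul_pinfty; rewrite ?lee_fin.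
  by apply: (le_lt_trans (integral_psi s0 T0)); rewrite ltry.
rewrite -ge0_integral_EFinMl//; last 2 first.
- by mfun.
- by move=> w; rewrite mulr_ge0 ?powR_ge0.
rewrite -ge0_integralD//; last 4 first.
- by move=> w _; rewrite lee_fin mulr_ge0.
- by mfun.
- by move=> w _; rewrite lee_fin mulr_ge0// mulr_ge0 ?powR_ge0.
- by mfun.
apply: ae_ge0_le_integral => //.
- by move=> w _; rewrite lee_fin mulr_ge0// mulr_ge0 ?powR_ge0.
- by apply/measurable_EFinP; exact: mX.
- by move=> w _; rewrite -EFinD lee_fin addr_ge0// mulr_ge0// mulr_ge0 ?powR_ge0.
- by apply: emeasurable_funD; mfun.
apply: (@filterS _ _ FF _ _ _ UE) => w [_ Uw] _; rewrite -EFinD lee_fin.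
have P0 : 0 <= F w `^ p by exact: powR_ge0.
have rhs2 : 0 <= c * (((w.2 : R) < T)%R%:R * F w `^ p) by rewrite mulr_ge0// mulr_ge0.
have [w0|w0] := ltP 0 (w.2 : R); last by rewrite !mul0r add0r.
have [wT|wT] := ltP (w.2 : R) T; last first.
  by rewrite /psi Kt0 ?subr_le0// !(mul0r, mulr0) add0r.
rewrite !mul1r.
apply: (@le_trans _ _ ((1 + F w `^ p) * psi s T w)).
  apply: ler_wpM2r => //; apply: le_trans Uw _.
  by have := powR_split_le p1 (F0 w) ltr01; rewrite powR1 mulr1.
rewrite mulrDl mul1r lerD2l mulrC; apply: ler_wpM2r => //.
have r0 : 0 < T - w.2 by rewrite subr_gt0.
rewrite /psi KtE//; apply: (@le_trans _ _ ((T - w.2) `^ (s - 1) * (T - w.2) `^ (- (n%:R / 2)))).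
  by apply: ler_wpM2l; [exact: powR_ge0|exact: gauss_le_powR].
rewrite -powRD ?(gt_eqF r0) ?implybT//.
apply: ge0_ler_powR; rewrite ?nnegrE ?(ltW r0) ?(ltW T0)//; last by rewrite gerBl ltW.
by rewrite /s /k; have := kappa0; have := a0; lra.
Qed.

(** Half of the constant in front of X T, so that the term produced by [young] can be absorbed. *)
Let delta : R := Ck / 2.
Let delta0 : 0 < delta. Proof. by rewrite divr_gt0. Qed.
Let C' : R := delta `^ (- (lambda - 1)^-1).
Let C'0 : 0 < C'. Proof. by rewrite powR_gt0. Qed.

(** This is [powR_split_le] with exponent lambda and threshold C' r^(- kappa); C' is chosen so that
    the threshold to the power 1 - lambda equals delta r^alpha. *)
Let young (x r : R) : 0 <= x -> 0 < r ->
  x * Kt (k + 1) r <= delta * (x `^ lambda * Kt (k + 1 + alpha) r) + C' * Kt (k + 1 - kappa) r.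
Proof.
move=> x0 r0; pose g := C' * r `^ (- kappa).
have g0 : 0 < g by rewrite mulr_gt0// powR_gt0.
have gE : g `^ (1 - lambda) = delta * r `^ alpha.
  rewrite /g powRM ?powR_ge0 ?(ltW C'0)// /C' -!powRrM.
  have -> : - (lambda - 1)^-1 * (1 - lambda) = 1 by field; rewrite gt_eqF.
  have -> : - kappa * (1 - lambda) = alpha by rewrite /kappa; field; rewrite gt_eqF.
  by rewrite powRr1 ?ltW.
have := powR_split_le (ltW lambda1) x0 g0; rewrite gE => H.
have rk : 0 <= r `^ (k + 1 - 1) by exact: powR_ge0.
rewrite !KtE//; apply: le_trans (ler_wpM2r rk H) _.
rewrite le_eqVlt; apply/orP; left; apply/eqP.
have -> : k + 1 + alpha - 1 = (k + 1 - 1) + alpha by ring.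
have -> : k + 1 - kappa - 1 = (k + 1 - 1) - kappa by ring.
rewrite !(@powRD _ r (k + 1 - 1)) ?(gt_eqF r0) ?implybT// /g; ring.
Qed.

(** With psi_s for [psi s T] and all integrals over t > 0: Ck X <= Ck int F psi_(k+1+alpha), which
    by [adjoint] is a double integral at most int U psi_(k+1), and this is at most (Ck/2) X + C' int
    psi_(k+1-kappa). The last exponent k + 1 - kappa equals n/2 + 1. *)
Lemma superlinear_energy_le T : 0 < T ->
  (X T <= (2 * C' / (Ck * (n%:R / 2 + 1)) * T `^ (n%:R / 2 + 1))%:E)%E.
Proof.
move=> T0; have hn1 : 0 < n%:R / 2 + 1 :> R by rewrite ltr_wpDl.
have kk : k + 1 - kappa = n%:R / 2 + 1 by rewrite /k; ring.
have mp1 := mpsi (k + 1) T; have mp2 := mpsi (k + 1 + alpha) T; have mp3 := mpsi (k + 1 - kappa) T.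
pose I (w : Z) : R := (0 < (w.2 : R))%R%:R.
have I0 w : 0 <= I w by [].
have mI : measurable_fun [set: Z] I by rewrite /I; mfun.
have X0 : (0 <= X T)%E.
  by apply: integral_ge0 => w _; rewrite lee_fin mulr_ge0// mulr_ge0 ?powR_ge0.
have s1 : (Ck%:E * X T <= \int[V]_w (I w * (F w * (Ck * psi (k + 1 + alpha) T w)))%:E)%E.
  rewrite -ge0_integral_EFinMl ?(ltW Ck0)//; last by move=> w; rewrite mulr_ge0// mulr_ge0 ?powR_ge0.
  apply: ae_ge0_le_integral => //.
  - by move=> w _; rewrite lee_fin mulr_ge0 ?(ltW Ck0)// mulr_ge0// mulr_ge0 ?powR_ge0.
  - by apply/measurable_EFinP; apply: measurable_funM.
  - by move=> w _; rewrite lee_fin mulr_ge0// mulr_ge0// mulr_ge0 ?(ltW Ck0).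
  - by mfun.
  apply: (@filterS _ _ FF _ _ _ UE) => w [_ Uw] _; rewrite lee_fin -/(I w).
  have -> : Ck * (I w * (U w `^ lambda * psi (k + 1 + alpha) T w)) =
    (I w * (Ck * psi (k + 1 + alpha) T w)) * U w `^ lambda by ring.
  have -> : I w * (F w * (Ck * psi (k + 1 + alpha) T w)) =
    (I w * (Ck * psi (k + 1 + alpha) T w)) * F w by ring.
  apply: ler_wpM2l => //.
  by rewrite mulr_ge0// mulr_ge0 ?(ltW Ck0).
pose H (q : Z * Z) : \bar R := (I q.2 * F q.2 * (ker alpha q.1 q.2 * psi (k + 1) T q.1))%:E.
have mH : measurable_fun [set: Z * Z] H.
  apply/measurable_EFinP; apply: measurable_funM; apply: measurable_funM.
  - exact: (measurableT_comp mI measurable_snd).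
  - exact: (measurableT_comp mF measurable_snd).
  - by mfun.
  - exact: (measurableT_comp mp1 measurable_fst).
have H0 q : (0 <= H q)%E.
  by rewrite lee_fin; apply: mulr_ge0; [exact: mulr_ge0|rewrite mulr_ge0// ker_ge0].
have s2 : (\int[V]_w (I w * (F w * (Ck * psi (k + 1 + alpha) T w)))%:E = \int[V]_w \int[V]_z H (z, w))%E.
  apply: eq_integral => w _.
  transitivity (\int[V]_z (I w * F w * (ker alpha z w * psi (k + 1) T z))%:E)%E => //.
  rewrite ge0_integral_EFinMl ?mulr_ge0//; last 2 first.
  - by mfun.
  - by move=> z; rewrite mulr_ge0// ker_ge0.
  by rewrite adjoint -EFinM mulrA.
have s3 : (\int[V]_w \int[V]_z H (z, w) <= \int[V]_z (I z * (U z * psi (k + 1) T z))%:E)%E.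
  rewrite -(spacetime_tonelli2 mH H0); apply: ae_ge0_le_integral => //.
  - by move=> z _; apply: integral_ge0 => w _; exact: H0.
  - exact: measurable_spacetime_integral.
  - by move=> z _; rewrite lee_fin mulr_ge0// mulr_ge0.
  - by mfun.
  apply: (@filterS _ _ FF _ _ _ UE) => z [Kz _] _.
  have -> : I z * (U z * psi (k + 1) T z) = I z * psi (k + 1) T z * U z by ring.
  have Ip0 : 0 <= I z * psi (k + 1) T z by exact: mulr_ge0.
  rewrite EFinM -Kz /Kf -(ge0_integral_EFinMl _ Ip0); last 2 first.
  - by mfun.
  - by move=> w; rewrite mulr_ge0// ker_ge0.
  apply: ge0_le_integral => //.
  - exact: (measurableT_comp mH (measurable_pair1 z)).
  - by mfun.
  move=> w _; change ((I w * F w * (ker alpha z w * psi (k + 1) T z) <= I z * psi (k + 1) T z * (ker alpha z w * F w))%R : Prop).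
  have -> : I w * F w * (ker alpha z w * psi (k + 1) T z) = (I w * ker alpha z w) * (F w * psi (k + 1) T z) by ring.
  have -> : I z * psi (k + 1) T z * (ker alpha z w * F w) = (I z * ker alpha z w) * (F w * psi (k + 1) T z) by ring.
  apply: ler_wpM2r; first by rewrite mulr_ge0.
  (* Causality: the kernel vanishes unless w precedes z, so the restriction to positive times passes
     from w to z. *)
  have kw := ker_ge0 z w a0.
  rewrite /I; have [w0|w0] := ltP 0 (w.2 : R); last by rewrite mul0r mulr_ge0.
  have [zw|zw] := leP (z.2 : R) w.2; first by rewrite ker0// !mulr0.
  by rewrite (lt_trans w0 zw).
have s4 : (\int[V]_z (I z * (U z * psi (k + 1) T z))%:E <=
    delta%:E * X T + C'%:E * (T `^ (n%:R / 2 + 1) / (n%:R / 2 + 1))%:E)%E.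
  apply: (@le_trans _ _ (delta%:E * X T + C'%:E * \int[V]_w (I w * psi (k + 1 - kappa) T w)%:E)%E); last first.
    apply: leeD2l; apply: lee_wpmul2l; first by rewrite lee_fin ltW.
    by rewrite kk; exact: integral_psi.
  have nX w : 0 <= (0 < (w.2 : R))%R%:R * (U w `^ lambda * psi (k + 1 + alpha) T w).
    by rewrite mulr_ge0// mulr_ge0 ?powR_ge0.
  have mI3 : measurable_fun [set: Z] (fun w => I w * psi (k + 1 - kappa) T w) by exact: measurable_funM.
  have nI3 w : 0 <= I w * psi (k + 1 - kappa) T w by rewrite mulr_ge0.
  rewrite -(ge0_integral_EFinMl _ (ltW delta0) (mX T) nX) -(ge0_integral_EFinMl _ (ltW C'0) mI3 nI3).
  rewrite -ge0_integralD//; last 4 first.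
  - by move=> w _; rewrite lee_fin mulr_ge0 ?(ltW delta0)// mulr_ge0// mulr_ge0 ?powR_ge0.
  - by apply/measurable_EFinP; apply: measurable_funM.
  - by move=> w _; rewrite lee_fin mulr_ge0 ?(ltW C'0)// mulr_ge0.
  - by mfun.
  apply: ge0_le_integral => //.
  - by move=> w _; rewrite lee_fin mulr_ge0// mulr_ge0.
  - by mfun.
  - by apply: emeasurable_funD; apply/measurable_EFinP; apply: measurable_funM => //; mfun.
  move=> w _; rewrite -EFinD lee_fin -/(I w).
  have -> : delta * (I w * (U w `^ lambda * psi (k + 1 + alpha) T w)) + C' * (I w * psi (k + 1 - kappa) T w) =
    I w * (delta * (U w `^ lambda * psi (k + 1 + alpha) T w) + C' * psi (k + 1 - kappa) T w) by ring.
  apply: ler_wpM2l => //.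
  have [r0|r0] := ltP 0 (T - w.2); last by rewrite /psi !Kt0// !(mul0r, mulr0) addr0.
  rewrite /psi; have := ler_wpM2r (gauss_ge0 w.1 (T - w.2)) (young (U_ge0 w) r0).
  by congr (_ <= _); ring.
have := le_trans s3 s4; rewrite -s2 => /(le_trans s1) {s1 s2 s3 s4}.
have := X_lty T0; case: (X T) X0 => [x||]// _ _.
rewrite -!EFinM -EFinD !lee_fin /delta => h.
have {}h : Ck / 2 * x <= C' * (T `^ (n%:R / 2 + 1) / (n%:R / 2 + 1)) by lra.
have -> : 2 * C' / (Ck * (n%:R / 2 + 1)) * T `^ (n%:R / 2 + 1) =
  C' * (T `^ (n%:R / 2 + 1) / (n%:R / 2 + 1)) / (Ck / 2).
  by field; rewrite (gt_eqF Ck0) gt_eqF//; lra.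
by rewrite ler_pdivlMr ?divr_gt0// mulrC.
Qed.

(** Each dyadic interval ]d, 2 d[ contributes at least 1/2, because 1/t >= 1/(2 d) there. This
    replaces the logarithm. *)
Lemma dyadic_log_le (c : R) (N : nat) : 0 < c ->
  ((N%:R / 2)%:E <= \int[mu]_t ((c < t)%R%:R * (t < c * 2 ^+ N)%R%:R * t^-1)%:E)%E.
Proof.
move=> c0; have f0 (d t : R) : 0 <= (c < t)%R%:R * (t < d)%R%:R * t^-1 :> R.
  by have [ct|_] := ltP c t; rewrite ?mul0r// mulr_ge0// invr_ge0 ltW// (lt_trans c0).
have mf (d : R) : measurable_fun [set: RR] (fun t : RR => ((c < t)%R%:R * (t < d)%R%:R * t^-1)%R : R).
  by mfun.
elim: N => [|N IH]; first by rewrite (mul0r (2^-1 : R)); apply: integral_ge0 => t _; rewrite lee_fin.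
pose d := c * 2 ^+ N; have d0 : 0 < d by rewrite mulr_gt0// exprn_gt0.
have dE : c * 2 ^+ N.+1 = 2 * d by rewrite exprS /d; ring.
have cd : c <= d by rewrite ler_peMr ?(ltW c0)// exprn_ege1// ler1n.
rewrite dE; move: IH; rewrite -/d => IH; clearbody d.
apply: (@le_trans _ _ (\int[mu]_t ((c < t)%R%:R * (t < d)%R%:R * t^-1)%:E +
   \int[mu]_t ((2 * d)^-1 * ((d < t)%R%:R * (t < 2 * d)%R%:R))%:E)%E).
  rewrite ge0_integral_EFinMl ?invr_ge0 ?mulr_ge0 ?(ltW d0)//; last by mfun.
  rewrite integral_ind_oo; have -> : d < 2 * d by lra.
  rewrite -EFinM; have -> : (2 * d)^-1 * (2 * d - d) = 1 / 2 by field; rewrite gt_eqF.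
  by rewrite -natr1 mulrDl EFinD; apply: leeD2r.
rewrite -ge0_integralD//; last 4 first.
- by move=> t _; rewrite lee_fin.
- exact/measurable_EFinP.
- by move=> t _; rewrite lee_fin mulr_ge0 ?invr_ge0 ?mulr_ge0 ?(ltW d0).
- by mfun.
apply: ge0_le_integral => //.
- by move=> t _; rewrite -EFinD lee_fin addr_ge0// mulr_ge0 ?invr_ge0 ?mulr_ge0 ?(ltW d0).
- by apply: emeasurable_funD; apply/measurable_EFinP => //; mfun.
- exact/measurable_EFinP.
move=> t _; rewrite -EFinD lee_fin.
have [td|dt] := ltP t d.
  rewrite (ltNge d) (ltW td)/= mul0r mulr0 addr0.
  have -> : t < 2 * d by lra.
  by [].
rewrite mulr0 mul0r add0r.
have [dt'|] := ltP d t; last by rewrite mul0r mulr0.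
have [td|_] := ltP t (2 * d); last by rewrite !mulr0 mul0r.
by rewrite (le_lt_trans cd dt') !mul1r mulr1 lef_pV2 ?posrE ?mulr_gt0// ?ltW// (lt_trans d0).
Qed.

Lemma superlinear_energy_ge : exists r0 c, [/\ 1 <= r0, 0 < c & forall N : nat,
  ((c * N%:R * (4 * r0 * 2 ^+ N) `^ (n%:R / 2 + 1))%:E <= X (4 * r0 * 2 ^+ N))%E].
Proof.
have [m [r0 [m0 r01 Hm]]] := potential_lower.
have r00 : 0 < r0 by apply: lt_le_trans r01.
pose ka := k + alpha; have ka0 : 0 <= ka by rewrite /ka /k; have := a0; have := hn; have := kappa0; lra.
pose P1 := (4 * pi) `^ (n%:R / 2) : R; pose P2 := (pi / (lambda + 1)) `^ (n%:R / 2) : R.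
have l20 : 0 < lambda + 1 by rewrite addr_gt0.
have P10 : 0 < P1 by rewrite powR_gt0// mulr_gt0 ?pi_gt0.
have P20 : 0 < P2 by rewrite powR_gt0// divr_gt0 ?pi_gt0.
pose c := m `^ lambda * (2^-1 `^ ka * P1^-1) * P2.
have h2 : 0 < 2^-1 `^ ka by rewrite powR_gt0// invr_gt0.
have P1i : 0 < P1^-1 by rewrite invr_gt0.
have c0 : 0 < c := mulr_gt0 (mulr_gt0 (powR_gt0 _ m0) (mulr_gt0 h2 P1i)) P20.
exists r0, (c / 2); split; [exact: r01|exact: divr_gt0|move=> N].
(* The times used are ]2 r0, T/2[, which consists of N dyadic pieces. There T - t >= T/2, so the
   test function is bounded below by a power of T times exp(- |x|^2/t). *)
set T := 4 * r0 * 2 ^+ N.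
have N1 : 1 <= 2 ^+ N :> R by rewrite exprn_ege1// ler1n.
have T4 : 4 * r0 <= T by rewrite ler_peMr// mulr_ge0 ?(ltW r00).
have T1 : 1 <= T by lra.
have T0 : 0 < T by lra.
have Th : 2 * r0 * 2 ^+ N = T / 2 by rewrite /T; field.
clearbody T.
pose i (t : RR) : R := (2 * r0 < t)%R%:R * (t < 2 * r0 * 2 ^+ N)%R%:R * t^-1.
have i0 t : 0 <= i t.
  rewrite /i; have [ct|_] := ltP (2 * r0) t; last by rewrite !mul0r.
  by rewrite mulr_ge0// invr_ge0; lra.
have mi : measurable_fun [set: RR] i.
  by rewrite /i; mfun.
have mi2 : measurable_fun [set: Z] (fun w : Z => i w.2) := measurableT_comp mi measurable_snd.
(* The Gaussian time of exp(- (lambda + 1) |x|^2/t), where lambda comes from U^lambda and 1 from the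
   test function. *)
pose s (t : RR) : R := (4 * ((lambda + 1) / t))^-1.
have ms : measurable_fun [set: RR] s.
  by rewrite /s; mfun.
have ms2 : measurable_fun [set: Z] (fun w : Z => s w.2) := measurableT_comp ms measurable_snd.
pose d := c * T `^ (ka - n%:R / 2).
have d0 : 0 < d by rewrite mulr_gt0// powR_gt0.
apply: (@le_trans _ _ (d%:E * (N%:R / 2)%:E)%E).
  rewrite -EFinM lee_fin /d.
  have -> : c / 2 * N%:R * T `^ (n%:R / 2 + 1) = c * T `^ (n%:R / 2 + 1) * (N%:R / 2) by ring.
  apply: ler_wpM2r; first by rewrite divr_ge0.
  apply: ler_wpM2l; first exact: ltW.
  by apply: ler_powR => //; rewrite /ka /k; have := kappa_alpha; lra.
apply: (@le_trans _ _ (d%:E * \int[mu]_t (i t)%:E)%E).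
  apply: lee_wpmul2l; first by rewrite lee_fin ltW.
  by apply: dyadic_log_le; rewrite mulr_gt0.
rewrite -(integral_gauss_time (s := s) (origin n) mi ms i0); last first.
  move=> t; rewrite /i /s; have [ct|_] := ltP (2 * r0) t; last by rewrite !mul0r eqxx.
  by move=> _; rewrite invr_gt0 mulr_gt0// divr_gt0//; lra.
rewrite -ge0_integral_EFinMl ?(ltW d0)//; last 2 first.
- by mfun.
- by move=> w; rewrite mulr_ge0 ?gauss_ge0.
apply: ae_ge0_le_integral => //.
- by move=> w _; rewrite lee_fin mulr_ge0 ?(ltW d0)// mulr_ge0 ?gauss_ge0.
- by mfun.
- by move=> w _; rewrite lee_fin mulr_ge0// mulr_ge0 ?powR_ge0.
- by apply/measurable_EFinP; exact: mX.
apply: (@filterS _ _ FF _ _ _ UE) => w [Kw _] _; rewrite lee_fin vsub_origin /i Th.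
have rhs0 : 0 <= (0 < (w.2 : R))%R%:R * (U w `^ lambda * psi (k + 1 + alpha) T w).
  by rewrite mulr_ge0// mulr_ge0 ?powR_ge0.
have [w1|w1] := ltP (2 * r0) (w.2 : R); last by rewrite !mul0r mulr0.
have [w2|w2] := ltP (w.2 : R) (T / 2); last by rewrite !(mul0r, mulr0).
have t0 : 0 < (w.2 : R) by lra.
rewrite t0 !mul1r.
set t := (w.2 : R) in w1 w2 t0 *; set x := sqnorm w.1.
have x0 : 0 <= x by exact: sqnorm_ge0.
have r0' : 0 < T - t by lra.
have Ulow : m `^ lambda * (t `^ (lambda * e) * expR (- (lambda / t * x))) <= U w `^ lambda.
  have -> : m `^ lambda * (t `^ (lambda * e) * expR (- (lambda / t * x))) =
      (m * (t `^ e * expR (- x / t))) `^ lambda.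
    rewrite !powRM ?mulr_ge0 ?powR_ge0 ?expR_ge0 ?(ltW m0)// -powRrM -expRM [e * _]mulrC.
    by congr (_ * (_ * expR _)); rewrite /x; field; rewrite gt_eqF.
  apply: ge0_ler_powR; rewrite ?nnegrE ?mulr_ge0 ?powR_ge0 ?expR_ge0 ?(ltW m0) ?(ltW lambda0)//.
  by rewrite -lee_fin -Kw; apply: Hm; exact: ltW.
have plow : 2^-1 `^ ka * P1^-1 * T `^ (ka - n%:R / 2) * expR (- (x / t)) <= psi (k + 1 + alpha) T w.
  have -> : 2^-1 `^ ka * P1^-1 * T `^ (ka - n%:R / 2) * expR (- (x / t)) =
      (T / 2) `^ ka * (((4 * pi * T) `^ (n%:R / 2))^-1 * expR (- (x / t))).
    rewrite [T / 2]mulrC [(2^-1 * T) `^ _]powRM ?(ltW T0)// ?invr_ge0//.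
    rewrite (@powRM _ (4 * pi)) ?mulr_ge0 ?pi_ge0 ?(ltW T0)// invfM.
    rewrite (@powRD _ T ka) ?(gt_eqF T0) ?implybT// powRN /P1; ring.
  rewrite /psi -/t KtE// /gauss -/x.
  have -> : k + 1 + alpha - 1 = ka by rewrite /ka; ring.
  apply: ler_pM; rewrite ?mulr_ge0 ?invr_ge0 ?powR_ge0 ?expR_ge0//.
    by apply: ge0_ler_powR; rewrite ?nnegrE ?(ltW r0') ?divr_ge0 ?(ltW T0)//; lra.
  apply: ler_pM; rewrite ?invr_ge0 ?powR_ge0 ?expR_ge0//.
    have h1 : 0 < 4 * pi * (T - t) by rewrite mulr_gt0// mulr_gt0 ?pi_gt0.
    have h3 : 0 < 4 * pi * T by rewrite mulr_gt0// mulr_gt0 ?pi_gt0.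
    rewrite lef_pV2 ?posrE ?powR_gt0//.
    apply: ge0_ler_powR; rewrite ?nnegrE ?(ltW h1) ?(ltW h3)//.
    by apply: ler_wpM2l; [rewrite mulr_ge0 ?pi_ge0|rewrite gerBl ltW].
  rewrite ler_expR mulNr lerN2; apply: ler_wpM2l => //.
  by rewrite lef_pV2 ?posrE ?mulr_gt0//; lra.
apply: le_trans (ler_pM _ _ Ulow plow); last 2 first.
- by rewrite !mulr_ge0 ?powR_ge0 ?expR_ge0.
- by rewrite !mulr_ge0 ?powR_ge0 ?expR_ge0 ?invr_ge0 ?powR_ge0.
have tx : expR (- (lambda / t * x)) * expR (- (x / t)) =
    P2 * t `^ (n%:R / 2) * gauss w.1 (s t).
  rewrite -expRD; have -> : - (lambda / t * x) + - (x / t) = - ((lambda + 1) / t * x).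
    by field; rewrite gt_eqF.
  rewrite expR_sqnormE ?divr_gt0// /s /P2 -powRM ?divr_ge0 ?pi_ge0 ?(ltW l20) ?(ltW t0)//.
  by congr (_ `^ _ * _); field; rewrite (gt_eqF l20) (gt_eqF t0).
have -> : m `^ lambda * (t `^ (lambda * e) * expR (- (lambda / t * x))) *
    (2^-1 `^ ka * P1^-1 * T `^ (ka - n%:R / 2) * expR (- (x / t))) =
  m `^ lambda * (2^-1 `^ ka * P1^-1) * T `^ (ka - n%:R / 2) * t `^ (lambda * e) *
    (expR (- (lambda / t * x)) * expR (- (x / t))) by ring.
rewrite tx.
have -> : m `^ lambda * (2^-1 `^ ka * P1^-1) * T `^ (ka - n%:R / 2) * t `^ (lambda * e) *
    (P2 * t `^ (n%:R / 2) * gauss w.1 (s t)) =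
  d * ((t `^ (lambda * e) * t `^ (n%:R / 2)) * gauss w.1 (s t)) by rewrite /d /c; ring.
apply: ler_wpM2l; first exact: ltW.
apply: ler_wpM2r; first exact: gauss_ge0.
rewrite -powRD ?(gt_eqF t0) ?implybT// -powR_inv1 ?(ltW t0)//.
(* As t >= 1, it is enough that the exponent lambda e + n/2 be at least -1, and this is
   [alpha_lambda]. *)
apply: ler_powR; first by lra.
have -> : lambda * e = alpha * lambda - lambda - lambda * (n%:R / 2) by rewrite /e; ring.
have -> : alpha * lambda - lambda - lambda * (n%:R / 2) + n%:R / 2 =
  alpha * lambda - (n%:R / 2 + 1) * (lambda - 1) - 1 by ring.
by have := alpha_lambda; lra.
Qed.

Lemma nonexistence_superlinear : False.
Proof.
have [r0 [c [r01 c0 H]]] := superlinear_energy_ge.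
pose C := 2 * C' / (Ck * (n%:R / 2 + 1)).
have hn1 : 0 < n%:R / 2 + 1 :> R by rewrite ltr_wpDl.
have C0 : 0 <= C / c by exact: (divr_ge0 (divr_ge0 (mulr_ge0 (ler0n _ 2) (ltW C'0)) (ltW (mulr_gt0 Ck0 hn1))) (ltW c0)).
pose N := (Num.truncn (C / c)).+1.
have MN : C / c < N%:R by have /andP[] := Num.Theory.truncn_itv C0.
have T0 : 0 < 4 * r0 * 2 ^+ N by rewrite !mulr_gt0 ?exprn_gt0//; lra.
have := le_trans (H N) (superlinear_energy_le T0).
rewrite lee_fin ler_pM2r ?powR_gt0// -/C mulrC -ler_pdivlMr// => h.
by move: (lt_le_trans MN h); rewrite ltxx.
Qed.

End superlinear.

End supersolution.

(** * The dichotomy *)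

Section necessity.
Context {R : realType} (n : nat) (lambda alpha p : R).
Hypothesis n_ge1 : (1 <= n)%N.
Hypothesis lambda0 : 0 < lambda.
Hypothesis alpha_p : [/\ 1 < p, 0 < alpha & alpha < (n%:R + 2) / (2 * p)] \/
               [/\ p = 1, 0 < alpha & alpha <= (n%:R + 2) / 2].
Local Notation Z := (spacetime R n).
Local Notation V := (@spacetime_measure R n).

Lemma solution_exponents (u : Z -> R) : nonneg_solution p alpha lambda u ->
  ~ (u = cst 0 %[ae V]) ->
  1 <= lambda /\ (1 < lambda -> alpha < (n%:R + 2) / 2 * (1 - lambda^-1)).
Proof.
move=> [Yu u0 usup _] unt; have [a0 p1 _] := admissible_exponent alpha_p.
have p0 := lt_le_trans ltr01 p1.
have FF : Filter (nbhs (almost_everywhere V)) by typeclasses eauto.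
pose f := frac_heat p alpha u.
have [Xf uJ] : [set f | Xspace p f /\ u = J alpha f %[ae V]] f.
  by apply: xgetPex; have [g Xg ug] := Yu; exists g.
(* The source satisfies f >= u^lambda >= 0 only almost everywhere; F is a representative that is
   nonnegative everywhere and has the same potential. *)
pose F w := Num.max (f w) 0.
have F0 w : 0 <= F w by rewrite le_max lexx orbT.
have /(XspaceP _ p0)[mf fp] := Xf.
have mF : measurable_fun [set: Z] F by exact: measurable_maxr.
have fF : {ae V, forall w, F w = f w}.
  apply: (@filterS _ _ FF _ _ _ usup) => w h; apply/max_idPl.
  by apply: le_trans h; exact: powR_ge0.
have XF : Xspace p F.
  apply/(XspaceP _ p0); split => // T; apply: le_lt_trans (fp T).
  have mnF := measurable_norm_comp mF; have mnf := measurable_norm_comp mf.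
  apply: ge0_le_integral => //.
  - by mfun.
  - by mfun.
  move=> w _; rewrite lee_fin; apply: ler_wpM2l => //.
  apply: ge0_ler_powR; rewrite ?nnegrE ?(ltW p0)// ger0_norm//.
  by rewrite ge_max normr_ge0 ler_norm.
have KE z : (\int[V]_w (ker alpha z w * F w)%:E = \int[V]_w (ker alpha z w * f w)%:E)%E.
  apply: ae_eq_integral => //.
  - by mfun.
  - by mfun.
  by apply: (@filterS _ _ FF _ _ _ fF) => w -> _.
have Fnt : ~ {ae V, forall w, F w = 0}.
  move=> H; apply: unt; apply: (@filterS _ _ FF _ _ _ uJ) => z h _; rewrite h// JE -KE.
  rewrite (_ : (\int[V]_w _ = 0)%E)//; apply: etrans (integral0 V [set: Z]).
  apply: ae_eq_integral => //; first by mfun.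
  by apply: (@filterS _ _ FF _ _ _ H) => w -> _; rewrite mulr0.
have Fsup : {ae V, forall z, forall b, 0 <= b ->
    (b%:E <= \int[V]_w (ker alpha z w * F w)%:E)%E -> b `^ lambda <= F z}.
  have Kf := ker_abs_lty alpha_p XF.
  have H1 : {ae V, forall z, F z = f z /\ u z `^ lambda <= f z}.
    exact: (@filterI _ _ FF _ _ fF usup).
  apply: (@filterS3 _ _ FF _ _ _ _ _ Kf uJ H1) => z Kz uz [-> uf] b b0 bK.
  have Kfin : (\int[V]_w (ker alpha z w * F w)%:E)%E \is a fin_num.
    rewrite ge0_fin_numE; last by apply: integral_ge0 => w _; rewrite lee_fin mulr_ge0// ker_ge0.
    apply: le_lt_trans Kz; rewrite le_eqVlt; apply/orP; left; apply/eqP.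
    by apply: eq_integral => w _; rewrite ger0_norm.
  have bu : b <= u z by rewrite uz// JE -KE -lee_fin fineK.
  by apply: le_trans uf; apply: ge0_ler_powR; rewrite ?nnegrE ?(ltW lambda0)// (le_trans b0).
split.
  rewrite leNgt; apply/negP => l1.
  exact: (nonexistence_sublinear lambda0 alpha_p XF F0 Fnt Fsup l1 n_ge1).
move=> l1; rewrite ltNge; apply/negP => ha.
exact: (nonexistence_superlinear lambda0 alpha_p XF F0 Fnt Fsup l1 ha).
Qed.

End necessity.

Theorem theorem2p1 (R : realType) (n : nat) (lambda alpha p : R)
    (n_ge1 : (1 <= n)%N) (lambda_gt0 : 0 < lambda)
    (alpha_p : [/\ 1 < p, 0 < alpha & alpha < (n%:R + 2) / (2 * p)] \/
               [/\ p = 1, 0 < alpha & alpha <= (n%:R + 2) / 2]) :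
  (exists u : spacetime R n -> R,
     nonneg_solution p alpha lambda u /\
     ~ (u = cst 0 %[ae spacetime_measure n])) <->
  (regionB `|` regionD n p `|` regionE n p) (lambda, alpha).
Proof.
have [a0 p1 _] := admissible_exponent alpha_p.
split=> [[u [Su unt]]|].
  have [l1 H] := solution_exponents n_ge1 lambda_gt0 alpha_p Su unt.
  have [l1'|l1'|l1'] := ltgtP lambda 1.
  - by move: l1; rewrite leNgt l1'.
  - have hD := H l1'.
    (* For alpha > 0 the regions D and E together are the single condition alpha < (n + 2)/2 (1 -
       1/lambda), cut at the value with denominator 2 p; conversely E satisfies it because p >=
       1. *)
    by have [h|h] := leP ((n%:R + 2) / (2 * p) * (1 - lambda^-1)) alpha;
      [left; right|right].
  - by left; left.
move=> [[[/= l1 _]|[/= l1 _ ha]]|[/= l1 _ ha]].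
- exact: existence_linear.
- exact: existence_superlinear.
apply: existence_superlinear => //; apply: lt_le_trans ha _.
apply: ler_wpM2r; first by rewrite subr_ge0 invf_le1// ltW.
apply: ler_wpM2l; first by rewrite addr_ge0.
have p0 : 0 < p by apply: lt_le_trans p1.
by rewrite lef_pV2 ?posrE ?mulr_gt0//; lra.
Qed.
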